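(* Let $u$, $\bar u'$, $\widehat u'$ be the solutions of SSM, dMSM and dDSM respectively (defined in the context). Assume that $u_0$, $\bar u_0'$ and $\widehat u_0'$ are identically distributed Gaussian random variables, that $u_0$ is independent of $\gamma_0$, and that $\widehat u'_0$ is independent of $\widehat\gamma'_0$. Then, for every fixed $T>0$ and for each choice of sign $\pm$, as $\epsilon\to\infty$ the mean and variance of $u_T$ conditioned on $\gamma_0=\gamma_\pm$, and the mean and variance of $\widehat u'_T$ conditioned on $\widehat\gamma'_0=\gamma_\pm$, converge to the mean and variance of $\bar u'_T$ conditioned on $\bar\gamma'=\gamma_\pm$. Furthermore, let $\gamma_\infty$ denote a random variable with law $\frac{\lambda_-}{\lambda_-+\lambda_+}\delta_{\gamma_+}+\frac{\lambda_+}{\lambda_-+\lambda_+}\delta_{\gamma_-}$. If $\gamma_0$, $\bar\gamma'$ and $\widehat\gamma'_0$ are all distributed as $\gamma_\infty$, then the weights, means and variances of the components in the Gaussian mixture approximations of $u_T$ and of $\widehat u'_T$ converge, as $\epsilon\to\infty$, to those of $\bar u'_T$.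
   Context: All processes are real-valued. Fixed parameters: $\gamma_+>0>\gamma_-$, $\lambda_\pm>0$, $\sigma_u$, $\nu_\pm>0$, $\sigma_\pm$, $\mu_\pm\in\mathbb R$; the scale parameter is $\epsilon>0$. The laws of all initial conditions do not depend on $\epsilon$. $B_u,B_\gamma$ are independent standard Brownian motions, independent of the initial conditions and mode choices (and $B_u$ is independent of the switching process $\gamma$). SSM: $du=-\gamma u\,dt+\sigma_u\,dB_u$, where $\gamma(t)$ is a continuous-time Markov chain on $\{\gamma_+,\gamma_-\}$ with jump rate $\lambda_+/\epsilon$ from $\gamma_+$ to $\gamma_-$ and $\lambda_-/\epsilon$ from $\gamma_-$ to $\gamma_+$. Independence of $u_0$ and $\gamma_0$ is understood so that $u_0$ is independent of the whole path of $\gamma$. dMSM (dual-mode mean stochastic model): $d\bar u'=-\bar\gamma'\,\bar u'\,dt+\sigma_u\,dB_u$, where $\bar\gamma'$ is constant in time and random, equal to $\gamma_+$ with probability $\bar\rho_+$ and to $\gamma_-$ with probability $\bar\rho_-=1-\bar\rho_+$, independent of $\bar u_0'$. dDSM (dual-mode diffusive stochastic model): $d\widehat u'=-\widehat\gamma'\,\widehat u'\,dt+\sigma_u\,dB_u$, where, for all time, $\widehat\gamma'$ follows one of the two equations $d\widehat\gamma'=-\frac{\nu_\pm}{\epsilon}(\widehat\gamma'-\mu_\pm)\,dt+\frac{\sigma_\pm}{\sqrt\epsilon}\,dB_\gamma$, the mode $+$ being chosen with probability $\widehat\rho_+$ and the mode $-$ with probability $\widehat\rho_-=1-\widehat\rho_+$.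 Conditioning conventions: conditioning on $\gamma_0=\gamma_\pm$ means that the chain is started at $\gamma_\pm$; conditioning on $\widehat\gamma'_0=\gamma_\pm$ means that $\widehat\gamma'$ is started at the value $\gamma_\pm$ and follows the equation of the mode with the same sign $\pm$. Gaussian mixture approximation: the law of $u_T$ is the mixture $\mathbb P(u_T)=\sum_{\pm}\mathbb P(\gamma_0=\gamma_\pm)\,\mathbb P(u_T\mid\gamma_0=\gamma_\pm)$; its Gaussian mixture approximation is the two-component Gaussian mixture with weights $\mathbb P(\gamma_0=\gamma_\pm)$ in which each component $\mathbb P(u_T\mid\gamma_0=\gamma_\pm)$ is replaced by the Gaussian with the same mean and variance. It is defined in the same way for $\widehat u'_T$ with $\widehat\gamma'_0$ in place of $\gamma_0$. For $\bar u'_T$, with $\bar\gamma'$ in place of $\gamma_0$, the components are exactly Gaussian. *)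

(* Defs.v *)
From HB Require Import structures.
From mathcomp Require Import all_boot all_order all_algebra.
From mathcomp Require Import all_classical all_reals all_analysis.

Set Implicit Arguments.
Unset Strict Implicit.
Unset Printing Implicit Defensive.

Import Order.TTheory GRing.Theory Num.Theory.
Import numFieldNormedType.Exports.

Local Open Scope classical_set_scope.
Local Open Scope ring_scope.

(* The sign of a mode is a boolean: [true] stands for + and [false] for -, so
   that a pair of parameters (x_+, x_-) is a function [x : bool -> R] and
   [~~ s] is the opposite sign.  Processes are indexed by all of R, but only
   the times t >= 0 are ever constrained or used.  Path properties are required
   almost surely. *)

Section laws_and_independence.
Context {d : measure_display} {T : measurableType d} {R : realType}.
Variable P : probability T R.

Definition has_law (X : T -> R) (nu : set R -> \bar R) : Prop :=
  forall B : set R, measurable B -> P (X @^-1` B) = nu B.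

Definition process_sigma (X : R -> {RV P >-> R}) : set (set T) :=
  <<s \bigcup_(t in [set t : R | 0 <= t]) g_sigma_algebra_preimage (X t) >>.

Definition mutual_indep (I : finType) (F : I -> set (set T)) : Prop :=
  forall (J : {set I}) (A : I -> set T),
    (forall i, i \in J -> F i (A i)) ->
    P (\bigcap_(i in [set` J]) A i) = (\prod_(i in J) P (A i))%E.

Definition indep_systems (Fs : seq (set (set T))) : Prop :=
  mutual_indep (fun i : 'I_(size Fs) => nth set0 Fs i).

(* Elementary conditioning on an event A with P A > 0; the variance follows the
   shape of the library's [variance]. *)
Definition cond_mean (A : set T) (X : T -> R) : \bar R :=
  ((\int[P]_(w in A) (X w)%:E) * ((fine (P A))^-1)%:E)%E.

Definition cond_var (A : set T) (X : T -> R) : \bar R :=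
  cond_mean A (fun w => (X w - fine (cond_mean A X)) ^+ 2).

End laws_and_independence.

(* N(m, v), parametrized by the variance v >= 0; the library's [normal_prob] is
   parametrized by the standard deviation and is not a Dirac mass when the
   latter is 0. *)
Definition gaussian_law {R : realType} (m v : R) : set R -> \bar R :=
  fun B => if v == 0 then \d_m B else normal_prob m (Num.sqrt v) B.

Section processes.
Context {d : measure_display} {T : measurableType d} {R : realType}.
Variable P : probability T R.

Definition continuous_path (X : R -> {RV P >-> R}) (w : T) : Prop :=
  {within [set t : R | 0 <= t], continuous (fun t => X t w)}.

Definition brownian (W : R -> {RV P >-> R}) : Prop :=
  [/\ {ae P, forall w, W 0 w = 0},
      {ae P, forall w, continuous_path W w},
      forall s t : R, 0 <= s -> s < t ->
        has_law P (fun w => W t w - W s w) (gaussian_law 0 (t - s))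
    & forall (n : nat) (t : nat -> R),
        0 <= t 0%N -> (forall i, t i <= t i.+1) ->
        mutual_indep P (fun i : 'I_n =>
          g_sigma_algebra_preimage (fun w => W (t i.+1) w - W (t i) w))].

(* Strong solution of dX = b dt + c dW in integrated form.  The noise is
   additive (c does not depend on time), so that the stochastic integral of c
   is c * W. *)
Definition additive_sde (X : R -> {RV P >-> R}) (b : R -> T -> R) (c : T -> R)
    (W : R -> {RV P >-> R}) : Prop :=
  {ae P, forall w,
    continuous_path X w /\
    forall t : R, 0 <= t ->
      lebesgue_measure.-integrable `[0, t] (fun s => (b s w)%:E) /\
      X t w = X 0 w + \int[lebesgue_measure]_(s in `[0, t]) b s w
              + c w * W t w}.

End processes.

Section two_state_chain.
Context {R : realType}.

(* Transition probabilities p t s s' from s to s' in time t, with jump rate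
   q s from s to the other state. *)
Definition transition_function (p : R -> bool -> bool -> R) : Prop :=
  [/\ forall t s s', 0 <= t -> 0 <= p t s s',
      forall t s, 0 <= t -> \sum_(s' : bool) p t s s' = 1,
      forall s s', p 0 s s' = (s == s')%:R
    & forall t1 t2 s s', 0 <= t1 -> 0 <= t2 ->
        p (t1 + t2) s s' = \sum_(r : bool) p t1 s r * p t2 r s'].

Definition has_jump_rates (p : R -> bool -> bool -> R) (q : bool -> R) : Prop :=
  forall s, p h s (~~ s) / h @[h --> 0^'+] --> q s.

Context {d : measure_display} {T : measurableType d}.
Variable P : probability T R.

Definition markov_chain (state : bool -> R) (q : bool -> R)
    (X : R -> {RV P >-> R}) : Prop :=
  {ae P, forall w, forall t : R, 0 <= t ->
     (exists s, X t w = state s) /\ X r w @[r --> t^'+] --> X t w} /\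
  exists p : R -> bool -> bool -> R,
  [/\ transition_function p, has_jump_rates p q
    & forall (n : nat) (t : nat -> R) (s : nat -> bool),
        0 <= t 0%N -> (forall i, t i < t i.+1) ->
        P [set w | forall i, (i <= n.+1)%N -> X (t i) w = state (s i)] =
        (P [set w | forall i, (i <= n)%N -> X (t i) w = state (s i)]
         * (p (t n.+1 - t n) (s n) (s n.+1))%:E)%E].

End two_state_chain.

Section models.
Context {d : measure_display} {T : measurableType d} {R : realType}.
Variable P : probability T R.

Definition is_SSM (gam lam : bool -> R) (sigu eps : R)
    (u g Bu : R -> {RV P >-> R}) : Prop :=
  [/\ brownian Bu,
      markov_chain gam (fun s => lam s / eps) g,
      indep_systems P [:: g_sigma_algebra_preimage (u 0);
                          process_sigma g; process_sigma Bu]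
    & additive_sde u (fun t w => - g t w * u t w) (fun=> sigu) Bu].

Definition is_dMSM (gam rho : bool -> R) (sigu : R)
    (u : R -> {RV P >-> R}) (g : {RV P >-> R}) (Bu : R -> {RV P >-> R}) : Prop :=
  [/\ brownian Bu,
      forall s, P [set w | g w = gam s] = (rho s)%:E,
      indep_systems P [:: g_sigma_algebra_preimage (u 0);
                          g_sigma_algebra_preimage g; process_sigma Bu]
    & additive_sde u (fun t w => - g w * u t w) (fun=> sigu) Bu].

(* M is the randomly chosen mode.  It may depend on the initial value [g 0]. *)
Definition is_dDSM (nu mu sig rho : bool -> R) (sigu eps : R)
    (u g : R -> {RV P >-> R}) (M : {RV P >-> bool})
    (Bu Bg : R -> {RV P >-> R}) : Prop :=
  [/\ brownian Bu /\ brownian Bg,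
      forall s, P [set w | M w = s] = (rho s)%:E,
      indep_systems P [:: g_sigma_algebra_preimage (u 0);
                          g_sigma_preimageU (g 0) M;
                          process_sigma Bu; process_sigma Bg],
      additive_sde g (fun t w => - (nu (M w) / eps) * (g t w - mu (M w)))
        (fun w => sig (M w) / Num.sqrt eps) Bg
    & additive_sde u (fun t w => - g t w * u t w) (fun=> sigu) Bu].

(* The conditioning event is {gamma = gamma_s} for a switching process or a
   constant damping; for the dDSM the mode must moreover have the sign of the
   starting value.  The model started deterministically at gamma_s is the case
   in which this event has probability 1. *)
Definition starts_at (gam : bool -> R) (g0 : T -> R) (s : bool) : set T :=
  [set w | g0 w = gam s].

Definition starts_at_mode (gam : bool -> R) (g0 : T -> R) (M : T -> bool)
    (s : bool) : set T :=
  [set w | g0 w = gam s /\ M w = s].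

End models.

Definition gamma_infty_law {R : realType} (gam lam : bool -> R) :
    set R -> \bar R :=
  fun B => ((lam false / (lam false + lam true))%:E * \d_(gam true) B
          + (lam true / (lam false + lam true))%:E * \d_(gam false) B)%E.

(* A two-component Gaussian mixture, given by its parameters. *)
Record gaussian_mixture (R : realType) := GaussianMixture {
  gm_weight : bool -> \bar R ;
  gm_mean : bool -> \bar R ;
  gm_var : bool -> \bar R }.

(* W s is the event that gives its weight to the component s, and C s is the
   event that the component s is conditioned on; they differ only for the
   dDSM. *)
Definition gm_approx {d : measure_display} {T : measurableType d}
    {R : realType} (P : probability T R) (W C : bool -> set T) (X : T -> R) :
    gaussian_mixture R :=
  {| gm_weight := fun s => P (W s);
     gm_mean := fun s => cond_mean P (C s) X;
     gm_var := fun s => cond_var P (C s) X |}.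

(* Main.v *)
Require Import Defs.
From HB Require Import structures.
From mathcomp Require Import all_boot all_order all_algebra.
From mathcomp Require Import all_classical all_reals all_analysis.
From mathcomp Require Import measurable_realfun ring lra.

Set Implicit Arguments.
Unset Strict Implicit.
Unset Printing Implicit Defensive.

Import Order.TTheory GRing.Theory Num.Theory.
Import numFieldNormedType.Exports.

Local Open Scope classical_set_scope.
Local Open Scope ring_scope.

(* The solution of each model is compared with the solution [F] of the equation
   whose damping is frozen at its initial value [gamma_s].  By variation of
   constants, [F] is an explicit functional of the initial value and of the noise,
   and by Fubini its first two moments conditional on the mode only depend on
   their laws: they are the same for all [eps] and for the three models, and for
   dMSM the solution is [F] itself.

   It remains to bound the error in conditional mean square by [O(1 / eps)], as the
   mean and the variance are stable under such perturbations.  For SSM the error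
   vanishes unless the chain jumps before [T], which has conditional probability at
   most [T lambda_s / eps] and is independent of the noise; on that event a crude
   Gronwall bound suffices.  For dDSM the damping stays within [eps^(-1/2) k] of
   [gamma_s], where [k] is affine in [|B_T|] and in the integral of [|B|], so Gronwall
   bounds the error by [eps^(-1/2)] times exponential functionals of Brownian paths
   that are linear in the exponent, hence integrable uniformly in [eps >= 1]. *)

(** * Integral equations on [[0, T]]: Gronwall's inequality and variation of constants *)

Section calculus.
Context {R : realType}.
Implicit Types (f g h k u y W : R -> R) (a b c t T : R).
Notation mu := (@lebesgue_measure R).

(** No stochastic calculus enters. The noise is additive, so each equation is read path by path as
    an integral equation; apart from its independence of the initial value and of the mode, the
    noise matters only through the Gaussian laws of its values and increments.

    The obstacle is that the damping multiplies the solution, so that Gronwall puts its time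
    integral in an exponent, and for dDSM this damping is an unbounded path. Products of functionals
    of [W], of the damping noise and of the initial value are therefore split, by inequalities such
    as [x y <= x^2 + y^2], into sums of functionals of one of them each, whose expectations follow
    from one-dimensional laws. For SSM the damping is bounded, and the only product left is that of
    the jump indicator with such a sum. *)

Lemma continuous_itv_integrable f t : continuous f ->
  mu.-integrable `[0, t] (EFin \o f).
Proof.
move=> cf; apply: continuous_compact_integrable; first exact: segment_compact.
exact: continuous_subspaceT.
Qed.

Lemma continuousM_fun f g : continuous f -> continuous g ->
  continuous (fun x => f x * g x).
Proof. by move=> cf cg x; apply: cvgM; [exact: cf|exact: cg]. Qed.

Lemma continuousB_fun f g : continuous f -> continuous g ->
  continuous (fun x => f x - g x).
Proof. by move=> cf cg x; apply: cvgB; [exact: cf|exact: cg]. Qed.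

Lemma continuousD_fun f g : continuous f -> continuous g ->
  continuous (fun x => f x + g x).
Proof. by move=> cf cg x; apply: cvgD; [exact: cf|exact: cg]. Qed.

Lemma continuous_norm_fun f : continuous f -> continuous (fun x => `|f x|).
Proof. by move=> cf x; apply: cvg_norm; exact: cf. Qed.

Lemma continuous_expR_fun f : continuous f -> continuous (fun x => expR (f x)).
Proof.
by move=> cf x; apply: (@continuous_comp _ _ _ f expR);
  [exact: cf|exact: continuous_expR].
Qed.

Lemma Rintegral_itv0 f : \int[mu]_(s in `[0, 0]) f s = 0.
Proof. by rewrite set_itv1 Rintegral_set1. Qed.

(** Since [f] is continuous on all of [R], the fundamental theorem on [[0, x + 1]] gives the
    derivative at every [x > 0], the endpoint [T] included. Only the right limit at 0 needs the
    continuity of an integral in its upper bound. *)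
Lemma primitive_derivable f a T : continuous f -> 0 < T ->
  let F := fun t => a + \int[mu]_(s in `[0, t]) f s in
  derivable_oo_LRcontinuous F 0 T /\ {in `]0, T[, derive1 F =1 f}.
Proof.
move=> cf T0 F.
have dF x : 0 < x -> derivable F x 1 /\ derive1 F x = f x.
  move=> x0.
  have x1 : x < x + 1 by rewrite ltrDl.
  have [dI eI] := continuous_FTC1_closed x1 (continuous_itv_integrable _ cf) x0 (cf x).
  split; first by apply: derivableD; [exact: derivable_cst|exact: dI].
  rewrite derive1E deriveD; [|exact: derivable_cst|exact: dI].
  by rewrite derive_cst add0r -derive1E.
have T1 : 0 <= T + 1 by rewrite ltW// addr_gt0.
have cI := parameterized_integral_continuous T1
  (continuous_itv_integrable (T + 1) cf).
have T1' : 0 < T + 1 by rewrite addr_gt0.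
have /continuous_within_itvP := cI => /(_ T1')[_ cI0 _].
split.
- split.
  + by move=> x; rewrite in_itv/= => /andP[x0 _]; have [] := dF x x0.
  + apply: cvgD; first exact: cvg_cst.
    exact: cI0.
  + have [dFT _] := dF T T0.
    apply: cvg_at_left_filter.
    by have /derivable1_diffP/differentiable_continuous := dFT.
- by move=> x; rewrite in_itv/= => /andP[x0 _]; have [] := dF x x0.
Qed.

Lemma expR_derivable f a T : continuous f -> 0 < T ->
  let F := fun t => expR (a * \int[mu]_(s in `[0, t]) f s) in
  derivable_oo_LRcontinuous F 0 T /\
  {in `]0, T[, derive1 F =1 fun t => a * f t * F t}.
Proof.
move=> cf T0 F.
have [[dI c0 cT] eI] := primitive_derivable 0 cf T0.
have EI : (fun t => 0 + \int[mu]_(s in `[0, t]) f s) =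
   (fun t => \int[mu]_(s in `[0, t]) f s) by apply/funext => t; rewrite add0r.
rewrite EI !add0r in dI c0 cT eI.
have cE : continuous (fun z : R => expR (a * z)).
  by apply: continuous_expR_fun => x; exact: mulrl_continuous.

have hD x : x \in `]0, T[ -> is_derive x 1 F (F x * (a * f x)).
  move=> xT; apply: (@is_derive1_comp _ expR
    (fun t => a * \int[mu]_(s in `[0, t]) f s)).
  apply: is_deriveZ; apply: DeriveDef; first exact: dI.
  by rewrite -derive1E eI.
split.
- split.
  + by move=> x xT; have [] := hD x xT.
  + apply: (@cvg_comp _ _ _ (fun t => \int[mu]_(s in `[0, t]) f s)
      (fun z => expR (a * z)) _ _ _ c0); exact: cE.
  + apply: (@cvg_comp _ _ _ (fun t => \int[mu]_(s in `[0, t]) f s)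
      (fun z => expR (a * z)) _ _ _ cT); exact: cE.
- by move=> x xT; have := hD x xT => hx; rewrite derive1E derive_val mulrC.
Qed.

Lemma expRM_derivable a T : 0 < T ->
  let F := fun t => expR (a * t) in
  derivable_oo_LRcontinuous F 0 T /\
  {in `]0, T[, derive1 F =1 fun t => a * F t}.
Proof.
move=> T0 F.
have hD (x : R) : is_derive x 1 F (F x * (a * 1)).
  exact: (@is_derive1_comp _ expR (fun t => a * t)).
have cF : continuous F.
  by apply: continuous_expR_fun => x; exact: mulrl_continuous.
split.
- split; [by move=> x _; have [] := hD x | |].
    by apply: cvg_at_right_filter; exact: cF.
  by apply: cvg_at_left_filter; exact: cF.
- by move=> x _; have := hD x => hx; rewrite derive1E derive_val mulr1 mulrC.
Qed.

(** With [P t = a + \int k y] and [E t = exp (- \int k)], the product [E P] has derivative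
    [E k (y - P) <= 0], so it never exceeds its initial value [a]. The monotonicity is obtained in
    integrated form, by parts on [[0, T]]. *)
Lemma gronwall k y a T : 0 < T -> continuous k -> continuous y ->
  (forall t, 0 <= k t) ->
  (forall t, 0 <= t <= T -> y t <= a + \int[mu]_(s in `[0, t]) (k s * y s)) ->
  y T <= a * expR (\int[mu]_(s in `[0, T]) k s).
Proof.
move=> T0 ck cy k0 hy.
have cky := continuousM_fun ck cy.
have [dP eP] := primitive_derivable a cky T0.
have [dE eE] := expR_derivable (-1) ck T0.
set P := (fun t => a + _) in dP eP.
set E := (fun t => expR (-1 * _)) in dE eE.
have cP : {within `[0, T], continuous P} by exact: derivable_oo_LRcontinuous_within.
have cE : {within `[0, T], continuous E} by exact: derivable_oo_LRcontinuous_within.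
have cE' : {within `[0, T], continuous (fun t => -1 * k t * E t)}.
  move=> x; apply: cvgM; last exact: cE.
  apply: cvgM; first exact: cvg_cst.
  exact: (@continuous_subspaceT _ _ `[0, T] _ ck).
have := Rintegration_by_parts T0 cE' dE eE (continuous_subspaceT cky) dP eP.
have E0 t : 0 <= E t by exact: expR_ge0.
have int_cvg h : {within `[0, T], continuous h} -> mu.-integrable `[0, T] (EFin \o h).
  by move=> ch; apply: continuous_compact_integrable => //; exact: segment_compact.
have i1 : mu.-integrable `[0, T] (EFin \o (fun x => E x * (k x * y x))).
  apply: int_cvg => x; apply: cvgM; first exact: cE.
  exact: (@continuous_subspaceT _ _ `[0, T] _ cky).
have i2 : mu.-integrable `[0, T] (EFin \o (fun x => -1 * k x * E x * P x)).
  by apply: int_cvg => x; apply: cvgM; [exact: cE'|exact: cP].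
have : \int[mu]_(x in `[0, T]) (E x * (k x * y x)) +
       \int[mu]_(x in `[0, T]) (-1 * k x * E x * P x) <= 0.
  rewrite -RintegralD// -[leRHS](mul0r (fine (mu `[0, T]))) -Rintegral_cst//.
  apply: le_Rintegral => //.
  - by apply: eq_integrable (integrableD _ i1 i2) => // x _ /=; rewrite EFinD.
  - by apply: int_cvg => x; exact: cvg_cst.
  - move=> t /=; rewrite in_itv/= => tT.
    rewrite (_ : _ + _ = E t * k t * (y t - P t)); last by ring.
    by rewrite mulr_ge0_le0 ?mulr_ge0// subr_le0 hy.
move=> h1 h2; move: h1; rewrite h2 subrK subr_le0.
rewrite {2}/P {1 2}/E !Rintegral_itv0 addr0 mulr0 expR0 mul1r mulN1r expRN.
rewrite mulrC ler_pdivrMr ?expR_gt0// => PT.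
by apply: le_trans PT; apply: hy; rewrite lexx ltW.
Qed.

(** The path [u - sig * W] is differentiable although [u] is not, so it can be multiplied by
    [exp (gam t)] and integrated by parts. The factor of [sig] is the stochastic convolution of
    [exp (- gam (T - s))] with [dW], written without a stochastic integral; the last term is the
    error due to a damping other than [gam]. *)
Lemma variation_of_constants g u W (gam sig T : R) : 0 < T ->
  continuous g -> continuous u -> continuous W ->
  (forall t, 0 <= t <= T ->
    u t = u 0 - \int[mu]_(s in `[0, t]) (g s * u s) + sig * W t) ->
  u T = expR (- gam * T) * u 0
    + sig * (W T - gam * \int[mu]_(s in `[0, T]) (expR (- gam * (T - s)) * W s))
    - \int[mu]_(s in `[0, T]) (expR (- gam * (T - s)) * ((g s - gam) * u s)).
Proof.
move=> T0 cg cu cW hu.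
have cgu : continuous (fun s => - (g s * u s)).
  by move=> x; apply: cvgN; exact: continuousM_fun.
have [dY eY] := primitive_derivable (u 0) cgu T0.
have [dE eE] := expRM_derivable gam T0.
set Y := (fun t => u 0 + _) in dY eY.
set E := (fun t => expR (gam * t)) in dE eE.
have cE : continuous E.
  by apply: continuous_expR_fun => x; exact: mulrl_continuous.
have cE' : continuous (fun t => gam * E t).
  by apply: continuousM_fun => // x; exact: cvg_cst.
have YE t : 0 <= t <= T -> Y t = u t - sig * W t.
  move=> /hu ->; rewrite /Y addrK; congr (_ + _).
  rewrite -mulN1r -RintegralZl//; last first.
    by apply: continuous_itv_integrable; exact: continuousM_fun.
  by apply: eq_Rintegral => x _; rewrite mulN1r.
have := Rintegration_by_parts T0 (continuous_subspaceT cE') dE eE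
  (continuous_subspaceT cgu) dY eY.
rewrite /= {3}/E {2}/Y Rintegral_itv0 addr0 mulr0 expR0 mul1r.
rewrite YE ?lexx ?ltW//.
rewrite [X in _ - X](@eq_Rintegral _ _ _ mu _ (fun x => E x * (gam * u x) - gam * sig * (E x * W x))); last first.
  by move=> x; rewrite inE/= in_itv/= => xT; rewrite YE//; ring.
have i1 : mu.-integrable `[0, T] (EFin \o (fun x => E x * (gam * u x))).
  apply: continuous_itv_integrable; apply: continuousM_fun => //.
  by apply: continuousM_fun => // x; exact: cvg_cst.
have i2 : mu.-integrable `[0, T] (EFin \o (fun x => E x * W x)).
  by apply: continuous_itv_integrable; apply: continuousM_fun.
have i3 : mu.-integrable `[0, T] (EFin \o (fun x => E x * - (g x * u x))).
  by apply: continuous_itv_integrable; apply: continuousM_fun.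
have ET : E T != 0 by rewrite gt_eqF// expR_gt0.
have EE s : expR (- gam * (T - s)) = (E T)^-1 * E s.
  by rewrite /E -expRN -expRD; congr expR; ring.
have EI f : continuous f -> \int[mu]_(s in `[0, T]) (expR (- gam * (T - s)) * f s) =
    (E T)^-1 * \int[mu]_(s in `[0, T]) (E s * f s).
  move=> cf; rewrite -RintegralZl//; last first.
    by apply: continuous_itv_integrable; apply: continuousM_fun.
  by apply: eq_Rintegral => x _; rewrite EE mulrA.
have cd : continuous (fun s => (g s - gam) * u s).
  by apply: continuousM_fun => //; apply: continuousB_fun => // x; exact: cvg_cst.
rewrite (EI _ cW) (EI _ cd) mulNr expRN -/(E T).
rewrite RintegralB//; last first.
  apply: continuous_itv_integrable; apply: continuousM_fun; first by move=> x; exact: cvg_cst.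
  exact: continuousM_fun.
rewrite (RintegralZl _ _ i2)//.
have -> : \int[mu]_(s in `[0, T]) (E s * ((g s - gam) * u s)) =
  (- \int[mu]_(s in `[0, T]) (E s * - (g s * u s)))
  - \int[mu]_(s in `[0, T]) (E s * (gam * u s)).
  rewrite -[X in _ = X - _]mulN1r -RintegralZl// -RintegralB//; last first.
    by apply: continuous_itv_integrable; apply: continuousM_fun;
      [move=> x; exact: cvg_cst|apply: continuousM_fun].
  by apply: eq_Rintegral => x _; ring.
move=> h.
by rewrite h; field.
Qed.

Lemma Rintegral_itv_mono f t T : 0 <= t <= T -> continuous f ->
  (forall s, 0 <= f s) ->
  \int[mu]_(s in `[0, t]) f s <= \int[mu]_(s in `[0, T]) f s.
Proof.
move=> /andP[t0 tT] cf f0.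
have st : `[0, t] `<=` `[0, T].
  by apply: subset_itvl; rewrite bnd_simp.
apply: fine_le.
- exact/integrable_fin_num/continuous_itv_integrable.
- exact/integrable_fin_num/continuous_itv_integrable.
- apply: ge0_subset_integral => //.
    by apply/measurable_EFinP; apply: measurable_funTS; exact: continuous_measurable_fun.
  by move=> x _; rewrite lee_fin.
Qed.

(** Gronwall is applied to [|u - sig * W|]. The damping [g] may jump, as it does in SSM, hence the
    continuous majorant [k] and the integrability of [g * u] as part of the hypothesis. *)
Lemma damped_bound g k u W (sig T : R) : 0 < T ->
  continuous k -> (forall t, 0 <= k t) -> continuous u -> continuous W ->
  (forall s, 0 <= s <= T -> `|g s| <= k s) ->
  (forall t, 0 <= t <= T ->
    mu.-integrable `[0, t] (EFin \o (fun s => g s * u s)) /\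
    u t = u 0 - \int[mu]_(s in `[0, t]) (g s * u s) + sig * W t) ->
  forall t, 0 <= t <= T -> `|u t - sig * W t| <=
    (`|u 0| + `|sig| * \int[mu]_(s in `[0, T]) (k s * `|W s|))
    * expR (\int[mu]_(s in `[0, T]) k s).
Proof.
move=> T0 ck k0 cu cW gk hu.
pose y s := `|u s - sig * W s|.
have cW' : continuous (fun s => `|W s|) by exact: continuous_norm_fun.
have cs : continuous (fun s => sig * W s).
  by apply: continuousM_fun => // x; exact: cvg_cst.
have cy : continuous y by apply: continuous_norm_fun; exact: continuousB_fun.
have ckW := continuousM_fun ck cW'.
have kW0 s : 0 <= k s * `|W s| by rewrite mulr_ge0.
have cky := continuousM_fun ck cy.
have hy t : 0 <= t <= T -> y t <= (`|u 0| +
    `|sig| * \int[mu]_(s in `[0, T]) (k s * `|W s|)) + \int[mu]_(s in `[0, t]) (k s * y s).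
  move=> tT; have [ig ut] := hu t tT.
  rewrite {1}/y ut addrK -addrA; apply: le_trans (ler_normB _ _) _; rewrite lerD2l.
  apply: le_trans (le_normr_Rintegral _ ig) _ => //.
  apply: (@le_trans _ _ (\int[mu]_(s in `[0, t]) (`|sig| * (k s * `|W s|) + k s * y s))).
    apply: le_Rintegral => //.
    - by apply: eq_integrable (integrable_norm ig).
    - apply: continuous_itv_integrable; apply: continuousD_fun => //.
      by apply: continuousM_fun => // x; exact: cvg_cst.
    move=> s /=; rewrite in_itv/= => /andP[s0 st].
    rewrite normrM; apply: (@le_trans _ _ (k s * `|u s|)).
      by rewrite ler_wpM2r// gk// s0 (le_trans st)//; case/andP: tT.
    rewrite mulrCA -mulrDr ler_wpM2l// -normrM /y addrC.
    by have := ler_normD (u s - sig * W s) (sig * W s); rewrite subrK.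
  rewrite RintegralD//; last 2 first.
  - apply: continuous_itv_integrable.
    by apply: continuousM_fun => // x; exact: cvg_cst.
  - exact: continuous_itv_integrable.
  rewrite lerD2r RintegralZl//; last exact: continuous_itv_integrable.
  by rewrite ler_wpM2l// Rintegral_itv_mono.
have B0 : 0 <= `|u 0| + `|sig| * \int[mu]_(s in `[0, T]) (k s * `|W s|).
  by rewrite addr_ge0// mulr_ge0// Rintegral_ge0.
move=> t /andP[]; rewrite le_eqVlt => /orP[/eqP <- _|t0 tT].
  have [_ e0] := hu 0 (introT andP (conj (lexx 0) (ltW T0))).
  rewrite {1}e0 Rintegral_itv0 subr0 addrK.
  apply: (@le_trans _ _ (`|u 0| + `|sig| * \int[mu]_(s in `[0, T]) (k s * `|W s|))).
    by rewrite lerDl mulr_ge0// Rintegral_ge0.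
  by rewrite ler_peMr// -[leLHS]expR0 ler_expR Rintegral_ge0.
apply: (@le_trans _ _ ((`|u 0| + `|sig| * \int[mu]_(s in `[0, T]) (k s * `|W s|))
   * expR (\int[mu]_(s in `[0, t]) k s))).
  apply: (gronwall t0 ck cy k0) => s /andP[s0 st].
  by apply: hy; rewrite s0 (le_trans st).
by rewrite ler_wpM2l// ler_expR Rintegral_itv_mono// ltW.
Qed.

(** The projection onto [[0, T]]. Composing a path that is continuous on the nonnegative times with
    it gives a path continuous on all of [R] and unchanged on [[0, T]]. *)
Definition clip T t := Num.max 0 (Num.min t T).

Lemma clip_id T t : 0 <= t <= T -> clip T t = t.
Proof. by move=> /andP[t0 tT]; rewrite /clip min_l// max_r. Qed.

Lemma clip_itv T t : 0 <= T -> 0 <= clip T t <= T.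
Proof. by move=> T0; rewrite /clip le_max lexx/= ge_max T0 ge_min lexx orbT. Qed.

Lemma continuous_clip T : continuous (clip T).
Proof.
have ccst (r : R) : continuous (fun x : R => r) by exact: cst_continuous.
move=> x; apply: (@continuous_max _ _ (fun=> 0) (fun t => Num.min t T)).
  exact: ccst.
apply: (@continuous_min _ _ id (fun=> T)); last exact: ccst.
exact: cvg_id.
Qed.

Lemma continuous_clip_comp T f : 0 <= T ->
  {within [set t | 0 <= t], continuous f} -> continuous (fun t => f (clip T t)).
Proof.
move=> T0 /subspace_continuousP cf x.
have /andP[c0 _] := clip_itv x T0.
apply: (@cvg_comp _ _ _ (clip T) f _ _ _ _ (cf _ c0)).
move=> B wB.
have : nbhs x (clip T @^-1` [set z | 0 <= z -> B z]) by exact: continuous_clip.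
apply: filterS => y /=; apply.
by have /andP[] := clip_itv y T0.
Qed.

End calculus.

(** * Integration against a restricted measure and against a density *)

Section measure_facts.
Local Open Scope ereal_scope.
Context {d : measure_display} {T : measurableType d} {R : realType}.

Lemma integral_mrestr (P : {measure set T -> \bar R}) (A : set T)
    (mA : measurable A) (f : T -> \bar R) : measurable_fun setT f ->
  \int[mrestr P mA]_x f x = \int[P]_(x in A) f x.
Proof.
move=> mf.
have mAC : measurable (~` A) by exact: measurableC.
have AC0 : mrestr P mA (~` A) = 0 by rewrite /mrestr setICl measure0.
have H (g : T -> \bar R) : measurable_fun setT g -> (forall x, 0 <= g x) ->
    \int[mrestr P mA]_x g x = \int[P]_(x in A) g x.
  move=> mg g0; rewrite -(setUv A) ge0_integral_setU//; last 2 first.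
    by rewrite setUv.
    by apply/disj_setPS; rewrite setICr.
  rewrite [X in _ + X]null_set_integral//; last exact: measurable_funTS.
  rewrite adde0; apply: eq_measure_integral => B mB BA.
  by rewrite /= /mrestr (setIidl BA).
rewrite [LHS]integralE [RHS]integralE !H//.
  exact: measurable_funeneg.
exact: measurable_funepos.
Qed.

Import HBNNSimple.

(** True for indicators by [m2E], hence for simple functions by linearity, hence in general by
    monotone convergence. *)
Lemma ge0_integral_density (m1 m2 : {measure set T -> \bar R}) (g : T -> R)
    (f : T -> \bar R) :
  measurable_fun setT g -> (forall x, 0 <= g x)%R ->
  (forall S, measurable S -> m2 S = \int[m1]_(x in S) (g x)%:E) ->
  measurable_fun setT f -> (forall x, 0 <= f x) ->
  \int[m2]_x f x = \int[m1]_x (f x * (g x)%:E).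
Proof.
move=> mg g0 m2E mf f0.
have mg' : measurable_fun setT (EFin \o g) by exact/measurable_EFinP.
have simple (h : {nnsfun T >-> R}) :
    \int[m2]_x (h x)%:E = \int[m1]_x ((h x)%:E * (g x)%:E).
  under [LHS]eq_integral do rewrite fimfunE -fsumEFin//.
  rewrite [LHS]ge0_integral_fsum//; last 2 first.
    by move=> r; exact/measurable_EFinP/measurableT_comp.
    by move=> n x _; rewrite EFinM nnfun_muleindic_ge0.
  under [RHS]eq_integral.
    move=> x _; rewrite fimfunE -fsumEFin// muleC ge0_mule_fsumr; last first.
      by move=> r; rewrite EFinM nnfun_muleindic_ge0.
    over.
  rewrite [RHS]ge0_integral_fsum//; last 2 first.
    move=> r; apply: emeasurable_funM => //.
    by apply/measurable_EFinP; apply/measurableT_comp => //.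
    by move=> n x _; rewrite mule_ge0 ?[(0 <= (g x)%:E)%E]lee_fin//= EFinM nnfun_muleindic_ge0.
  apply: eq_fsbigr => r rh.
  rewrite integralZl_indic_nnsfun//= integral_indic// setIT m2E//.
  have r0 : (0 <= r)%R.
    by move: rh; rewrite inE/= => -[x _ <-].
  under [RHS]eq_integral => x _ do rewrite EFinM muleCA.
  rewrite [RHS]ge0_integralZl//; last 2 first.
    - apply: emeasurable_funM => //.
      by apply/measurable_EFinP; exact: measurable_indic.
    - by move=> x _; rewrite mule_ge0// lee_fin.
  congr (_ * _); rewrite integral_mkcond; apply: eq_integral => x _.
  rewrite patchE indicE; case: ifPn => _; first by rewrite mule1.
  by rewrite mule0.
pose f_ := nnsfun_approx measurableT mf.
transitivity (limn (fun n => \int[m2]_x (f_ n x)%:E)).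
  rewrite -monotone_convergence//=.
  - apply: eq_integral => x _; apply/esym/cvg_lim => //.
    exact: cvg_nnsfun_approx.
  - by move=> n; exact/measurable_EFinP.
  - by move=> n x _; rewrite lee_fin.
  - by move=> x _ a b ab; rewrite lee_fin; exact/lefP/nd_nnsfun_approx.
transitivity (limn (fun n => \int[m1]_x ((f_ n x)%:E * (g x)%:E))).
  by apply: congr_lim; apply/funext => n; exact: simple.
rewrite -monotone_convergence//=.
- apply: eq_integral => x _; apply/cvg_lim => //.
  by apply: cvgeZr => //; exact: cvg_nnsfun_approx.
- move=> n; apply: emeasurable_funM => //.
  exact/measurable_EFinP.
- by move=> n x _; rewrite mule_ge0// lee_fin.
- move=> x _ a b ab; rewrite lee_wpmul2r ?lee_fin//.
  exact/lefP/nd_nnsfun_approx.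
Qed.

End measure_facts.

(* [m] gives the law of [Y] the total mass [p]: for [m] the restriction of a
   probability to an event independent of [Y], [p] is the probability of that
   event. *)
Definition has_mlaw {d} {T : measurableType d} {R : realType}
    (m : set T -> \bar R) (Y : T -> R) (p : R) (nu : set R -> \bar R) :=
  forall S : set R, measurable S -> m (Y @^-1` S) = (p%:E * nu S)%E.

(** * Exponential moments of Gaussian laws, and integrals of functions of a Gaussian variable *)

Section gaussian_moments.
Context {R : realType}.
Implicit Types (m v q p s : R) (f : R -> R).

Lemma integral_normal_prob m s (f : R -> \bar R) : measurable_fun setT f ->
  (forall x, 0 <= f x)%E ->
  (\int[normal_prob m s]_x f x =
   \int[lebesgue_measure]_x (f x * (normal_pdf m s x)%:E))%E.
Proof.
move=> mf f0; apply: ge0_integral_density => //.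
  exact: measurable_normal_pdf.
by move=> x; exact: normal_pdf_ge0.
Qed.

(* Completing the square: an exponential tilt of a Gaussian density is a shift. *)
Lemma normal_pdf_tilt m s q x : s != 0 ->
  expR (q * x) * normal_pdf m s x =
  expR (q * m + q ^+ 2 * s ^+ 2 / 2) * normal_pdf (m + q * s ^+ 2) s x.
Proof.
move=> s0; rewrite !normal_pdfE// /normal_fun !(mulrCA _ (normal_peak s)).
congr (_ * _); rewrite -!expRD; congr expR.
by rewrite -mulr_natr; field.
Qed.

Lemma normal_mgf m s q : s != 0 ->
  (\int[normal_prob m s]_x (expR (q * x))%:E =
   (expR (q * m + q ^+ 2 * s ^+ 2 / 2))%:E)%E.
Proof.
move=> s0; rewrite integral_normal_prob; last 2 first.
- by apply/measurable_EFinP; apply: measurableT_comp.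
- by move=> x; rewrite lee_fin expR_ge0.
under eq_integral => x _ do rewrite -EFinM normal_pdf_tilt// EFinM.
rewrite ge0_integralZl//.
- by rewrite integral_normal_pdf mule1.
- by apply/measurable_EFinP; exact: measurable_normal_pdf.
- by move=> x _; rewrite lee_fin normal_pdf_ge0.
Qed.

(** The moment generating function of N(m, v) at [q] plus its value at [- q]. It dominates the mean
    of [expR (q * |X|)] and is nondecreasing in [v], so its value at variance [b] serves a Brownian
    motion at all times up to [b]. *)
Definition gaussian_exp_bound m v q : R :=
  expR (q * m + q ^+ 2 * v / 2) + expR (- q * m + q ^+ 2 * v / 2).

Lemma gaussian_exp_bound_ge0 m v q : 0 <= gaussian_exp_bound m v q.
Proof. by rewrite addr_ge0// expR_ge0. Qed.

(** The case [v == 0] follows [gaussian_law], which is then a Dirac mass. *)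
Definition gaussian_moment m v f : R :=
  if v == 0 then f m else \int[normal_prob m (Num.sqrt v)]_x f x.

Lemma expR_norm_le q x : expR (q * `|x|) <= expR (q * x) + expR (- q * x).
Proof.
case: (ger0P x) => x0; first by rewrite lerDl expR_ge0.
by rewrite mulrN -mulNr lerDr expR_ge0.
Qed.

Lemma measurable_expR_norm {d} {T : measurableType d} (Y : T -> R) q :
  measurable_fun setT Y -> measurable_fun setT (fun x => expR (q * `|Y x|)).
Proof.
move=> mY; apply: measurableT_comp => //; apply: measurable_funM => //.
exact: measurableT_comp.
Qed.

Lemma normal_exp_norm_le m s q : s != 0 ->
  (\int[normal_prob m s]_x (expR (q * `|x|))%:E <=
   (gaussian_exp_bound m (s ^+ 2) q)%:E)%E.
Proof.
move=> s0.
have mE (r : R) : measurable_fun setT (fun x : R => (expR (r * x))%:E).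
  by apply/measurable_EFinP; apply: measurableT_comp.
apply: (@le_trans _ _ (\int[normal_prob m s]_x
   ((expR (q * x))%:E + (expR (- q * x))%:E)))%E.
  apply: ge0_le_integral => //.
  - by apply/measurable_EFinP; exact: measurable_expR_norm.
  - by apply: emeasurable_funD; exact: mE.
  - by move=> x _; rewrite -EFinD lee_fin expR_norm_le.
rewrite ge0_integralD//.
- by rewrite !normal_mgf// -EFinD sqrrN.
- exact: mE.
- exact: mE.
Qed.

Context {d : measure_display} {T : measurableType d}.
Variables (Q : {finite_measure set T -> \bar R}).

Lemma ge0_integral_mlaw {d'} {U : measurableType d'} (Y : T -> U) p
    (nu : {measure set U -> \bar R}) (f : U -> \bar R) :
  measurable_fun setT Y -> 0 <= p ->
  (forall S, measurable S -> Q (Y @^-1` S) = (p%:E * nu S)%E) ->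
  measurable_fun setT f -> (forall x, 0 <= f x)%E ->
  (\int[Q]_w f (Y w) = p%:E * \int[nu]_x f x)%E.
Proof.
move=> mY p0 QY mf f0.
rewrite -[LHS](@ge0_integral_pushforward _ _ _ _ _ Y mY Q setT f)//.
rewrite [LHS](eq_measure_integral (mscale (NngNum p0) nu))/=.
  by rewrite ge0_integral_mscale.
by move=> S mS _; rewrite /pushforward QY.
Qed.

Lemma gaussian_lawE m v : gaussian_law m v =
  if v == 0 then \d_m else normal_prob m (Num.sqrt v) :> (set R -> \bar R).
Proof. by apply/funext => B; rewrite /gaussian_law; case: ifP. Qed.

Lemma integral_exp_mlaw (Y : T -> R) p m v V q : measurable_fun setT Y ->
  0 <= p -> 0 <= v <= V -> has_mlaw Q Y p (gaussian_law m v) ->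
  (\int[Q]_w (expR (q * `|Y w|))%:E <= (p * gaussian_exp_bound m V q)%:E)%E.
Proof.
move=> mY p0 /andP[v0 vV]; rewrite gaussian_lawE.
have mE : measurable_fun setT (fun x : R => (expR (q * `|x|))%:E).
  by apply/measurable_EFinP; exact: measurable_expR_norm.
have E0 (x : R) : (0 <= (expR (q * `|x|))%:E)%E by rewrite lee_fin expR_ge0.
have mono : gaussian_exp_bound m v q <= gaussian_exp_bound m V q.
  by apply: lerD; rewrite ler_expR lerD2l ler_wpM2r// ler_wpM2l// sqr_ge0.
have [v00|v00] := eqVneq v 0 => QY.
  rewrite (ge0_integral_mlaw mY p0 QY mE E0) integral_dirac// diracT mul1e.
  rewrite -EFinM lee_fin ler_wpM2l//; apply: le_trans mono.
  apply: le_trans (expR_norm_le _ _) _.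
  by rewrite /gaussian_exp_bound v00 mulr0 mul0r !addr0.
rewrite (@ge0_integral_mlaw _ (measurableTypeR R) Y p
  (normal_prob m (Num.sqrt v)) _ mY p0 QY mE E0).
rewrite EFinM lee_wpmul2l ?lee_fin//.
have sv : Num.sqrt v != 0 by rewrite sqrtr_eq0 -ltNge lt_neqAle eq_sym v00.
apply: le_trans (normal_exp_norm_le _ _ sv) _.
by rewrite lee_fin sqr_sqrtr.
Qed.

Lemma integrable_mlaw (Y : T -> R) p m v f K q : measurable_fun setT Y ->
  0 <= p -> 0 <= v -> has_mlaw Q Y p (gaussian_law m v) ->
  measurable_fun setT f -> (forall x, `|f x| <= K * expR (q * `|x|)) ->
  Q.-integrable setT (EFin \o (f \o Y)).
Proof.
move=> mY p0 v0 QY mf fK; apply/integrableP; split.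
  by apply/measurable_EFinP; exact: measurableT_comp.
apply: (@le_lt_trans _ _ (\int[Q]_w (`|K|%:E * (expR (q * `|Y w|))%:E)))%E.
  apply: ge0_le_integral => //.
  - apply: measurableT_comp => //.
    by apply/measurable_EFinP; exact: measurableT_comp.
  - by apply: emeasurable_funM => //; apply/measurable_EFinP; exact: measurable_expR_norm.
  - move=> w _ /=; rewrite lee_fin (le_trans (fK _))//.
    by rewrite ler_wpM2r ?expR_ge0// ler_norm.
rewrite ge0_integralZl//; last first.
  by apply/measurable_EFinP; exact: measurable_expR_norm.
have vv : 0 <= v <= v by rewrite v0 lexx.
have le := integral_exp_mlaw q mY p0 vv QY.
apply: le_lt_trans (lee_wpmul2l _ le) _; first by rewrite lee_fin.
by rewrite -EFinM ltry.
Qed.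

Lemma Rintegral_mlaw (Y : T -> R) p m v f K q : measurable_fun setT Y ->
  0 <= p -> 0 <= v -> has_mlaw Q Y p (gaussian_law m v) ->
  measurable_fun setT f -> (forall x, `|f x| <= K * expR (q * `|x|)) ->
  \int[Q]_w f (Y w) = p * gaussian_moment m v f.
Proof.
move=> mY p0 v0 QY mf fK.
have iY := integrable_mlaw mY p0 v0 QY mf fK.
have mf' : measurable_fun setT (EFin \o f) by exact/measurable_EFinP.
have H (nu : {measure set (measurableTypeR R) -> \bar R}) : has_mlaw Q Y p nu ->
    \int[Q]_w f (Y w) = p * \int[nu]_x f x.
  move=> hY.
  have P1 := @ge0_integral_mlaw _ (measurableTypeR R) Y p nu _ mY p0 hY
    (measurable_funepos mf') (funepos_ge0 _).
  have P2 := @ge0_integral_mlaw _ (measurableTypeR R) Y p nu _ mY p0 hY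
    (measurable_funeneg mf') (funeneg_ge0 _).
  have iY' : Q.-integrable setT ((EFin \o f) \o Y) by [].
  have F1 : (\int[Q]_w ((EFin \o f)^\+ (Y w)) < +oo)%E.
    by have := integral_funepos_lt_pinfty measurableT iY'; rewrite funepos_comp.
  have F2 : (\int[Q]_w ((EFin \o f)^\- (Y w)) < +oo)%E.
    by have := integral_funeneg_lt_pinfty measurableT iY'; rewrite funeneg_comp.
  rewrite /Rintegral -[X in fine X = _]/(\int[Q]_w ((EFin \o f) \o Y) w)%E.
  rewrite [in LHS]integralE funepos_comp funeneg_comp/=.
  rewrite {}P1 {}P2 in F1 F2 *.
  rewrite [X in _ = _ * fine X]integralE.
  have : (0 <= \int[nu]_x (EFin \o f)^\+ x)%E.
    by apply: integral_ge0 => x _; exact: funepos_ge0.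
  have : (0 <= \int[nu]_x (EFin \o f)^\- x)%E.
    by apply: integral_ge0 => x _; exact: funeneg_ge0.
  move: F1 F2.
  set a := (\int[nu]_x _^\+ x)%E; set b := (\int[nu]_x _^\- x)%E.
  (* For [p = 0] both sides vanish whatever the integrals against [nu] are; for [p > 0] their
     finiteness is inherited from [Q]. *)
  move: p0; rewrite le_eqVlt => /orP[/eqP <-|pgt0].
    by rewrite !mul0e sube0 mul0r.
  move: a b => [a| |] [b| |]//; rewrite ?gt0_muley ?lte_fin//.
  by rewrite -!EFinM -!EFinB/= mulrBr.
move: QY; rewrite gaussian_lawE /gaussian_moment.
case: ifPn => [v00|v00] QY; last exact: (H (normal_prob m (Num.sqrt v)) QY).
rewrite (H (@dirac _ (measurableTypeR R) m R) QY).
by rewrite /Rintegral integral_dirac// diracT mul1e.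
Qed.

End gaussian_moments.

(** * Time integrals of continuous processes: joint measurability, Cauchy-Schwarz and Fubini *)

Section path_integrals.
Context {R : realType} {d : measure_display} {T : measurableType d}.
Implicit Types (W g : R -> T -> R).
Notation mu := (@lebesgue_measure R).

(** Rounding the time down to the grid of mesh [1 / (n + 1)] gives a process whose preimages are
    countable unions of rectangles; by path continuity these processes converge pointwise to [W]. *)
Lemma measurable_continuous_process W : (forall t, measurable_fun setT (W t)) ->
  (forall w, continuous (W ^~ w)) ->
  measurable_fun setT (fun z : measurableTypeR R * T => W z.1 z.2).
Proof.
move=> mW cW.
pose q (n : nat) (t : R) : R := (Num.floor (t * n.+1%:R))%:~R / n.+1%:R.
have q_cvg t : q n t @[n --> \oo] --> t.
  apply/subr_cvg0.
  have qle n : - (n.+1%:R)^-1 <= q n t - t <= 0.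
    have n0 : 0 < n.+1%:R :> R by rewrite ltr0n.
    have fl : (Num.floor (t * n.+1%:R))%:~R <= t * n.+1%:R by exact: floor_le_tmp.
    have fu : t * n.+1%:R < (Num.floor (t * n.+1%:R))%:~R + 1.
      by rewrite -[1]/(1%:~R) -intrD; exact: floorD1_gt.
    rewrite /q subr_le0 ler_pdivrMr// fl andbT.
    rewrite lerBrDl -(ler_pM2r n0) mulrDl mulNr mulVf ?gt_eqF// mulfVK ?gt_eqF//.
    by lra.
  apply: (squeeze_cvgr (f := fun n => - (n.+1%:R)^-1) (h := fun=> 0)).
  - by apply: nearW => n; exact: qle.
  - by rewrite -oppr0; apply: cvgN; exact: cvg_harmonic.
  - exact: cvg_cst.
apply: (@measurable_fun_cvg _ _ _ _ (fun n z => W (q n z.1) z.2)); last first.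
  move=> [t w] _ /=.
  by apply: (cvg_comp (fun n => q n t) (W ^~ w)); [exact: q_cvg|exact: cW].
move=> n _ S mS; rewrite setTI.
rewrite (_ : _ @^-1` S = \bigcup_(k : int)
   (`[k%:~R / n.+1%:R, (k + 1)%:~R / n.+1%:R[ `*` (W (k%:~R / n.+1%:R) @^-1` S))).
  apply: countable_bigcupT_measurable; first exact: countableP.
  move=> k; apply: measurableX; first exact: measurable_itv.
  by rewrite -[X in measurable X]setTI; exact: mW.
have n0 : 0 < n.+1%:R :> R by rewrite ltr0n.
apply/seteqP; split => [[t w] /= Sz|[t w] [k _ [/= kt Sk]]] /=.
  exists (Num.floor (t * n.+1%:R)) => //; split => //=.
  rewrite in_itv/= ler_pdivrMr// ltr_pdivlMr//.
  by rewrite floor_le_tmp floorD1_gt.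
rewrite (_ : q n t = k%:~R / n.+1%:R)// /q; congr (_%:~R / _).
move: kt; rewrite in_itv/= ler_pdivrMr// ltr_pdivlMr// => kt.
exact/floor_def.
Qed.

Variables (Q : {finite_measure set T -> \bar R}).

(** Cauchy-Schwarz against the constant 1: with [I] the integral of [f], the nonnegative integral of
    [(t f - I)^2] equals [t (t \int f^2 - I^2)]. *)
Lemma Rintegral_sqr_le (f : R -> R) t : 0 <= t -> continuous f ->
  (\int[mu]_(s in `[0, t]) f s) ^+ 2 <= t * \int[mu]_(s in `[0, t]) (f s ^+ 2).
Proof.
move=> t0 cf.
set I := \int[mu]_(s in `[0, t]) f s.
have cc (c : R) : continuous (fun x : R => c) by exact: cst_continuous.
have cf2 : continuous (fun s => f s ^+ 2).
  by apply: continuousM_fun.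
have cI : continuous (fun s => (- (2 * I)) * (t * f s) + t ^+ 2 * f s ^+ 2).
  by apply: continuousD_fun; apply: continuousM_fun => //; apply: continuousM_fun.
have iZ (c : R) (h : R -> R) : continuous h -> \int[mu]_(s in `[0, t]) (c * h s) =
    c * \int[mu]_(s in `[0, t]) h s.
  by move=> ch; rewrite RintegralZl//; exact: continuous_itv_integrable.
have : 0 <= \int[mu]_(s in `[0, t]) ((t * f s - I) ^+ 2).
  by apply: Rintegral_ge0 => s _; exact: sqr_ge0.
rewrite (_ : \int[mu]_(s in `[0, t]) _ = \int[mu]_(s in `[0, t])
   (I ^+ 2 + ((- (2 * I)) * (t * f s) + t ^+ 2 * f s ^+ 2))); last first.
  by apply: eq_Rintegral => s _; ring.
rewrite RintegralD//; [|exact: continuous_itv_integrable..].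
rewrite RintegralD//; last 2 first.
- by apply: continuous_itv_integrable; do ?[apply: continuousM_fun => //].
- by apply: continuous_itv_integrable; do ?[apply: continuousM_fun => //].
rewrite (iZ (- (2 * I)) (fun s => t * f s)); last exact: continuousM_fun.
rewrite (iZ t f)// (iZ _ (fun s => f s ^+ 2))// -/I Rintegral_cst//= lebesgue_measure_itv/= lte_fin.
move: t0; rewrite le_eqVlt => /orP[/eqP t00 _|t0].
  by rewrite /I -t00 Rintegral_itv0 mul0r expr0n.
rewrite t0 -EFinD/= subr0 => h.
by rewrite -subr_ge0 -(pmulr_rge0 _ t0); apply: le_trans h _; nra.
Qed.

Variables (g : R -> T -> R) (K b : R).
Hypotheses (b0 : 0 <= b) (mg : forall t, measurable_fun setT (g t))
  (cg : forall w, continuous (g ^~ w))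
  (gK : forall s, 0 <= s <= b -> (\int[Q]_w (`|g s w|)%:E <= K%:E)%E).

(** The time cut-off is moved into the integrand so that Fubini's theorem applies on the product of
    [Q] with the whole Lebesgue measure; by [gK] the integral of [|F|] is at most [K * b]. *)
Let F (z : measurableTypeR R * T) : \bar R := (\1_`[0, b] z.1 * g z.1 z.2)%:E.

Let mF : measurable_fun setT F.
Proof.
apply/measurable_EFinP; apply: measurable_funM.
  by apply: (measurableT_comp (f := \1_`[0, b] : measurableTypeR R -> R));
    [exact: measurable_indic|exact: measurable_fst].
exact: measurable_continuous_process.
Qed.

Let F_in s w : 0 <= s <= b -> F (s, w) = (g s w)%:E.
Proof. by move=> sb; rewrite /F indicE mem_set ?mul1r//= in_itv. Qed.

Let F_out s w : ~~ (0 <= s <= b) -> F (s, w) = 0%E.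
Proof.
move=> sb; rewrite /F indicE memNset ?mul0r//= in_itv/=.
exact/negP.
Qed.

Let F_le : (\int[mu]_x \int[Q]_w `|F (x, w)| <= (K * b)%:E)%E.
Proof.
apply: (@le_trans _ _ (\int[mu]_x (K%:E * (\1_`[0, b] x)%:E)))%E.
  apply: ge0_le_integral => //.
  - by move=> x _; exact: integral_ge0.
  - have := @measurable_fun_fubini_tonelli_F _ _ _ _ _ Q (fun z => `|F z|%E).
    apply; first exact: measurableT_comp.
    by move=> x; exact: abse_ge0.
  - apply: emeasurable_funM => //.
    by apply/measurable_EFinP; exact: measurable_indic.
  - move=> x _; have [xb|xb] := boolP (0 <= x <= b).
      under eq_integral => w _ do rewrite F_in// abse_EFin.
      by rewrite indicE mem_set ?mule1 ?gK//= in_itv.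
    under eq_integral => w _ do rewrite F_out// abse0.
    rewrite integral0 indicE memNset ?mule0//= in_itv/=; exact/negP.
have K0 : (0 <= K%:E)%E.
  have : 0 <= (0 : R) <= b by rewrite lexx b0.
  by move=> /gK; apply: le_trans; exact: integral_ge0.
rewrite ge0_integralZl//; last by apply/measurable_EFinP; exact: measurable_indic.
rewrite integral_indic//= setIT lebesgue_measure_itv/=.
rewrite lte_fin EFinM; case: ltgtP b0 => // [b00|<-] _; last by rewrite mule0.
by rewrite oppr0 adde0.
Qed.

Let iF : (mu \x Q)%E.-integrable setT F.
Proof. by apply/integrable12ltyP => //; exact: le_lt_trans F_le (ltry _). Qed.

Let I (w : T) : R := \int[mu]_(s in `[0, b]) g s w.

Let IE w : (\int[mu]_s F (s, w) = (I w)%:E)%E.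
Proof.
have iw := @continuous_itv_integrable R (g ^~ w) b (@cg w).
rewrite /I /Rintegral fineK; last exact: integrable_fin_num.
rewrite [RHS]integral_mkcond; apply: eq_integral => s _.
rewrite patchE /=; case: ifPn => [|/negP].
  by rewrite inE/= in_itv/= => sb; rewrite F_in.
by move=> sb; rewrite F_out//; apply/negP => sb'; apply: sb; rewrite inE/= in_itv.
Qed.

Lemma measurable_path_integral : measurable_fun setT I.
Proof.
apply/measurable_EFinP.
have : measurable_fun setT (fun w => (\int[mu]_s F^\+ (s, w) - \int[mu]_s F^\- (s, w))%E).
  apply: emeasurable_funB.
  - apply: (@measurable_fun_fubini_tonelli_G _ _ _ _ _ mu (F^\+)%E).
      exact: measurable_funepos.
    by move=> z; exact: funepos_ge0.
  - apply: (@measurable_fun_fubini_tonelli_G _ _ _ _ _ mu (F^\-)%E).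
      exact: measurable_funeneg.
    by move=> z; exact: funeneg_ge0.
apply: eq_measurable_fun => w _ /=; rewrite -IE [RHS]integralE; congr (_ - _)%E.
  by apply: eq_integral => s _; rewrite (funepos_comp F (fun s => (s, w))).
by apply: eq_integral => s _; rewrite (funeneg_comp F (fun s => (s, w))).
Qed.

Lemma integrable_path_integral : Q.-integrable setT (EFin \o I).
Proof.
have /(@integrable21ltyP _ _ _ _ _ mu Q _ mF) := iF => h.
apply/integrableP; split; first exact/measurable_EFinP/measurable_path_integral.
apply: le_lt_trans h; apply: ge0_le_integral => //.
- by apply: measurableT_comp => //; exact/measurable_EFinP/measurable_path_integral.
- have := @measurable_fun_fubini_tonelli_G _ _ _ _ _ mu (fun z => `|F z|%E).
  apply; first exact: measurableT_comp.
  by move=> x; exact: abse_ge0.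
- move=> w _; rewrite -[(EFin \o I) w]/((I w)%:E) -IE; apply: le_abse_integral => //.
  exact: (measurableT_comp mF (pair2_measurable w)).
Qed.

Lemma Rintegral_path_integral :
  \int[Q]_w I w = \int[mu]_(s in `[0, b]) (\int[Q]_w g s w).
Proof.
rewrite /Rintegral -[X in fine X = _]/(\int[Q]_w (I w)%:E)%E.
rewrite (eq_integral (fun w => \int[mu]_s F (s, w))%E); last by move=> w _; rewrite IE.
have := integral21_prod_meas1 iF; rewrite /fubini_G => ->.
rewrite -(integral12_prod_meas1 iF) /fubini_F; congr fine.
rewrite [RHS]integral_mkcond; apply: eq_integral => s _.
rewrite patchE /=; case: ifPn => [|/negP].
  rewrite inE/= in_itv/= => sb.
  under eq_integral => w _ do rewrite F_in//.
  rewrite fineK//; apply: integrable_fin_num => //.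
  apply/integrableP; split; first exact/measurable_EFinP.
  exact: le_lt_trans (gK sb) (ltry _).
move=> sb; have sb' : ~~ (0 <= s <= b).
  by apply/negP => sb'; apply: sb; rewrite inE/= in_itv.
by under eq_integral => w _ do rewrite F_out//; rewrite integral0.
Qed.

Lemma ge0_integral_path_integral_le : (forall s w, 0 <= g s w) ->
  (\int[Q]_w (I w)%:E <= (K * b)%:E)%E.
Proof.
move=> g0.
rewrite (eq_integral (fun w => \int[mu]_s F (s, w))%E); last by move=> w _; rewrite IE.
have := integral21_prod_meas1 iF; rewrite /fubini_G => ->.
rewrite -(integral12_prod_meas1 iF) /fubini_F.
apply: le_trans F_le; rewrite le_eqVlt; apply/orP; left; apply/eqP.
apply: eq_integral => s _; apply: eq_integral => w _.
by rewrite gee0_abs// /F lee_fin mulr_ge0.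
Qed.

End path_integrals.

(** * Integrable and square integrable random variables *)

Section square_integrable.
Context {d : measure_display} {T : measurableType d} {R : realType}.
Variable Q : {finite_measure set T -> \bar R}.
Implicit Types (f g h X Y Z : T -> R) (a b c : R).

Definition rint f := Q.-integrable setT (EFin \o f).

Lemma rint_le f h : measurable_fun setT f -> rint h ->
  (forall w, `|f w| <= h w) -> rint f.
Proof.
move=> mf ih fh; apply: (le_integrable measurableT _ _ ih).
  exact/measurable_EFinP.
by move=> w _ /=; rewrite lee_fin (le_trans (fh w))// ler_norm.
Qed.

Lemma rint_measurable f : rint f -> measurable_fun setT f.
Proof. by move=> /measurable_int/measurable_EFinP. Qed.

Lemma rintD f g : rint f -> rint g -> rint (fun w => f w + g w).
Proof. by move=> fi gi; have := integrableD measurableT fi gi. Qed.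

Lemma rintZ a f : rint f -> rint (fun w => a * f w).
Proof. by move=> fi; have := integrableZl measurableT a fi. Qed.

Lemma rint_cst a : rint (fun=> a).
Proof. exact: finite_measure_integrable_cst. Qed.

(** The shape [a * f + g] lets a single rewriting rule unfold any linear combination that is nested
    to the right and closed by 0. *)
Lemma EZD a f g : rint f -> rint g ->
  \int[Q]_w (a * f w + g w) = a * \int[Q]_w f w + \int[Q]_w g w.
Proof.
move=> fi gi; rewrite RintegralD//; last exact: (rintZ a fi).
by rewrite RintegralZl.
Qed.

Lemma E_le f g : rint f -> rint g -> (forall w, f w <= g w) ->
  \int[Q]_w f w <= \int[Q]_w g w.
Proof. by move=> fi gi fg; apply: le_Rintegral. Qed.

Lemma rint_EFin f : rint f -> (\int[Q]_w (f w)%:E = (\int[Q]_w f w)%:E)%E.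
Proof. by move=> fi; rewrite /Rintegral fineK//; exact: integrable_fin_num. Qed.

Lemma rint_of_le f (K : R) : measurable_fun setT f -> (forall w, 0 <= f w) ->
  (\int[Q]_w (f w)%:E <= K%:E)%E -> rint f /\ \int[Q]_w f w <= K.
Proof.
move=> mf f0 fK; have fi : rint f.
  apply/integrableP; split; first exact/measurable_EFinP.
  under eq_integral => w _ do rewrite /= ger0_norm//.
  exact: le_lt_trans fK (ltry _).
by split=> //; rewrite -lee_fin -rint_EFin.
Qed.

Definition sqint X := measurable_fun setT X /\ rint (fun w => X w ^+ 2).

Lemma sqintM X Y : sqint X -> sqint Y -> rint (fun w => X w * Y w).
Proof.
move=> [mX iX] [mY iY]; apply: rint_le (rintD iX iY) _.
  exact: measurable_funM.
move=> w; rewrite normrM -(real_normK (num_real (X w))) -(real_normK (num_real (Y w))).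
have := sqr_ge0 (`|X w| - `|Y w|); have := normr_ge0 (X w); have := normr_ge0 (Y w).
by nra.
Qed.

Lemma sqint_rint X : sqint X -> rint X.
Proof.
move=> X2; have one : sqint (fun=> 1) by split; [|exact: rint_cst].
have := sqintM X2 one.
by apply: eq_integrable => // w _ /=; rewrite mulr1.
Qed.

Lemma sqintD X Y : sqint X -> sqint Y -> sqint (fun w => X w + Y w).
Proof.
move=> X2 Y2; have XY := sqintM X2 Y2; case: X2 Y2 => [mX iX] [mY iY].
split; first exact: measurable_funD.
have := rintD iX (rintD iY (rintZ 2 XY)).
by apply: eq_integrable => // w _ /=; congr EFin; ring.
Qed.

Lemma sqintZ a X : sqint X -> sqint (fun w => a * X w).
Proof.
move=> [mX iX]; split; first exact: measurable_funM.
have := rintZ (a ^+ 2) iX.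
by apply: eq_integrable => // w _ /=; congr EFin; ring.
Qed.

Lemma E_sqr3 a b c X Y Z : sqint X -> sqint Y -> sqint Z ->
  \int[Q]_w ((a * X w + b * Y w + c * Z w) ^+ 2) =
  a ^+ 2 * \int[Q]_w (X w ^+ 2) + b ^+ 2 * \int[Q]_w (Y w ^+ 2)
  + c ^+ 2 * \int[Q]_w (Z w ^+ 2)
  + 2 * a * b * \int[Q]_w (X w * Y w) + 2 * a * c * \int[Q]_w (X w * Z w)
  + 2 * b * c * \int[Q]_w (Y w * Z w).
Proof.
move=> X2 Y2 Z2.
have XY := sqintM X2 Y2; have XZ := sqintM X2 Z2; have YZ := sqintM Y2 Z2.
case: X2 Y2 Z2 => [mX iX] [mY iY] [mZ iZ].
rewrite (@eq_Rintegral _ _ _ Q setT (fun w =>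
  a ^+ 2 * (X w ^+ 2) + (b ^+ 2 * (Y w ^+ 2) + (c ^+ 2 * (Z w ^+ 2)
  + ((2 * a * b) * (X w * Y w) + ((2 * a * c) * (X w * Z w)
  + ((2 * b * c) * (Y w * Z w) + 0))))))); last by move=> w _; ring.
have i0 := rint_cst 0.
rewrite !EZD ?Rintegral_cst ?mul0r ?addr0 ?addrA//;
  by do ?[exact: i0|assumption|apply: rintD|apply: rintZ].
Qed.

Lemma E_lin3 a b c X Y Z : rint X -> rint Y -> rint Z ->
  \int[Q]_w (a * X w + b * Y w + c * Z w) =
  a * \int[Q]_w X w + b * \int[Q]_w Y w + c * \int[Q]_w Z w.
Proof.
move=> iX iY iZ.
rewrite (@eq_Rintegral _ _ _ Q setT (fun w =>
  a * X w + (b * Y w + (c * Z w + 0)))); last by move=> w _; ring.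
have i0 := rint_cst 0.
rewrite !EZD ?Rintegral_cst ?mul0r ?addr0 ?addrA//;
  by do ?[exact: i0|assumption|apply: rintD|apply: rintZ].
Qed.

End square_integrable.

(** Square [y <= expR y] at [y = |x| / 2]. The fourth power below uses [|x| / 4] in the same way,
    whence [256 = 4 ^ 4]. *)
Lemma sqr_le_exp {R : realType} (x : R) : x ^+ 2 <= 4 * expR `|x|.
Proof.
have h := expR_ge1Dx (`|x| / 2).
have -> : expR `|x| = expR (`|x| / 2) ^+ 2.
  by rewrite expr2 -expRD; congr expR; lra.
have x0 := normr_ge0 x.
rewrite -(real_normK (num_real x)).
by move: h; set e := expR _ => h; nra.
Qed.

Lemma exp4_le_exp {R : realType} (x : R) : x ^+ 4 <= 256 * expR `|x|.
Proof.
have h := expR_ge1Dx (`|x| / 4).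
have -> : expR `|x| = expR (`|x| / 4) ^+ 4.
  by rewrite !exprS expr0 mulr1 -!expRD; congr expR; lra.
have x0 := normr_ge0 x.
rewrite -(ger0_norm (_ : 0 <= x ^+ 4)); last by rewrite exprn_even_ge0.
rewrite normrX (_ : 256 = 4 ^+ 4); last by ring.
rewrite -exprMn lerXn2r// ?nnegrE ?mulr_ge0 ?expR_ge0//.
by move: h; set e := expR _ => h; lra.
Qed.

(* The moments of the noise [W] and of the initial value [u0] that are used, for
   a probability [Q] that will be the conditional one given the mode. *)
Record noise_input {d} {T : measurableType d} {R : realType}
    (Q : {finite_measure set T -> \bar R}) (u0 : T -> R) (W : R -> T -> R)
    (m0 v0 b : R) : Prop := NoiseInput {
  noise_u0 : measurable_fun setT u0 ;
  noise_W : forall t, measurable_fun setT (W t) ;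
  noise_cont : forall w, continuous (W ^~ w) ;
  noise_law_u0 : has_mlaw Q u0 1 (gaussian_law m0 v0) ;
  noise_law_W : forall t, 0 <= t <= b -> has_mlaw Q (W t) 1 (gaussian_law 0 t) ;
  noise_law_incr : forall s t, 0 <= s -> s <= t -> t <= b ->
    has_mlaw Q (fun w => W t w - W s w) 1 (gaussian_law 0 (t - s)) ;
  noise_uncorrelated : forall t, 0 <= t <= b ->
    \int[Q]_w (u0 w * W t w) = \int[Q]_w u0 w * \int[Q]_w W t w }.

Section frozen_moments.
Context {R : realType} (m0 v0 gam sig b : R) (v0_ge0 : 0 <= v0) (b0 : 0 < b).
Notation mu := (@lebesgue_measure R).

Let h s : R := expR (- gam * (b - s)).

Let ch : continuous h.
Proof.
apply: continuous_expR_fun; apply: continuousM_fun; first exact: cst_continuous.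
apply: continuousB_fun; first exact: cst_continuous.
by move=> x; exact: cvg_id.
Qed.

(* The solution at time [b] of the equation with constant damping [gam]. *)
Definition frozen {T : Type} (u0 : T -> R) (W : R -> T -> R) (w : T) : R :=
  expR (- gam * b) * u0 w
  + sig * (W b w - gam * \int[mu]_(s in `[0, b]) (expR (- gam * (b - s)) * W s w)).

Let q v : R := gaussian_moment 0 v (fun x => x ^+ 2).
Let a1 v : R := gaussian_moment 0 v id.
Let n1 : R := gaussian_moment m0 v0 id.
(** The covariance of [W] by polarization: [W s * W t] is half of
    [(W s)^2 + (W t)^2 - (W t - W s)^2], and the three squares only involve laws of values and
    increments. *)
Let cov s t : R := (q s + q t - q `|t - s|) / 2.

Definition frozen_mean : R :=
  expR (- gam * b) * n1 + sig * a1 b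
  + (- (sig * gam)) * \int[mu]_(s in `[0, b]) (h s * a1 s).

(** The expanded square of the three terms of [frozen]: initial value, final noise, path integral.
    The double integral is the second moment of the path integral. *)
Definition frozen_msq : R :=
  expR (- gam * b) ^+ 2 * gaussian_moment m0 v0 (fun x => x ^+ 2)
  + sig ^+ 2 * q b
  + (- (sig * gam)) ^+ 2 *
      \int[mu]_(s in `[0, b]) (h s * \int[mu]_(t in `[0, b]) (h t * cov s t))
  + 2 * expR (- gam * b) * sig * (n1 * a1 b)
  + 2 * expR (- gam * b) * (- (sig * gam)) *
      \int[mu]_(s in `[0, b]) (h s * (n1 * a1 s))
  + 2 * sig * (- (sig * gam)) * \int[mu]_(s in `[0, b]) (h s * cov b s).

Context {d : measure_display} {T : measurableType d}.
Variables (Q : {finite_measure set T -> \bar R}) (u0 : T -> R) (W : R -> T -> R).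
Hypothesis N : noise_input Q u0 W m0 v0 b.

Let mW := noise_W N.
Let cW := noise_cont N.
Let H : R := expR (`|gam| * b).
Let H0 : 0 <= H. Proof. exact: expR_ge0. Qed.

Let hH s : 0 <= s <= b -> `|h s| <= H.
Proof.
move=> /andP[s0 sb]; rewrite ger0_norm ?expR_ge0// ler_expR.
apply: (@le_trans _ _ (`|gam| * (b - s))).
  by rewrite ler_wpM2r ?subr_ge0// (le_trans (ler_norm _))// normrN.
by rewrite ler_wpM2l// lerBlDr lerDl.
Qed.

(** A bound on the mean of [(W s)^2] for all [s <= b], through [x^2 <= 4 exp |x|]. It is crude, but
    Fubini only asks for a finite uniform bound. *)
Let G : R := 4 * gaussian_exp_bound 0 b 1.

Let W_sq s : 0 <= s <= b -> sqint Q (W s) /\ \int[Q]_w (W s w ^+ 2) <= G.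
Proof.
move=> sb.
have mW2 : measurable_fun setT (fun w => W s w ^+ 2) by exact: measurable_funX.
have [||i2 le2] := @rint_of_le _ _ _ Q (fun w => W s w ^+ 2) G mW2.
- by move=> w; exact: sqr_ge0.
- apply: (@le_trans _ _ (\int[Q]_w (4%:E * (expR (1 * `|W s w|))%:E))%E).
    apply: ge0_le_integral => //.
    - by move=> w _; rewrite lee_fin sqr_ge0.
    - exact/measurable_EFinP.
    - by apply: emeasurable_funM => //; apply/measurable_EFinP; exact: measurable_expR_norm.
    - by move=> w _; rewrite -EFinM lee_fin mul1r sqr_le_exp.
  rewrite ge0_integralZl//; last first.
    by apply/measurable_EFinP; exact: measurable_expR_norm.
  rewrite EFinM lee_wpmul2l//.
  have := integral_exp_mlaw 1 (mW s) ler01 sb (noise_law_W N sb).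
  by rewrite mul1r.
by split => //; split.
Qed.

Let u0_sq : sqint Q u0.
Proof.
split; first exact: noise_u0 N.
apply: (@integrable_mlaw _ _ _ Q u0 1 m0 v0 (fun x => x ^+ 2) 4 1) => //.
- exact: noise_u0 N.
- exact: noise_law_u0 N.
- by move=> x; rewrite ger0_norm ?sqr_ge0// mul1r sqr_le_exp.
Qed.

Let I (w : T) : R := \int[mu]_(s in `[0, b]) (h s * W s w).

Let cst_b : 0 <= b <= b. Proof. by rewrite lexx ltW. Qed.

(** By Cauchy-Schwarz in time, [I^2] is at most [b] times the integral of [(h s * W s)^2], which is
    integrable by Fubini. *)
Let I_sq : sqint Q I.
Proof.
have G0 : 0 <= G by rewrite mulr_ge0// gaussian_exp_bound_ge0.
pose g s w := (h s * W s w) ^+ 2.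
have mg s : measurable_fun setT (g s).
  by apply: measurable_funX; exact: measurable_funM.
have cg w : continuous (g ^~ w).
  by apply: continuousM_fun; apply: continuousM_fun.
have gK s : 0 <= s <= b -> (\int[Q]_w (`|g s w|)%:E <= (H ^+ 2 * G)%:E)%E.
  move=> sb; have [[_ i2] le2] := W_sq sb.
  rewrite (rint_EFin (f := fun w => `|g s w|)); last first.
    apply: rint_le (rintZ (H ^+ 2) i2) _; first exact: measurableT_comp.
    move=> w; rewrite normr_id normrX normrM exprMn.
    rewrite (real_normK (num_real (W s w))) ler_wpM2r ?sqr_ge0//.
    by rewrite lerXn2r ?nnegrE// hH.
  rewrite lee_fin; apply: (@le_trans _ _ (\int[Q]_w (H ^+ 2 * W s w ^+ 2))).
    apply: E_le; [|exact: rintZ|].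
      apply: rint_le (rintZ (H ^+ 2) i2) _; first exact: measurableT_comp.
      move=> w; rewrite normr_id normrX normrM exprMn.
      rewrite (real_normK (num_real (W s w))) ler_wpM2r ?sqr_ge0//.
      by rewrite lerXn2r ?nnegrE// hH.
    move=> w; rewrite normrX normrM exprMn.
    rewrite (real_normK (num_real (W s w))) ler_wpM2r ?sqr_ge0//.
    by rewrite lerXn2r ?nnegrE// hH.
  by rewrite RintegralZl// ler_wpM2l// sqr_ge0.
pose g1 s w := h s * W s w.
have mI : measurable_fun setT I.
  apply: (measurable_path_integral (g := g1)).
    by move=> t; exact: measurable_funM.
  by move=> w; exact: continuousM_fun.
split => //.
have ib := rintZ b (integrable_path_integral (ltW b0) mg cg gK).
apply: (rint_le _ ib); first exact: measurable_funX.
move=> w; rewrite ger0_norm ?sqr_ge0//.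
by apply: Rintegral_sqr_le; [exact: ltW|apply: continuousM_fun].
Qed.

(** Fubini, with [|X * W s| <= X^2 + (W s)^2] for domination. The factor [X] is taken to be 1, [u0],
    [W b], [W s] and [I] itself; the last two choices together produce the double integral of the
    covariance. *)
Let E_mul_I X : sqint Q X ->
  \int[Q]_w (X w * I w) = \int[mu]_(s in `[0, b]) (h s * \int[Q]_w (X w * W s w)).
Proof.
move=> X2; pose g s w := h s * (X w * W s w).
have [mX iX] := X2.
have mg s : measurable_fun setT (g s).
  by apply: measurable_funM => //; exact: measurable_funM.
have cg w : continuous (g ^~ w).
  apply: continuousM_fun => //; apply: continuousM_fun => //.
  exact: cst_continuous.
have gK s : 0 <= s <= b -> (\int[Q]_w (`|g s w|)%:E <=
    (H * (G + \int[Q]_w (X w ^+ 2)))%:E)%E.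
  move=> sb; have [W2 le2] := W_sq sb; have XW := sqintM X2 W2.
  have [_ i2] := W2.
  have ig : rint Q (fun w => `|g s w|).
    exact: (integrable_norm (rintZ (h s) XW)).
  rewrite (rint_EFin ig) lee_fin.
  apply: (@le_trans _ _ (\int[Q]_w (H * (W s w ^+ 2 + X w ^+ 2)))).
    apply: E_le => //; first by apply: rintZ; exact: rintD.
    move=> w; rewrite normrM ler_pM ?hH// normrM.
    rewrite -(real_normK (num_real (W s w))) -(real_normK (num_real (X w))).
    have := sqr_ge0 (`|X w| - `|W s w|).
    by have := normr_ge0 (X w); have := normr_ge0 (W s w); nra.
  rewrite RintegralZl//; last exact: rintD.
  by rewrite ler_wpM2l// RintegralD// lerD2r.
have := Rintegral_path_integral (ltW b0) mg cg gK.
rewrite [LHS](_ : _ = \int[Q]_w (X w * I w)); last first.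
  apply: eq_Rintegral => w _; rewrite /I -RintegralZl//; last first.
    by apply: continuous_itv_integrable; exact: continuousM_fun.
  by apply: eq_Rintegral => s _; rewrite /g mulrCA.
move=> ->; apply: eq_Rintegral => s; rewrite inE/= in_itv/= => sb.
by rewrite RintegralZl//; exact: sqintM X2 (W_sq sb).1.
Qed.

Let E_W s : 0 <= s <= b -> \int[Q]_w W s w = a1 s.
Proof.
move=> sb; have /andP[s0 _] := sb.
rewrite (@Rintegral_mlaw _ _ _ Q (W s) 1 0 s id 1 1 _ ler01 s0 (noise_law_W N sb)) ?mul1r//.
by move=> x; rewrite !mul1r (le_trans _ (expR_ge1Dx _))// lerDr.
Qed.

Let sqr_exp_bound (x : R) : `|x ^+ 2| <= 4 * expR (1 * `|x|).
Proof. by rewrite ger0_norm ?sqr_ge0// mul1r sqr_le_exp. Qed.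

Let E_u0 : \int[Q]_w u0 w = n1.
Proof.
rewrite (@Rintegral_mlaw _ _ _ Q u0 1 m0 v0 id 1 1 (noise_u0 N) ler01 v0_ge0
  (noise_law_u0 N)) ?mul1r//.
by move=> x; rewrite !mul1r (le_trans _ (expR_ge1Dx _))// lerDr.
Qed.

Let E_sqr (Y : T -> R) v : measurable_fun setT Y -> 0 <= v ->
  has_mlaw Q Y 1 (gaussian_law 0 v) -> \int[Q]_w (Y w ^+ 2) = q v.
Proof.
move=> mY v_ge0 lY.
have := Rintegral_mlaw mY ler01 v_ge0 lY (exprn_measurable 2) sqr_exp_bound.
by rewrite mul1r.
Qed.

Let E_cov s t : 0 <= s <= b -> 0 <= t <= b ->
  \int[Q]_w (W s w * W t w) = cov s t.
Proof.
move=> sb tb.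
wlog st : s t sb tb / s <= t.
  move=> hw; have [|/ltW ts] := leP s t; first exact: hw.
  have covC : cov t s = cov s t.
    by rewrite /cov distrC; move: (q s) (q t) (q _) => x y z; congr (_ / 2); ring.
  apply: etrans covC; rewrite -(hw t s tb sb ts).
  by apply: eq_Rintegral => w _; exact: mulrC.
have /andP[s0 _] := sb; have /andP[t0 tb'] := tb.
have ts0 : 0 <= t - s by rewrite subr_ge0.
have [Ws _] := W_sq sb; have [Wt _] := W_sq tb.
have Ed := E_sqr (measurable_funB (mW t) (mW s)) ts0 (noise_law_incr N s0 st tb').
have Es := E_sqr (mW s) s0 (noise_law_W N sb).
have Et := E_sqr (mW t) t0 (noise_law_W N tb).
have i0 : sqint Q (fun=> 0) by split; [|exact: rint_cst].
have := E_sqr3 1 (-1) 0 Wt Ws i0.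
rewrite (_ : \int[Q]_w _ = q (t - s)); last first.
  by rewrite -Ed; apply: eq_Rintegral => w _ /=; congr (_ ^+ 2); ring.
rewrite Es Et (_ : \int[Q]_w (W t w * W s w) = \int[Q]_w (W s w * W t w)); last first.
  by apply: eq_Rintegral => w _; exact: mulrC.
rewrite expr0n/= !mulr0 !mul0r !addr0 /cov (ger0_norm ts0).
move: (q (t - s)) (q s) (q t) (\int[Q]_w (W s w * W t w)) => x y z I0 ->.
by field.
Qed.

Let frozenE w : frozen u0 W w =
  expR (- gam * b) * u0 w + sig * W b w + (- (sig * gam)) * I w.
Proof.
rewrite -[LHS]/(expR (- gam * b) * u0 w + sig * (W b w - gam * I w)).
by move: (I w) (W b w) (expR _) => x y z; ring.
Qed.

Lemma frozen_sqint : sqint Q (frozen u0 W).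
Proof.
rewrite (_ : frozen u0 W = fun w => expR (- gam * b) * u0 w
  + sig * W b w + (- (sig * gam)) * I w); last by apply/funext => w; rewrite frozenE.
have [Wb _] := W_sq cst_b.
by apply: sqintD; [apply: sqintD|]; exact: sqintZ.
Qed.

Lemma E_frozen : \int[Q]_w frozen u0 W w = frozen_mean.
Proof.
under eq_Rintegral => w _ do rewrite frozenE.
have [Wb _] := W_sq cst_b.
rewrite E_lin3 ?E_W ?E_u0//; [|exact: sqint_rint..].
congr (_ + _ * _).
have one : sqint Q (fun=> 1) by split; [|exact: rint_cst].
have := E_mul_I one.
rewrite (_ : \int[Q]_w _ = \int[Q]_w I w); last first.
  by apply: eq_Rintegral => w _; rewrite mul1r.
move=> ->; apply: eq_Rintegral => s; rewrite inE/= in_itv/= => sb.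
rewrite -(E_W sb); congr (_ * _).
by apply: eq_Rintegral => w _; rewrite mul1r.
Qed.

Lemma E_frozen_sqr : \int[Q]_w (frozen u0 W w ^+ 2) = frozen_msq.
Proof.
under eq_Rintegral => w _ do rewrite frozenE.
have [Wb _] := W_sq cst_b.
rewrite E_sqr3//.
have -> : \int[Q]_w (u0 w ^+ 2) = gaussian_moment m0 v0 (fun x => x ^+ 2).
  by rewrite (@Rintegral_mlaw _ _ _ Q u0 1 m0 v0 (fun x => x ^+ 2) 4 1
    (noise_u0 N) ler01 v0_ge0 (noise_law_u0 N)) ?mul1r.
have -> : \int[Q]_w (W b w ^+ 2) = q b.
  exact: E_sqr (mW b) (ltW b0) (noise_law_W N cst_b).
rewrite (E_mul_I u0_sq) (E_mul_I Wb).
have -> : \int[Q]_w (I w ^+ 2) =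
   \int[mu]_(s in `[0, b]) (h s * \int[mu]_(t in `[0, b]) (h t * cov s t)).
  rewrite (_ : \int[Q]_w _ = \int[Q]_w (I w * I w))//.
  rewrite (E_mul_I I_sq); apply: eq_Rintegral => s; rewrite inE/= in_itv/= => sb.
  congr (_ * _); have [Ws _] := W_sq sb.
  rewrite (_ : \int[Q]_w _ = \int[Q]_w (W s w * I w)); last first.
    by apply: eq_Rintegral => w _; rewrite mulrC.
  rewrite (E_mul_I Ws); apply: eq_Rintegral => t; rewrite inE/= in_itv/= => tb.
  by rewrite E_cov.
rewrite (noise_uncorrelated N cst_b) E_u0 E_W//.
congr (_ + _ * _ + _ * _).
  apply: eq_Rintegral => s; rewrite inE/= in_itv/= => sb.
  by rewrite (noise_uncorrelated N sb) E_u0 E_W.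
by apply: eq_Rintegral => s; rewrite inE/= in_itv/= => sb; rewrite E_cov.
Qed.

End frozen_moments.

(** * The expectation of a product of independent variables *)

Section product_law.
Context {d : measure_display} {T : measurableType d} {R : realType}.
Variables (Q : probability T R) (X Y : {RV Q >-> R}).

Hypothesis XY : forall S1 S2 : set R, measurable S1 -> measurable S2 ->
  Q (X @^-1` S1 `&` Y @^-1` S2) = (Q (X @^-1` S1) * Q (Y @^-1` S2))%E.

Let Z (w : T) : R * R := (X w, Y w).
Let mZ : measurable_fun setT Z.
Proof. by apply/measurable_fun_pairP; split; exact: measurable_funP. Qed.

HB.instance Definition _ := isMeasurableFun.Build _ _ _ _ Z mZ.

Let PZ (S : set (R * R)) : measurable S ->
  (distribution Q X \x distribution Q Y)%E S = pushforward Q Z S.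
Proof.
apply: (@product_measure_unique _ _ _ _ _ (distribution Q X) (distribution Q Y)
  (pushforward Q Z)).
by move=> S1 S2 mS1 mS2; rewrite /distribution /pushforward -XY.
Qed.

(** By [XY] the law of the pair agrees with the product of the laws on rectangles, hence everywhere;
    Fubini for the function [x * y] concludes. *)
Lemma Rintegral_indep : sqint Q X -> sqint Q Y ->
  \int[Q]_w (X w * Y w) = \int[Q]_w X w * \int[Q]_w Y w.
Proof.
move=> X2 Y2.
have iXY := sqintM X2 Y2.
have iX := sqint_rint X2; have iY := sqint_rint Y2.
pose f (z : R * R) : \bar R := (z.1 * z.2)%:E.
have mf : measurable_fun setT f.
  apply/measurable_EFinP; apply: measurable_funM; [exact: measurable_fst|exact: measurable_snd].
have pf : (distribution Q X \x distribution Q Y)%E.-integrable setT f.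
  have /integrableP[_ h] := @integrable_pushforward _ _ _ _ _ Z mZ Q setT f mf iXY measurableT.
  apply/integrableP; split => //.
  by rewrite (eq_measure_integral (pushforward Q Z))// => S mS _; exact: PZ.
rewrite /Rintegral -[X in fine X = _](@integral_pushforward _ _ _ _ _ Z mZ Q setT f)//.
rewrite [in LHS](eq_measure_integral (distribution Q X \x distribution Q Y)%E); last first.
  by move=> S mS _; apply/esym; exact: PZ.
rewrite -integral12_prod_meas1// /fubini_F /f/=.
have EY : (\int[distribution Q Y]_y y%:E = \int[Q]_w (Y w)%:E)%E.
  by rewrite (@integral_pushforward _ _ _ _ _ Y _ Q setT EFin).
have EX : (\int[distribution Q X]_y y%:E = \int[Q]_w (X w)%:E)%E.
  by rewrite (@integral_pushforward _ _ _ _ _ X _ Q setT EFin).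
have ipX : (distribution Q X).-integrable setT EFin.
  exact: (@integrable_pushforward _ _ _ _ _ X _ Q setT EFin).
have ipY : (distribution Q Y).-integrable setT EFin.
  exact: (@integrable_pushforward _ _ _ _ _ Y _ Q setT EFin).
under eq_integral => x _.
  under eq_integral => y _ do rewrite EFinM.
  rewrite integralZl// EY (rint_EFin iY) muleC.
  over.
by rewrite integralZl// EX (rint_EFin iX)/= mulrC.
Qed.

End product_law.

(** * Stability of the mean and the variance under a small mean-square error *)

Section approximation.
Context {d : measure_display} {T : measurableType d} {R : realType}.
Variable Q : probability T R.

Lemma E_cst (c : R) : \int[Q]_w c = c.
Proof. by rewrite Rintegral_cst// [X in fine X]probability_setT mulr1. Qed.

Lemma E_var (X : T -> R) (m : R) : sqint Q X ->
  \int[Q]_w ((X w - m) ^+ 2) =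
  \int[Q]_w (X w ^+ 2) - 2 * m * \int[Q]_w X w + m ^+ 2.
Proof.
move=> X2; have one : sqint Q (fun=> 1) by split; [|exact: rint_cst].
have := E_sqr3 1 (- m) 0 X2 one one.
rewrite (_ : \int[Q]_w (X w * 1) = \int[Q]_w X w); last first.
  by apply: eq_Rintegral => w _; rewrite mulr1.
rewrite [X in X = _](_ : _ = \int[Q]_w ((X w - m) ^+ 2)); last first.
  by apply: eq_Rintegral => w _; congr (_ ^+ 2); ring.
move=> ->; rewrite !E_cst.
by move: (\int[Q]_w _) (\int[Q]_w _) => x y; ring.
Qed.

(** With [D = X - F], integrate the weighted inequalities [|D| <= e / 2 + D^2 / (2 e)] and
    [|F D| <= e F^2 / 2 + D^2 / (2 e)]; as [D^2] has mean at most [e^2], each right-hand side is of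
    order [e]. *)
Lemma moments_approx (X F : T -> R) (e : R) : sqint Q F -> sqint Q (fun w => X w - F w) ->
  0 < e -> \int[Q]_w ((X w - F w) ^+ 2) <= e ^+ 2 ->
  let c1 := \int[Q]_w F w in let c2 := \int[Q]_w (F w ^+ 2) in
  let m := \int[Q]_w X w in
  [/\ rint Q X, rint Q (fun w => (X w - m) ^+ 2), `|m - c1| <= e &
    `|\int[Q]_w ((X w - m) ^+ 2) - (c2 - c1 ^+ 2)| <=
      e * (c2 + 1 + 2 * `|c1|) + 2 * e ^+ 2].
Proof.
move=> F2 D2 e0 De c1 c2 m.
pose D w := X w - F w.
have XE : X = fun w => F w + D w by apply/funext => w; rewrite /D; ring.
have X2 : sqint Q X by rewrite XE; exact: sqintD.
have [_ iF2] := F2; have [_ iD2] := D2.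
have iD := sqint_rint D2; have iF := sqint_rint F2; have iFD := sqintM F2 D2.
have one : sqint Q (fun=> 1) by split; [|exact: rint_cst].
have mE : m = c1 + \int[Q]_w D w by rewrite /m XE RintegralD.
have Eabs (f g : T -> R) : rint Q f -> rint Q g ->
    (forall w, `|f w| <= g w) -> `|\int[Q]_w f w| <= \int[Q]_w g w.
  move=> fi gi fg; apply: le_trans (le_normr_Rintegral measurableT fi) _.
  by apply: E_le => //; exact: integrable_norm fi.
have ae : `|\int[Q]_w D w| <= e.
  have h : `|\int[Q]_w D w| <= \int[Q]_w ((e / 2) * 1 + (e^-1 / 2 * D w ^+ 2 + 0)).
    apply: Eabs => //.
      by apply: rintD; [exact: rint_cst|apply: rintD; [exact: rintZ|exact: rint_cst]].
    move=> w; rewrite mulr1 addr0 -(real_normK (num_real (D w))).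
    rewrite -subr_ge0 (_ : _ - _ = e^-1 / 2 * (e - `|D w|) ^+ 2); last first.
      by field; rewrite gt_eqF.
    by rewrite mulr_ge0 ?sqr_ge0// divr_ge0// invr_ge0 ltW.
  apply: le_trans h _; rewrite !EZD;
    try by do ?[exact: iD2|exact: rint_cst|apply: rintD|apply: rintZ].
  rewrite !E_cst mulr1 addr0.
  apply: (@le_trans _ _ (e / 2 + e^-1 / 2 * e ^+ 2)).
    by rewrite lerD2l ler_wpM2l// divr_ge0// invr_ge0 ltW.
  by rewrite le_eqVlt; apply/orP; left; apply/eqP; field; rewrite gt_eqF.
have fe : `|2 * \int[Q]_w (F w * D w)| <= e * (c2 + 1).
  have h : `|\int[Q]_w (F w * D w)| <= \int[Q]_w ((e / 2) * F w ^+ 2 + (e^-1 / 2 * D w ^+ 2 + 0)).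
    apply: Eabs => //.
      by apply: rintD; [exact: rintZ|apply: rintD; [exact: rintZ|exact: rint_cst]].
    move=> w; rewrite addr0 normrM -(real_normK (num_real (D w))) -(real_normK (num_real (F w))).
    rewrite -subr_ge0 (_ : _ - _ = e^-1 / 2 * (e * `|F w| - `|D w|) ^+ 2); last first.
      by field; rewrite gt_eqF.
    by rewrite mulr_ge0 ?sqr_ge0// divr_ge0// invr_ge0 ltW.
  rewrite normrM ger0_norm//; apply: (le_trans (ler_wpM2l _ h)) => //.
  rewrite !EZD;
    try by do ?[exact: iD2|exact: iF2|exact: rint_cst|apply: rintD|apply: rintZ].
  rewrite !E_cst addr0 -/c2.
  apply: (@le_trans _ _ (2 * (e / 2 * c2 + e^-1 / 2 * e ^+ 2))).
    by rewrite ler_wpM2l// lerD2l ler_wpM2l// divr_ge0// invr_ge0 ltW.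
  by rewrite le_eqVlt; apply/orP; left; apply/eqP; field; rewrite gt_eqF.
split.
- exact: sqint_rint.
- have nm : sqint Q (fun=> - m) by split; [|exact: rint_cst].
  by have [] := sqintD X2 nm.
- by rewrite mE addrC addKr.
rewrite E_var// -/m.
have X2E : \int[Q]_w (X w ^+ 2) = c2 + \int[Q]_w (D w ^+ 2) + 2 * \int[Q]_w (F w * D w).
  have i0 : sqint Q (fun=> 0) by split; [|exact: rint_cst].
  have := E_sqr3 1 1 0 F2 D2 i0.
  rewrite [X in X = _](_ : _ = \int[Q]_w (X w ^+ 2)); last first.
    by apply: eq_Rintegral => w _; congr (_ ^+ 2); ring.
  by rewrite expr0n/= !mulr0 !mul0r !addr0 !mulr1 expr1n !mul1r.
rewrite X2E mE -/(D _).
have De' : \int[Q]_w (D w ^+ 2) <= e ^+ 2 by exact: De.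
have D0 : 0 <= \int[Q]_w (D w ^+ 2) by apply: Rintegral_ge0 => w _; exact: sqr_ge0.
move: ae fe De' D0.
move: (\int[Q]_w D w) (\int[Q]_w (F w * D w)) (\int[Q]_w (D w ^+ 2)) => x y z xe ye ze z0.
(* The difference of the variances is [2 E[F D] + E[D^2] - 2 c1 E[D] - E[D]^2]. *)
rewrite (_ : _ - _ = 2 * y + (z + (- (2 * c1 * x) - x ^+ 2))); last by ring.
apply: le_trans (ler_normD _ _) _.
have : `|z + (- (2 * c1 * x) - x ^+ 2)| <= 2 * e ^+ 2 + e * (2 * `|c1|).
  have c1x : `|2 * c1 * x| <= e * (2 * `|c1|).
    by rewrite !normrM ger0_norm// mulrC ler_wpM2r// mulr_ge0.
  have xx : 0 <= x ^+ 2 <= e ^+ 2.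
    rewrite sqr_ge0/= -(real_normK (num_real x)) lerXn2r ?nnegrE//.
    exact: ltW.
  move: c1x; rewrite ler_norml => /andP[h1 h2].
  case/andP: xx => h3 h4.
  by rewrite ler_norml; apply/andP; split; lra.
by move: ye; set a := `|2 * y|; set b := `|_ + _|; lra.
Qed.

End approximation.

(** * Conditioning on an event of positive probability *)

Section conditioning.
Context {d : measure_display} {T : measurableType d} {R : realType}.
Variables (P : probability T R) (A : set T) (mA : measurable A).
Hypothesis A0 : (0 < P A)%E.

(** As a genuine probability measure it turns conditional moments into ordinary integrals. The last
    argument of [mnormalize] is the value for a restriction of total mass 0 or infinity, which [A0]
    and the finiteness of [P] exclude. *)
Definition condp : set T -> \bar R := mnormalize (mrestr P mA) P.

HB.instance Definition _ := Probability.on condp.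

Let PA_fin : P A \is a fin_num.
Proof. exact: fin_num_measure. Qed.

Let p : R := fine (P A).
Let p0 : 0 < p.
Proof. by rewrite fine_gt0// A0 ltey_eq PA_fin. Qed.
Let PAE : P A = p%:E. Proof. by rewrite fineK. Qed.

Lemma condpE (S : set T) : condp S = (P (S `&` A) * (p^-1)%:E)%E.
Proof.
rewrite /condp /mnormalize/= /mrestr setTI.
by rewrite gt_eqF//= lt_eqF// ltey_eq PA_fin.
Qed.

(** The positive and negative parts are scaled by [p^-1 > 0]. Integrability is not assumed, so
    compatibility of the scaling with the extended difference is checked for finite and infinite
    parts. *)
Lemma integral_condp (f : T -> R) : measurable_fun setT f ->
  (\int[condp]_w (f w)%:E = (\int[P]_(w in A) (f w)%:E) * (p^-1)%:E)%E.
Proof.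
move=> mf; have pV0 : 0 <= p^-1 by rewrite invr_ge0 ltW.
have pV : 0 < p^-1 by rewrite invr_gt0.
have mf' : measurable_fun setT (EFin \o f) by exact/measurable_EFinP.
have H (h : T -> \bar R) : measurable_fun setT h -> (forall w, 0 <= h w)%E ->
    (\int[condp]_w h w = (p^-1)%:E * \int[P]_(w in A) h w)%E.
  move=> mh h0.
  rewrite (eq_measure_integral (mscale (NngNum pV0) (mrestr P mA))).
    by rewrite ge0_integral_mscale//= integral_mrestr.
  by move=> S mS _; rewrite /= condpE muleC.
rewrite [LHS]integralE [in RHS]integralE.
rewrite (H _ (measurable_funepos mf') (funepos_ge0 _)).
rewrite (H _ (measurable_funeneg mf') (funeneg_ge0 _)).
have : (0 <= \int[P]_(w in A) (fun w => (f w)%:E)^\+ w)%E.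
  by apply: integral_ge0 => w _; exact: funepos_ge0.
have : (0 <= \int[P]_(w in A) (fun w => (f w)%:E)^\- w)%E.
  by apply: integral_ge0 => w _; exact: funeneg_ge0.
set a := (\int[P]_(w in A) _^\+ w)%E; set b := (\int[P]_(w in A) _^\- w)%E.
move: a b => [a| |] [b| |]//= _ _; rewrite ?gt0_muley ?gt0_mulye ?lte_fin//.
- by rewrite -!(EFinM, EFinD); congr EFin; ring.
- by rewrite -EFinM /= addeNy gt0_mulNye ?lte_fin.
- by rewrite /= addeNy gt0_mulNye ?lte_fin.
Qed.

Lemma cond_meanE (X : T -> R) : rint condp X ->
  cond_mean P A X = (\int[condp]_w X w)%:E.
Proof. by move=> iX; rewrite -rint_EFin// integral_condp//; exact: rint_measurable iX. Qed.

Lemma cond_varE (X : T -> R) : rint condp X ->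
  rint condp (fun w => (X w - \int[condp]_w X w) ^+ 2) ->
  cond_var P A X = (\int[condp]_w ((X w - \int[condp]_w X w) ^+ 2))%:E.
Proof. by move=> iX iX2; rewrite /cond_var (cond_meanE iX) cond_meanE. Qed.

Lemma mlaw_condp (Y : T -> R) (nu : set R -> \bar R) :
  (forall S, measurable S -> P (Y @^-1` S `&` A) = (nu S * P A)%E) ->
  has_mlaw condp Y 1 nu.
Proof.
move=> h S mS; rewrite condpE h// PAE -muleA -EFinM mulfV ?gt_eqF//.
by rewrite mule1 mul1e.
Qed.

End conditioning.

(** * Independence of generated sigma-algebras, unfolded to events *)

Section independence.
Context {d : measure_display} {T : measurableType d} {R : realType}.
Variables (P : probability T R).

Lemma indep_systems3 (F0 F1 F2 : set (set T)) : indep_systems P [:: F0; F1; F2] ->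
  forall E0 E1 E2, F0 E0 -> F1 E1 -> F2 E2 ->
  P (E0 `&` E1 `&` E2) = (P E0 * P E1 * P E2)%E.
Proof.
move=> h E0 E1 E2 h0 h1 h2.
have := h (finset xpredT) (fun i => nth setT [:: E0; E1; E2] i).
rewrite !big_mkcond !big_ord_recl big_ord0/= !inE/= mule1 muleA => <-; last first.
  by case=> -[|[|[|//]]] i3 _.
congr (P _); apply/seteqP; split => w /=.
  by move=> [[w0 w1] w2] [[|[|[|//]]] i3] _.
move=> hw; split; [split|].
- by apply: (hw (@Ordinal 3 0 isT)); rewrite /= inE.
- by apply: (hw (@Ordinal 3 1 isT)); rewrite /= inE.
- by apply: (hw (@Ordinal 3 2 isT)); rewrite /= inE.
Qed.

Lemma indep_systems4 (F0 F1 F2 F3 : set (set T)) :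
  indep_systems P [:: F0; F1; F2; F3] ->
  forall E0 E1 E2 E3, F0 E0 -> F1 E1 -> F2 E2 -> F3 E3 ->
  P (E0 `&` E1 `&` E2 `&` E3) = (P E0 * P E1 * P E2 * P E3)%E.
Proof.
move=> h E0 E1 E2 E3 h0 h1 h2 h3.
have := h (finset xpredT) (fun i => nth setT [:: E0; E1; E2; E3] i).
rewrite !big_mkcond !big_ord_recl big_ord0/= !inE/= mule1 !muleA => <-; last first.
  by case=> -[|[|[|[|//]]]] i3 _.
congr (P _); apply/seteqP; split => w /=.
  by move=> [[[w0 w1] w2] w3] [[|[|[|[|//]]]] i3] _.
move=> hw; split; [split; [split|]|].
- by apply: (hw (@Ordinal 4 0 isT)); rewrite /= inE.
- by apply: (hw (@Ordinal 4 1 isT)); rewrite /= inE.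
- by apply: (hw (@Ordinal 4 2 isT)); rewrite /= inE.
- by apply: (hw (@Ordinal 4 3 isT)); rewrite /= inE.
Qed.

Lemma g_sigma_preimageT (Y : T -> R) : g_sigma_algebra_preimage Y setT.
Proof. by exists setT => //; rewrite preimage_setT setTI. Qed.

Lemma g_sigma_preimageS (Y : T -> R) (S : set R) : measurable S ->
  g_sigma_algebra_preimage Y (Y @^-1` S).
Proof. by move=> mS; exists S => //; rewrite setTI. Qed.

Lemma process_sigmaT (X : R -> {RV P >-> R}) : process_sigma X setT.
Proof. by rewrite -setC0; apply: sigma_algebraC; exact: sigma_algebra0. Qed.

Lemma process_sigma_preimage (X : R -> {RV P >-> R}) t (S : set R) : 0 <= t ->
  measurable S -> process_sigma X (X t @^-1` S).
Proof.
move=> t0 mS; apply: sub_sigma_algebra; exists t => //.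
exact: g_sigma_preimageS.
Qed.

Lemma process_sigma_incr (X : R -> {RV P >-> R}) s t (S : set R) :
  0 <= s -> 0 <= t -> measurable S ->
  process_sigma X ((fun w => X t w - X s w) @^-1` S).
Proof.
move=> s0 t0 mS.
pose G := \bigcup_(t in [set t : R | 0 <= t]) g_sigma_algebra_preimage (X t).
have mX r : 0 <= r -> measurable_fun (setT : set (g_sigma_algebraType G)) (X r).
  by move=> r0 _ B mB; rewrite setTI; exact: process_sigma_preimage.
have := measurable_funB (mX t t0) (mX s s0).
by move=> /(_ measurableT S mS); rewrite setTI.
Qed.

Lemma process_sigma_measurable (X : R -> {RV P >-> R}) : process_sigma X `<=` measurable.
Proof.
apply: smallest_sub; first exact: sigma_algebra_measurable.
move=> _ [t t0 [S mS <-]].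
exact: measurable_funP.
Qed.

End independence.

(** * Brownian motion: a regular version, and its law under conditioning *)

Section brownian_facts.
Context {d : measure_display} {T : measurableType d} {R : realType}.
Variables (P : probability T R) (W : R -> {RV P >-> R}).
Hypothesis BW : brownian W.

(** [brownian] gives the law for [s < t]; at [s = t] the increment is 0 and [gaussian_law 0 0] is
    the Dirac mass at 0. *)
Lemma brownian_incr s t (S : set R) : 0 <= s -> s <= t -> measurable S ->
  P ((fun w => W t w - W s w) @^-1` S) = gaussian_law 0 (t - s) S.
Proof.
move=> s0; rewrite le_eqVlt => /orP[/eqP <-|st] mS; last first.
  by have [_ _ h _] := BW; exact: h.
rewrite subrr gaussian_lawE eqxx.
under eq_fun => w do rewrite subrr.
rewrite preimage_cst diracE; case: ifPn => _; [exact: probability_setT|exact: measure0].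
Qed.

Lemma measurable_incr s t : measurable_fun setT (fun w => W t w - W s w).
Proof. by apply: measurable_funB; exact: measurable_funP. Qed.

Lemma ae_eq_measure (E1 E2 : set T) : measurable E1 -> measurable E2 ->
  {ae P, forall w, E1 w <-> E2 w} -> P E1 = P E2.
Proof.
move=> m1 m2 [N [mN PN hN]].
have h (B1 B2 : set T) : measurable B1 -> measurable B2 ->
    (forall w, ~ N w -> B1 w -> B2 w) -> (P B1 <= P B2)%E.
  move=> mB1 mB2 sub; apply: (@le_trans _ _ (P (B2 `|` N))).
    apply: le_measure; rewrite ?inE//; first exact: measurableU.
    by move=> w B1w; have [Nw|nN] := pselect (N w); [right|left; exact: sub].
  by apply: le_trans (measureU2 _ mB2 mN) _; rewrite [X in (_ + X)%E]PN adde0.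
apply/eqP; rewrite eq_le; apply/andP; split; apply: h => // w nN Ew.
  by have := contra_not (@hN w) nN; rewrite /= notK => /iffLR; exact.
by have := contra_not (@hN w) nN; rewrite /= notK => /iffRL; exact.
Qed.

(** Joint measurability and the pathwise lemmas ask for continuity of every path at every time. The
    version is stopped at time [b], held constant before 0, and set to 0 on a measurable null set
    containing the irregular paths; laws and independence carry over through almost sure
    equality. *)
Lemma brownian_clean b : 0 <= b -> exists W' : R -> T -> R,
  [/\ forall t, measurable_fun setT (W' t), forall w, continuous (W' ^~ w)
    & {ae P, forall w, forall t, 0 <= t <= b -> W' t w = W t w}].
Proof.
move=> b0; have [_ [N [mN PN hN]] _ _] := BW.
exists (fun t w => W (clip b t) w * \1_(~` N) w); split.
- move=> t; apply: measurable_funM; first exact: measurable_funP.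
  by apply: measurable_indic; exact: measurableC.
- move=> w; have [Nw|nN] := pselect (N w).
    rewrite (_ : (fun t => _) = fun=> 0); first exact: cst_continuous.
    by apply/funext => t; rewrite indicE memNset ?mulr0//; exact.
  apply: continuousM_fun; last exact: cst_continuous.
  apply: (continuous_clip_comp (f := W ^~ w) b0).
  by apply: contrapT => h; apply: nN; exact: hN.
- exists N; split => // w /= h; apply: contrapT => nN; apply: h => t tb.
  by rewrite clip_id// indicE mem_set ?mulr1.
Qed.

Variables (b : R) (b0 : 0 <= b) (W' : R -> T -> R).
Hypothesis mW' : forall t, measurable_fun setT (W' t).
Hypothesis cW' : forall w, continuous (W' ^~ w).
Hypothesis WW' : {ae P, forall w, forall t, 0 <= t <= b -> W' t w = W t w}.

(** Stated for any event independent of the noise, because it serves both for the mode event and, in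
    SSM, for the jump event. *)
Lemma mlaw_incr (E : set T) s t (S : set R) : measurable E ->
  (forall E2, process_sigma W E2 -> P (E `&` E2) = (P E * P E2)%E) ->
  0 <= s -> s <= t -> t <= b -> measurable S ->
  P ((fun w => W' t w - W' s w) @^-1` S `&` E) = (gaussian_law 0 (t - s) S * P E)%E.
Proof.
move=> mE hE s0 st tb mS; have t0 := le_trans s0 st.
have sb := le_trans st tb.
have pre (Y : T -> R) : measurable_fun setT Y -> measurable (Y @^-1` S).
  by move=> mY; rewrite -[X in measurable X]setTI; exact: mY.
rewrite -(brownian_incr s0 st mS) muleC -hE; last exact: process_sigma_incr.
rewrite setIC; apply: ae_eq_measure.
- by apply: measurableI => //; apply: pre; exact: measurable_funB.
- by apply: measurableI => //; apply: pre; exact: measurable_incr.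
apply: filterS WW' => w h.
by rewrite /= !h ?s0 ?t0.
Qed.

Lemma mlaw_W (E : set T) t (S : set R) : measurable E ->
  (forall E2, process_sigma W E2 -> P (E `&` E2) = (P E * P E2)%E) ->
  0 <= t <= b -> measurable S ->
  P (W' t @^-1` S `&` E) = (gaussian_law 0 t S * P E)%E.
Proof.
move=> mE hE /andP[t0 tb] mS.
rewrite -[in RHS](subr0 t) -(mlaw_incr mE hE (lexx 0) t0 tb mS).
have pre (Y : T -> R) : measurable_fun setT Y -> measurable (Y @^-1` S).
  by move=> mY; rewrite -[X in measurable X]setTI; exact: mY.
apply: ae_eq_measure.
- by apply: measurableI => //; exact: pre.
- by apply: measurableI => //; apply: pre; exact: measurable_funB.
have [W0 _ _ _] := BW.
apply: filterS2 WW' W0 => w h h0.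
by rewrite /= [W' 0 w]h ?lexx// h0 subr0.
Qed.

Variables (A : set T) (mA : measurable A) (A0 : (0 < P A)%E).
Variables (u0 : {RV P >-> R}) (m0 v0 : R) (v0_ge0 : 0 <= v0).
Hypothesis lu0 : has_law P u0 (gaussian_law m0 v0).
Hypothesis indep : forall E0 E2, g_sigma_algebra_preimage u0 E0 ->
  process_sigma W E2 -> P (E0 `&` A `&` E2) = (P E0 * P A * P E2)%E.

Lemma indep_noise E2 : process_sigma W E2 -> P (A `&` E2) = (P A * P E2)%E.
Proof.
move=> h2; have := indep (g_sigma_preimageT u0) h2.
by rewrite setTI probability_setT mul1e.
Qed.

Lemma indep_u0 (S : set R) : measurable S ->
  P (u0 @^-1` S `&` A) = (P (u0 @^-1` S) * P A)%E.
Proof.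
move=> mS; have := indep (g_sigma_preimageS u0 mS) (@process_sigmaT _ _ _ P W).
by rewrite setIT probability_setT mule1.
Qed.

Lemma sqint_mlaw (Q : probability T R) (Y : T -> R) m v : measurable_fun setT Y ->
  0 <= v -> has_mlaw Q Y 1 (gaussian_law m v) -> sqint Q Y.
Proof.
move=> mY v0' lY; split => //.
apply: (@integrable_mlaw _ _ _ Q Y 1 m v (fun x => x ^+ 2) 4 1) => //.
by move=> x; rewrite ger0_norm ?sqr_ge0// mul1r sqr_le_exp.
Qed.

(** The initial value, the mode event and the noise are jointly independent, so conditioning on the
    event changes neither the laws of [u0] and [W'] nor their mutual independence. *)
Lemma noise_inputI : noise_input (condp P mA) u0 W' m0 v0 b.
Proof.
have mu0 : measurable_fun setT u0 by exact: measurable_funP.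
have L0 : has_mlaw (condp P mA) u0 1 (gaussian_law m0 v0).
  by apply: mlaw_condp => // S mS; rewrite indep_u0// lu0.
have LW t : 0 <= t <= b -> has_mlaw (condp P mA) (W' t) 1 (gaussian_law 0 t).
  move=> tb; apply: mlaw_condp => // S mS.
  by apply: mlaw_W => //; exact: indep_noise.
split; [exact: mu0|exact: mW'|exact: cW'|exact: L0|exact: LW| |].
  move=> s t s0 st tb; apply: mlaw_condp => // S mS.
  by apply: mlaw_incr => //; exact: indep_noise.
move=> t tb; have /andP[t0 _] := tb.
pose Y : {mfun T >-> R} :=
  MeasurableFun.Pack (MeasurableFun.Class (isMeasurableFun.Build _ _ _ _ _ (mW' t))).
apply: (@Rintegral_indep _ _ _ (condp P mA) u0 Y).
- move=> S1 S2 mS1 mS2.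
  rewrite [X in _ = (X * _)%E](etrans (L0 S1 mS1) (mul1e _)).
  rewrite [X in _ = (_ * X)%E](etrans (LW t tb S2 mS2) (mul1e _)).
  rewrite [LHS]condpE// -lu0//.
  have -> : P (u0 @^-1` S1 `&` W' t @^-1` S2 `&` A) =
      P (u0 @^-1` S1 `&` A `&` W t @^-1` S2).
    rewrite setIAC; apply: ae_eq_measure.
    + apply: measurableI; first apply: measurableI => //.
        by rewrite -[X in measurable X]setTI; exact: mu0.
      by rewrite -[X in measurable X]setTI; exact: mW'.
    + apply: measurableI; first apply: measurableI => //.
        by rewrite -[X in measurable X]setTI; exact: mu0.
      by rewrite -[X in measurable X]setTI; exact: measurable_funP.
    by apply: filterS WW' => w h; rewrite /= h.
  rewrite indep; [|exact: g_sigma_preimageS|exact: process_sigma_preimage].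
  have := mlaw_W measurableT _ tb mS2; rewrite setIT probability_setT mule1 => <-; last first.
    by move=> E2 _; rewrite setTI mul1e.
  have -> : P (W' t @^-1` S2) = P (W t @^-1` S2).
    apply: ae_eq_measure.
    + by rewrite -[X in measurable X]setTI; exact: mW'.
    + by rewrite -[X in measurable X]setTI; exact: measurable_funP.
    by apply: filterS WW' => w h; rewrite /= h.
  have PA_fin : P A \is a fin_num by exact: fin_num_measure.
  have pc : (P A * (fine (P A))^-1%:E)%E = 1%E.
    rewrite -{1}(fineK PA_fin) -EFinM mulfV//.
    by rewrite gt_eqF// fine_gt0// A0 ltey_eq PA_fin.
  rewrite -muleA [X in (_ * X)%E = _]muleC muleA.
  by rewrite -[X in (X * _)%E = _]muleA pc mule1.
- exact: sqint_mlaw L0.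
- exact: sqint_mlaw (LW t tb).
Qed.

End brownian_facts.

(** * Error estimates for a single path *)

Section pathwise.
Context {R : realType}.
Notation mu := (@lebesgue_measure R).
Implicit Types (u g G W B X : R -> R) (gam sig a c b t : R).

Definition expint b q W : R := \int[mu]_(s in `[0, b]) expR (q * `|W s|).

(** [frozen] at one sample point, to which it is convertible. *)
Definition frozen_path gam sig b (x : R) W : R :=
  expR (- gam * b) * x
  + sig * (W b - gam * \int[mu]_(s in `[0, b]) (expR (- gam * (b - s)) * W s)).

(* The integral form of [dU = - G U dt + c dW] on [[0, b]]. *)
Definition damped G c b W u :=
  forall t, 0 <= t <= b -> mu.-integrable `[0, t] (EFin \o (fun s => G s * u s)) /\
    u t = u 0 - \int[mu]_(s in `[0, t]) (G s * u s) + c * W t.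

(** Passes from the models to the regularized paths. The freedom to replace [g] by any [G] that
    agrees with it on [[0, b]] yields a constant damping when the chain does not jump. *)
Lemma damped_clip g G c b W W' u : 0 <= b ->
  (forall t, 0 <= t ->
    mu.-integrable `[0, t] (fun s => (- g s * u s)%:E) /\
    u t = u 0 + \int[mu]_(s in `[0, t]) (- g s * u s) + c * W t) ->
  (forall t, 0 <= t <= b -> W' t = W t) ->
  (forall t, 0 <= t <= b -> G t = g t) ->
  damped G c b W' (fun t => u (clip b t)).
Proof.
move=> b0 hu WW Gg t tb; have /andP[t0 tb'] := tb.
have [iu ut] := hu t t0.
have e s : s \in `[0, t]%classic -> G s * u (clip b s) = - (- g s * u s).
  rewrite inE/= in_itv/= => /andP[s0 st]; have sb := le_trans st tb'.
  by rewrite clip_id ?s0// Gg ?s0// mulNr opprK.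
have ig : mu.-integrable `[0, t] (EFin \o (fun s => G s * u (clip b s))).
  by apply: eq_integrable (integrableN iu) => // s sI /=; rewrite e.
split=> //; rewrite !clip_id ?lexx ?b0// ut WW//; congr (_ + _ + _).
rewrite -mulN1r -RintegralZl//; apply: eq_Rintegral => s sI.
by rewrite e// mulN1r opprK.
Qed.

Lemma expRN_le1 a t : 0 <= a -> 0 <= t -> expR (- a * t) <= 1.
Proof. by move=> a0 t0; rewrite -[leRHS]expR0 ler_expR mulNr oppr_le0 mulr_ge0. Qed.

Lemma expRN_le gam b s C : 0 <= s <= b -> `|gam| <= C ->
  expR (- gam * (b - s)) <= expR (C * b).
Proof.
move=> /andP[s0 sb] gC; rewrite ler_expR.
have C0 : 0 <= C by exact: le_trans (normr_ge0 _) gC.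
apply: (@le_trans _ _ (C * (b - s))).
  by rewrite ler_wpM2r ?subr_ge0// (le_trans _ gC)// (le_trans (ler_norm _))// normrN.
by rewrite ler_wpM2l// lerBlDr lerDl.
Qed.

Let cc (r : R) : continuous (fun _ : R => r).
Proof. exact: cst_continuous. Qed.

Let cexp gam b : continuous (fun s : R => expR (- gam * (b - s))).
Proof.
apply: continuous_expR_fun; apply: continuousM_fun => //.
by apply: continuousB_fun => // x; exact: cvg_id.
Qed.

Lemma Rint_cont_le (f h : R -> R) b : continuous f -> continuous h ->
  (forall s, 0 <= s <= b -> `|f s| <= h s) ->
  `|\int[mu]_(s in `[0, b]) f s| <= \int[mu]_(s in `[0, b]) h s.
Proof.
move=> cf ch fh; apply: le_trans (le_normr_Rintegral _ (continuous_itv_integrable b cf)) _ => //.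
apply: le_Rintegral => //.
- apply: continuous_itv_integrable; exact: continuous_norm_fun.
- exact: continuous_itv_integrable.
Qed.

Lemma RintZ_cont (f : R -> R) (r b : R) : continuous f ->
  \int[mu]_(s in `[0, b]) (r * f s) = r * \int[mu]_(s in `[0, b]) f s.
Proof. by move=> cf; rewrite RintegralZl//; exact: continuous_itv_integrable. Qed.

Lemma damped_const gam sig b W u : 0 < b -> continuous u -> continuous W ->
  damped (fun=> gam) sig b W u -> u b = frozen_path gam sig b (u 0) W.
Proof.
move=> b0 cu cW hu.
rewrite (@variation_of_constants _ (fun=> gam) u W gam sig b b0 (@cc gam) cu cW); last first.
  by move=> t /hu[].
rewrite -/(frozen_path gam sig b (u 0) W) -[RHS]subr0; congr (_ - _).
rewrite (@eq_Rintegral _ _ _ mu _ (fun=> 0)).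
  by rewrite Rintegral_cst// mul0r.
by move=> s _; rewrite subrr mul0r mulr0.
Qed.

Lemma damped_crude gam sig b C g W u : 0 < b -> continuous u -> continuous W ->
  `|gam| <= C -> (forall s, 0 <= s <= b -> `|g s| <= C) ->
  damped g sig b W u ->
  `|u b - frozen_path gam sig b (u 0) W| <=
  2 * expR (C * b) * (`|u 0| + `|sig| * C * \int[mu]_(s in `[0, b]) `|W s|).
Proof.
move=> b0 cu cW gC gsC hu.
have C0 : 0 <= C by exact: le_trans (normr_ge0 _) gC.
have cnW := continuous_norm_fun cW.
have bb : 0 <= b <= b by rewrite lexx ltW.
have b00 : 0 <= (0 : R) <= b by rewrite lexx ltW.
have h1 := @damped_bound _ g (fun=> C) u W sig b b0 (@cc C) (fun=> C0) cu cW gsC hu b bb.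
have muI : fine (mu `[0, b]) = b.
  by rewrite lebesgue_measure_itv/= lte_fin b0 oppr0 adde0.
rewrite RintZ_cont// Rintegral_cst// muI in h1.
set J := \int[mu]_(s in `[0, b]) `|W s| in h1 *.
have J0 : 0 <= J by apply: Rintegral_ge0.
have h2 : `|frozen_path gam sig b (u 0) W - sig * W b| <=
    expR (C * b) * (`|u 0| + `|sig| * C * J).
  rewrite (_ : _ - _ = expR (- gam * b) * u 0 - sig * gam *
     \int[mu]_(s in `[0, b]) (expR (- gam * (b - s)) * W s)); last first.
    by rewrite /frozen_path; set x := expR _; set y := (\int[_]_(_ in _) _); ring.
  apply: le_trans (ler_normB _ _) _; rewrite mulrDr; apply: lerD.
    rewrite normrM ler_wpM2r// ger0_norm ?expR_ge0//.
    by have := expRN_le b00 gC; rewrite subr0.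
  have h3 : `|\int[mu]_(s in `[0, b]) (expR (- gam * (b - s)) * W s)| <= expR (C * b) * J.
    rewrite -RintZ_cont//; apply: Rint_cont_le.
    - exact: continuousM_fun.
    - exact: continuousM_fun.
    - move=> s sb; rewrite normrM ler_wpM2r// ger0_norm ?expR_ge0//.
      exact: expRN_le.
  rewrite !normrM; apply: (@le_trans _ _ (`|sig| * C * (expR (C * b) * J))).
    apply: ler_pM => //.
    by rewrite ler_wpM2l.
  by rewrite mulrCA.
rewrite (_ : u b - _ = (u b - sig * W b) - (frozen_path gam sig b (u 0) W - sig * W b)); last by ring.
apply: le_trans (ler_normB _ _) _.
rewrite (_ : 2 * _ * _ = expR (C * b) * (`|u 0| + `|sig| * C * J) + expR (C * b) * (`|u 0| + `|sig| * C * J)); last by ring.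
by apply: lerD => //; apply: le_trans h1 _; rewrite -[`|sig| * C * J]mulrA [leLHS]mulrC.
Qed.

Lemma expint_cont q W : continuous W -> continuous (fun s => expR (q * `|W s|)).
Proof.
move=> cW; apply: continuous_expR_fun; apply: continuousM_fun => //.
exact: continuous_norm_fun.
Qed.

Lemma expint_ge0 b q W : 0 <= expint b q W.
Proof. by apply: Rintegral_ge0 => s _; exact: expR_ge0. Qed.

Lemma sqr_int_le_expint b W : 0 <= b -> continuous W ->
  (\int[mu]_(s in `[0, b]) `|W s|) ^+ 2 <= 4 * b * expint b 1 W.
Proof.
move=> b0 cW; have cnW := continuous_norm_fun cW.
apply: le_trans (Rintegral_sqr_le b0 cnW) _.
rewrite (mulrC 4 b) -mulrA ler_wpM2l// -RintZ_cont; last exact: expint_cont.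
have cW2 : continuous (fun s => `|W s| ^+ 2) by exact: continuousM_fun.
apply: le_Rintegral => //.
- exact: continuous_itv_integrable.
- by apply: continuous_itv_integrable; apply: continuousM_fun => //; exact: expint_cont.
- by move=> s _; rewrite mul1r -[X in expR X]normr_id sqr_le_exp.
Qed.

(* Jensen's inequality, through the tangent of [expR] at the mean. *)
Lemma expR_int_le_expint b q W : 0 < b -> continuous W ->
  expR (q * \int[mu]_(s in `[0, b]) `|W s|) <= b^-1 * expint b (q * b) W.
Proof.
move=> b0 cW; have cnW := continuous_norm_fun cW.
set I := \int[mu]_(s in `[0, b]) `|W s|.
have muI : fine (mu `[0, b]) = b.
  by rewrite lebesgue_measure_itv/= lte_fin b0 oppr0 adde0.
have ch : continuous (fun s => expR (q * I) * (1 - q * I) + expR (q * I) * (q * b) * `|W s|).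
  by apply: continuousD_fun => //; exact: continuousM_fun.
have : \int[mu]_(s in `[0, b]) (expR (q * I) * (1 - q * I) + expR (q * I) * (q * b) * `|W s|)
   <= expint b (q * b) W.
  apply: le_Rintegral => //; [exact: continuous_itv_integrable|
    by apply: continuous_itv_integrable; exact: expint_cont|].
  move=> s _; rewrite -mulrA -mulrDr.
  rewrite (_ : q * b * `|W s| = q * I + (q * b * `|W s| - q * I)); last by ring.
  rewrite expRD ler_wpM2l ?expR_ge0//.
  apply: le_trans (expR_ge1Dx _).
  by rewrite le_eqVlt; apply/orP; left; apply/eqP; ring.
rewrite RintegralD//; [|exact: continuous_itv_integrable|
  by apply: continuous_itv_integrable; exact: continuousM_fun].
rewrite Rintegral_cst// muI RintZ_cont// -/I => h.
rewrite ler_pdivlMl//; apply: le_trans h.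
by rewrite le_eqVlt; apply/orP; left; apply/eqP; ring.
Qed.

(** Here [damped_const] is the explicit Ornstein-Uhlenbeck solution, and [1 - exp (- a t) <= a t]
    bounds the relaxation. The bound is small with [a] and [c], as needed for [a = nu / eps] and
    [c = sig / sqrt eps]. *)
Lemma damped_OU a c b B x x0 : 0 < b -> 0 <= a -> continuous x -> continuous B ->
  damped (fun=> a) c b B x -> x 0 = x0 ->
  forall t, 0 <= t <= b -> `|x t - x0| <=
    a * b * `|x0| + `|c| * (`|B t| + a * \int[mu]_(s in `[0, b]) `|B s|).
Proof.
move=> b0 a0 cx cB hx xx0 t /andP[t0 tb].
have cnB := continuous_norm_fun cB.
have I0 : 0 <= \int[mu]_(s in `[0, b]) `|B s| by apply: Rintegral_ge0.
move: t0; rewrite le_eqVlt => /orP[/eqP <-|t0].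
  rewrite xx0 subrr normr0 addr_ge0//; first by rewrite !mulr_ge0// ltW.
  by rewrite mulr_ge0// addr_ge0// mulr_ge0.
have hx' : damped (fun=> a) c t B x.
  by move=> r /andP[r0 rt]; apply: hx; rewrite r0 (le_trans rt).
rewrite (damped_const t0 cx cB hx') /frozen_path xx0.
have Et : 1 - a * t <= expR (- a * t) by have := expR_ge1Dx (- a * t); rewrite mulNr.
have Et1 := expRN_le1 a0 (ltW t0).
rewrite (_ : _ - x0 = (expR (- a * t) - 1) * x0 + c * (B t - a *
  \int[mu]_(s in `[0, t]) (expR (- a * (t - s)) * B s))); last by ring.
apply: le_trans (ler_normD _ _) _; apply: lerD; rewrite normrM.
  rewrite ler_wpM2r// distrC ger0_norm ?subr_ge0//.
  apply: (@le_trans _ _ (a * t)); first by lra.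
  by rewrite ler_wpM2l.
rewrite ler_wpM2l//; apply: le_trans (ler_normB _ _) _.
rewrite lerD2l normrM ger0_norm// ler_wpM2l//.
apply: le_trans (Rint_cont_le (h := fun s => `|B s|) _ cnB _) _.
- exact: continuousM_fun.
- move=> s /andP[s0 st]; rewrite normrM ger0_norm ?expR_ge0//.
  by rewrite ler_piMl// expRN_le1// subr_ge0.
by apply: Rintegral_itv_mono => //; rewrite (ltW t0) tb.
Qed.

Lemma le_expR (x : R) : x <= expR x.
Proof. by apply: le_trans (expR_ge1Dx x); rewrite lerDr. Qed.

(** The inequality [p q <= p^2 + q^2]: it separates functionals of the two noises, so that no joint
    law is needed. *)
Lemma expR2_le (x y : R) : expR (x + y) <= expR (2 * x) + expR (2 * y).
Proof.
have E2 r : expR (2 * r) = expR r ^+ 2 by rewrite mulrDl !mul1r expRD expr2.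
rewrite !E2 expRD; have := expR_ge0 x; have := expR_ge0 y.
move: (expR x) (expR y) => p q q0 p0.
by have := sqr_ge0 (p - q); nra.
Qed.

Lemma expR4_le (x y z t : R) : expR (x + y + (z + t)) <=
  expR (4 * x) + expR (4 * y) + (expR (4 * z) + expR (4 * t)).
Proof.
have e4 (r : R) : 4 * r = 2 * (2 * r) by ring.
apply: le_trans (expR2_le _ _) _; rewrite !mulrDr !e4.
by apply: lerD; exact: expR2_le.
Qed.

(* [g] stays within [kap * k] of [gam], with [k = C1 (1 + |B| + \int |B|)]. *)
Lemma damped_perturbed gam sig b kap C1 c0 g W B u : 0 < b ->
  continuous u -> continuous W -> continuous g -> continuous B ->
  0 <= kap <= 1 -> 0 <= C1 ->
  (forall s, 0 <= s <= b -> `|g s - gam| <=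
     kap * (C1 * (1 + `|B s| + \int[mu]_(r in `[0, b]) `|B r|))) ->
  damped g sig b W u -> c0 = `|gam| + C1 ->
  `|u b - frozen_path gam sig b (u 0) W| ^+ 2 <=
  kap ^+ 2 * (4 * expR (`|gam| * b) ^+ 2 * (8 * (u 0 ^+ 4 + sig ^+ 4 *
      (b ^+ 3 * (expint b 16 W + (b * expR (16 * c0) + expint b (16 * C1) B
        + expint b (16 * C1 * b) B)) )) +
      (expR (16 * c0 * b) + b^-1 * expint b (16 * (C1 * (1 + b)) * b) B))).
Proof.
move=> b0 cu cW cg cB /andP[kap0 kap1] C10 gk hu c0E.
have cnW := continuous_norm_fun cW; have cnB := continuous_norm_fun cB.
set I := \int[mu]_(r in `[0, b]) `|B r| in gk.
have I0 : 0 <= I by apply: Rintegral_ge0.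
have c00 : 0 <= c0 by rewrite c0E addr_ge0.
have muI : fine (mu `[0, b]) = b.
  by rewrite lebesgue_measure_itv/= lte_fin b0 oppr0 adde0.
(* This [k] bounds the deviation divided by [kap]; the summand [|gam|] inside [c0] makes it bound
   [|g|] as well, because [kap <= 1]. *)
pose k s := (c0 + C1 * I) + C1 * `|B s|.
have ck : continuous k by apply: continuousD_fun => //; exact: continuousM_fun.
have k0 s : 0 <= k s by rewrite !addr_ge0// mulr_ge0.
have ckW := continuousM_fun ck cnW.
have bk s : C1 * (1 + `|B s| + I) <= k s.
  by rewrite /k c0E; have := normr_ge0 gam; lra.
have bt0 s : 0 <= C1 * (1 + `|B s| + I) by rewrite mulr_ge0// !addr_ge0.
have gk' s : 0 <= s <= b -> `|g s| <= k s.
  move=> /gk h; rewrite -[g s](subrK gam) (le_trans (ler_normD _ _))//.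
  apply: (@le_trans _ _ (C1 * (1 + `|B s| + I) + `|gam|)).
    rewrite lerD2r (le_trans h)// ler_piMl//.
  by rewrite /k c0E; lra.
set V := \int[mu]_(s in `[0, b]) (k s * `|W s|).
have V0 : 0 <= V by apply: Rintegral_ge0 => s _; rewrite mulr_ge0.
set K := \int[mu]_(s in `[0, b]) k s.
have K0 : 0 <= K by apply: Rintegral_ge0.
have KE : K = (c0 + C1 * I) * b + C1 * I.
  rewrite /K RintegralD//; [|exact: continuous_itv_integrable|
    by apply: continuous_itv_integrable; exact: continuousM_fun].
  by rewrite Rintegral_cst// muI RintZ_cont.
pose Y := (`|u 0| + `|sig| * V) * expR K.
have Y0 : 0 <= Y by rewrite mulr_ge0 ?expR_ge0// addr_ge0// mulr_ge0.
have hY := damped_bound b0 ck k0 cu cW gk' hu.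
pose Eg := expR (`|gam| * b).
have Eg0 : 0 <= Eg by exact: expR_ge0.
(* The last term of the variation of constants: the deviation contributes [kap * k s], and [|u s|]
   is at most [|sig * W s| + Y] by Gronwall. *)
have D1 : `|u b - frozen_path gam sig b (u 0) W| <=
    kap * (Eg * (`|sig| * V + Y * K)).
  rewrite (@variation_of_constants _ g u W gam sig b b0 cg cu cW); last first.
    by move=> t /hu[].
  rewrite -/(frozen_path gam sig b (u 0) W) addrAC subrr add0r normrN.
  have cgg : continuous (fun s => g s - gam) by exact: continuousB_fun.
  have ch : continuous (fun s => Eg * kap * (`|sig| * (k s * `|W s|) + Y * k s)).
    apply: continuousM_fun => //; apply: continuousD_fun; exact: continuousM_fun.
  apply: le_trans (Rint_cont_le (h := fun s => Eg * kap * (`|sig| * (k s * `|W s|) + Y * k s)) _ ch _) _.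
  - by apply: continuousM_fun => //; exact: continuousM_fun.
  - move=> s sb; rewrite normrM normrM -mulrA; apply: ler_pM => //.
      by rewrite ger0_norm ?expR_ge0// expRN_le.
    rewrite (_ : kap * _ = (kap * k s) * (`|sig| * `|W s| + Y)); last by ring.
    apply: ler_pM => //.
      by apply: le_trans (gk s sb) _; rewrite ler_wpM2l.
    rewrite -[u s](subrK (sig * W s)) addrC (le_trans (ler_normD _ _))//.
    by rewrite normrM lerD2l hY.
  rewrite RintZ_cont; last by apply: continuousD_fun; exact: continuousM_fun.
  rewrite RintegralD//; [|by apply: continuous_itv_integrable; exact: continuousM_fun..].
  by rewrite !RintZ_cont// -/V -/K -mulrA mulrCA.
(* The factor [K] is absorbed by [K <= exp K], the missing exponentials by [1 <= exp K]. *)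
have D2 : `|u b - frozen_path gam sig b (u 0) W| <=
    kap * (Eg * (2 * ((`|u 0| + `|sig| * V) * expR (2 * K)))).
  apply: le_trans D1 _; rewrite ler_wpM2l// ler_wpM2l//.
  have sV : 0 <= `|sig| * V by rewrite mulr_ge0.
  have u00 := normr_ge0 (u 0).
  have KK := le_expR K.
  have e1 : 1 <= expR K by rewrite -[leLHS]expR0 ler_expR.
  rewrite /Y (_ : expR (2 * K) = expR K * expR K); last by rewrite -expRD; congr expR; ring.
  have h1 : (`|u 0| + `|sig| * V) * expR K * K <= (`|u 0| + `|sig| * V) * (expR K * expR K).
    by rewrite -mulrA ler_wpM2l ?addr_ge0// ler_wpM2l// expR_ge0.
  have h2 : `|sig| * V <= (`|u 0| + `|sig| * V) * (expR K * expR K).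
    apply: (@le_trans _ _ (`|u 0| + `|sig| * V)); first by rewrite lerDr.
    by rewrite ler_peMr ?addr_ge0// mulr_ege1.
  by lra.
(* Cauchy-Schwarz twice in time gives [b ^ 3]. Then [x <= exp x], raised to the fourth power, is
   split into four exponentials, each with its exponent multiplied by 4 again: [16 = 4 * 4]. Jensen
   handles the term with [I]. *)
have V4 : V ^+ 4 <= b ^+ 3 * (expint b 16 W + (b * expR (16 * c0) +
    expint b (16 * C1) B + expint b (16 * C1 * b) B)).
  have cf2 : continuous (fun s => (k s * `|W s|) ^+ 2) by exact: continuousM_fun.
  have cf4 : continuous (fun s => ((k s * `|W s|) ^+ 2) ^+ 2) by exact: continuousM_fun.
  have V2 := Rintegral_sqr_le (ltW b0) ckW; rewrite -/V in V2.
  have W2 := Rintegral_sqr_le (ltW b0) cf2.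
  apply: (@le_trans _ _ (b ^+ 3 * \int[mu]_(s in `[0, b]) (((k s * `|W s|) ^+ 2) ^+ 2))).
    rewrite (_ : V ^+ 4 = (V ^+ 2) ^+ 2); last by rewrite -exprM.
    apply: (@le_trans _ _ ((b * \int[mu]_(s in `[0, b]) ((k s * `|W s|) ^+ 2)) ^+ 2)).
      rewrite lerXn2r ?nnegrE ?sqr_ge0// mulr_ge0 ?(ltW b0)//.
      by apply: Rintegral_ge0 => s _; exact: sqr_ge0.
    rewrite exprMn (_ : b ^+ 3 = b ^+ 2 * b); last by rewrite -exprSr.
    by rewrite -mulrA ler_wpM2l// sqr_ge0.
  rewrite ler_wpM2l ?exprn_ge0 ?(ltW b0)//.
  have c16W := @expint_cont 16 W cW; have c16B := @expint_cont (16 * C1) B cB.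
  apply: (@le_trans _ _ (\int[mu]_(s in `[0, b])
     (expR (16 * `|W s|) + (expR (16 * c0) + expR (16 * C1 * I) + expR (16 * C1 * `|B s|))))).
    apply: le_Rintegral => //.
    - exact: continuous_itv_integrable.
    - by apply: continuous_itv_integrable; do 2 apply: continuousD_fun => //.
    move=> s _; rewrite -exprM.
    apply: (@le_trans _ _ (expR (k s + `|W s|) ^+ 4)).
      rewrite lerXn2r ?nnegrE ?expR_ge0 ?mulr_ge0// expRD.
      by rewrite ler_pM// le_expR.
    rewrite (_ : expR _ ^+ 4 = expR (4 * `|W s| + 4 * c0 + (4 * (C1 * I) + 4 * (C1 * `|B s|)))); last first.
      by rewrite !exprS expr0 mulr1 -!expRD; congr expR; rewrite /k; ring.
    apply: le_trans (expR4_le _ _ _ _) _.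
    have e16 (r : R) : 4 * (4 * r) = 16 * r by ring.
    rewrite !e16.
    by rewrite -!mulrA !addrA.
  rewrite RintegralD//; [|exact: continuous_itv_integrable|
    by apply: continuous_itv_integrable; apply: continuousD_fun].
  rewrite -/(expint b 16 W) lerD2l RintegralD//; [|exact: continuous_itv_integrable..].
  rewrite -/(expint b (16 * C1) B) Rintegral_cst// muI.
  have := expR_int_le_expint (16 * C1) b0 cB; rewrite -/I ler_pdivlMl// => J1.
  by rewrite mulrDl (mulrC b (expR (16 * c0))); move: J1; rewrite (mulrC b); lra.
have K8 : expR (8 * K) <= expR (16 * c0 * b) + b^-1 * expint b (16 * (C1 * (1 + b)) * b) B.
  have := expR_int_le_expint (16 * (C1 * (1 + b))) b0 cB; rewrite -/I => J1.
  rewrite (_ : 8 * K = 8 * c0 * b + 8 * (C1 * (1 + b)) * I); last by rewrite KE; ring.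
  apply: le_trans (expR2_le _ _) _.
  rewrite (_ : 2 * (8 * c0 * b) = 16 * c0 * b); last by ring.
  rewrite (_ : 2 * (8 * (C1 * (1 + b)) * I) = 16 * (C1 * (1 + b)) * I); last by ring.
  by rewrite lerD2l.
(* After squaring, [p^2 q^2 <= p^4 + q^4] separates the polynomial factor from the exponential one;
   this is why fourth powers and [exp (8 K)] occur. *)
have sq : `|u b - frozen_path gam sig b (u 0) W| ^+ 2 <=
    kap ^+ 2 * (4 * Eg ^+ 2 * ((`|u 0| + `|sig| * V) ^+ 4 + expR (8 * K))).
  apply: (@le_trans _ _ ((kap * (Eg * (2 * ((`|u 0| + `|sig| * V) * expR (2 * K))))) ^+ 2)).
    rewrite lerXn2r ?nnegrE//.
    by rewrite !mulr_ge0 ?expR_ge0// addr_ge0// mulr_ge0.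
  rewrite exprMn ler_wpM2l ?sqr_ge0//.
  rewrite (_ : expR (8 * K) = expR (2 * K) ^+ 4); last first.
    by rewrite !exprS expr0 mulr1 -!expRD; congr expR; ring.
  set p := (`|u 0| + _); set q := expR _.
  rewrite [leLHS](_ : _ = 4 * Eg ^+ 2 * (p ^+ 2 * q ^+ 2)); last by ring.
  rewrite ler_wpM2l ?mulr_ge0 ?sqr_ge0//.
  rewrite (exprM p 2 2) (exprM q 2 2).
  move: (p ^+ 2) (q ^+ 2) => x y.
  by have := sqr_ge0 (x - y); have := sqr_ge0 x; have := sqr_ge0 y; nra.
apply: le_trans sq _; rewrite ler_wpM2l ?sqr_ge0//.
rewrite ler_wpM2l ?mulr_ge0 ?sqr_ge0//.
apply: lerD => //.
apply: (@le_trans _ _ (8 * (u 0 ^+ 4 + sig ^+ 4 * V ^+ 4))); last first.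
  by rewrite ler_wpM2l// lerD2l ler_wpM2l// exprn_even_ge0.
have a4 (r : R) : r ^+ 4 = `|r| ^+ 4.
  by rewrite -normrX ger0_norm// exprn_even_ge0.
rewrite (a4 (u 0)) (a4 sig) -exprMn.
have : 0 <= `|sig| * V by rewrite mulr_ge0.
move: (`|sig| * V) (normr_ge0 (u 0)); move: `|u 0| => x y x0 y0.
rewrite (exprM _ 2 2) (exprM x 2 2) (exprM y 2 2).
have h1 : (x + y) ^+ 2 <= 2 * (x ^+ 2 + y ^+ 2) by have := sqr_ge0 (x - y); nra.
apply: (@le_trans _ _ ((2 * (x ^+ 2 + y ^+ 2)) ^+ 2)).
  by rewrite lerXn2r ?nnegrE ?sqr_ge0// mulr_ge0// addr_ge0// sqr_ge0.
by move: (x ^+ 2) (y ^+ 2) => p q; have := sqr_ge0 (p - q); nra.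
Qed.

End pathwise.

(** * Expectations of the pathwise bounds *)

Section bounded_expectation.
Context {d : measure_display} {T : measurableType d} {R : realType}.
Variable Q : {finite_measure set T -> \bar R}.
Implicit Types (f h : T -> R) (K : R).

(** Integrability and the bound travel together, so that a composite bound is integrated by
    following its syntax. *)
Definition bint f K := rint Q f /\ \int[Q]_w f w <= K.

Lemma bintD f h K L : bint f K -> bint h L -> bint (fun w => f w + h w) (K + L).
Proof.
move=> [fi fK] [hi hL]; split; first exact: rintD.
by rewrite RintegralD//; exact: lerD.
Qed.

Lemma bintZ c f K : 0 <= c -> bint f K -> bint (fun w => c * f w) (c * K).
Proof.
move=> c0 [fi fK]; split; first exact: rintZ.
by rewrite RintegralZl//; exact: ler_wpM2l.
Qed.

Lemma bint_expint (W : R -> T -> R) b p q : 0 < b -> 0 <= p ->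
  (forall t, measurable_fun setT (W t)) -> (forall w, continuous (W ^~ w)) ->
  (forall t, 0 <= t <= b -> has_mlaw Q (W t) p (gaussian_law 0 t)) ->
  bint (fun w => expint b q (W ^~ w)) (p * gaussian_exp_bound 0 b q * b).
Proof.
move=> b0 p0 mW cW lW.
pose g s w := expR (q * `|W s w|).
have mg s : measurable_fun setT (g s) by exact: measurable_expR_norm.
have cg w : continuous (g ^~ w) by exact: (@expint_cont _ q (W ^~ w) (cW w)).
have gK s : 0 <= s <= b -> (\int[Q]_w (`|g s w|)%:E <= (p * gaussian_exp_bound 0 b q)%:E)%E.
  move=> sb; under eq_integral => w _ do rewrite ger0_norm ?expR_ge0//.
  exact: integral_exp_mlaw (mW s) p0 sb (lW s sb).
have ii := integrable_path_integral (ltW b0) mg cg gK.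
split; first exact: ii.
rewrite -lee_fin -rint_EFin//.
by apply: (ge0_integral_path_integral_le (ltW b0) mg cg gK) => s w; exact: expR_ge0.
Qed.

Lemma bint_exp (u0 : T -> R) m0 v0 p : 0 <= v0 -> 0 <= p -> measurable_fun setT u0 ->
  has_mlaw Q u0 p (gaussian_law m0 v0) ->
  bint (fun w => expR `|u0 w|) (p * gaussian_exp_bound m0 v0 1).
Proof.
move=> v00 p0 mu lu.
have vv : 0 <= v0 <= v0 by rewrite v00 lexx.
have := integral_exp_mlaw 1 mu p0 vv lu.
under eq_integral => w _ do rewrite mul1r.
move=> h; apply: rint_of_le => //.
by apply: measurableT_comp => //; exact: measurableT_comp.
Qed.

End bounded_expectation.

(** * From a conditional mean-square error to convergence of means and variances *)

Section closeness.
Context {R : realType}.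

(** The conclusion of [moments_approx] for conditional moments; the real witnesses record that these
    are finite. *)
Definition close {d} {T : measurableType d} (P : probability T R) (A : set T)
    (X : T -> R) (c1 c2 e : R) := exists m v,
  [/\ cond_mean P A X = m%:E, cond_var P A X = v%:E, `|m - c1| <= e
    & `|v - (c2 - c1 ^+ 2)| <= e * (c2 + 1 + 2 * `|c1|) + 2 * e ^+ 2].

Lemma cond_close {d} {T : measurableType d} (P : probability T R) (A : set T)
    (mA : measurable A) (X F Bd : T -> R) (e : R) : (0 < P A)%E ->
  measurable_fun setT X -> sqint (condp P mA) F -> (forall w, 0 <= Bd w) ->
  {ae P, forall w, A w -> (X w - F w) ^+ 2 <= Bd w} ->
  0 < e -> bint (condp P mA) Bd (e ^+ 2) ->
  close P A X (\int[condp P mA]_w F w) (\int[condp P mA]_w (F w ^+ 2)) e.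
Proof.
move=> A0 mX F2 B0 [N [mN PN hN]] e0 [iB Be].
have mF := F2.1; have mB := rint_measurable iB.
have mD2 : measurable_fun setT (fun w => (X w - F w) ^+ 2).
  by apply: measurable_funX; exact: measurable_funB.
have aeQ : {ae condp P mA, forall w, setT w ->
    (((X w - F w) ^+ 2)%:E <= (Bd w)%:E)%E}.
  (* The pointwise bound is known on [A] only, but the complement of [A] is null for the conditional
     probability. *)
  exists (N `|` ~` A); split.
  - by apply: measurableU => //; exact: measurableC.
  - apply/eqP; rewrite eq_le measure_ge0 andbT.
    apply: le_trans (measureU2 _ mN (measurableC mA)) _.
    rewrite [X in (X + _)%E](condpE mA A0 N) [X in (_ + X)%E](condpE mA A0 (~` A)).
    rewrite setICl measure0 mul0e adde0.
    rewrite (_ : P (N `&` A) = 0%E) ?mul0e//.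
    by apply: (subset_measure0 _ mN _ PN) => //; exact: measurableI.
  - move=> w /= h; have [Aw|nA] := pselect (A w); last by right.
    left; apply: hN => /= h'; apply: h => _; rewrite lee_fin; exact: h'.
have DB : (\int[condp P mA]_w ((X w - F w) ^+ 2)%:E <= (e ^+ 2)%:E)%E.
  apply: (@le_trans _ _ (\int[condp P mA]_w (Bd w)%:E)%E).
    apply: ae_ge0_le_integral => //.
    - by move=> w _; rewrite lee_fin sqr_ge0.
    - exact/measurable_EFinP.
    - by move=> w _; rewrite lee_fin.
    - exact/measurable_EFinP.
  by rewrite rint_EFin// lee_fin.
have [|iD De] := rint_of_le mD2 _ DB; first by move=> w; exact: sqr_ge0.
have D2 : sqint (condp P mA) (fun w => X w - F w).
  by split => //; exact: measurable_funB.
have [iX iV h1 h2] := moments_approx F2 D2 e0 De.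
exists (\int[condp P mA]_w X w),
  (\int[condp P mA]_w ((X w - \int[condp P mA]_w X w) ^+ 2)).
by split => //; [exact: cond_meanE|exact: cond_varE].
Qed.

Lemma cvg_rate (f : R -> \bar R) (c C : R) :
  (forall eps, 1 <= eps -> exists r, f eps = r%:E /\ `|r - c| <= C / Num.sqrt eps) ->
  f eps @[eps --> +oo] --> c%:E.
Proof.
move=> h; apply/fine_cvgP; split.
  near=> eps; have e1 : 1 <= eps by near: eps; exact: nbhs_pinfty_ge.
  by have [r [-> _]] := h eps e1.
apply/cvgrPdist_le => e e0; near=> eps.
have e1 : 1 <= eps by near: eps; exact: nbhs_pinfty_ge.
have [r [/= -> rC]] := h eps e1; rewrite distrC.
apply: le_trans rC _ => /=.
have C1 : 0 <= `|C| + 1 by rewrite addr_ge0.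
have s0 : 0 < Num.sqrt eps by rewrite sqrtr_gt0 (lt_le_trans _ e1).
rewrite ler_pdivrMr// mulrC -ler_pdivrMr//.
apply: (@le_trans _ _ (`|C| / e)); first by rewrite ler_wpM2r ?ler_norm// invr_ge0 ltW.
have q0 : 0 <= `|C| / e by rewrite divr_ge0// ltW.
rewrite -[leLHS](ger0_norm q0) -sqrtr_sqr ler_sqrt; last exact: le_trans ler01 e1.
by near: eps; apply: nbhs_pinfty_ge; exact: num_real.
Unshelve. all: by end_near. Qed.

Lemma close_cvg {d} (Om : R -> measurableType d) (P : forall eps, probability (Om eps) R)
    (A : forall eps, set (Om eps)) (X : forall eps, Om eps -> R) (c1 c2 K : R) :
  (forall eps, 1 <= eps -> close (P eps) (A eps) (X eps) c1 c2 (K / Num.sqrt eps)) ->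
  0 <= c2 -> 0 <= K ->
  cond_mean (P eps) (A eps) (X eps) @[eps --> +oo] --> c1%:E /\
  cond_var (P eps) (A eps) (X eps) @[eps --> +oo] --> (c2 - c1 ^+ 2)%:E.
Proof.
move=> h c20 K0; split.
  by apply: (@cvg_rate _ _ K) => eps /h[m [v [-> _ hm _]]]; exists m.
apply: (@cvg_rate _ _ (K * (c2 + 1 + 2 * `|c1|) + 2 * K ^+ 2)) => eps e1.
have [m [v [_ -> _ hv]]] := h eps e1.
exists v; split => //; apply: le_trans hv _.
(* For [eps >= 1] the quadratic term [1 / eps] is at most [1 / sqrt eps]. *)
have s1 : 1 <= Num.sqrt eps by rewrite -[leLHS]sqrtr1 ler_sqrt// (le_trans _ e1).
have s0 : 0 < Num.sqrt eps by exact: lt_le_trans s1.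
rewrite [leRHS]mulrDl [X in X + _ <= _]mulrAC lerD2l exprMn -[leRHS]mulrA ler_wpM2l// ler_wpM2l ?sqr_ge0//.
by rewrite expr2 ler_piMl ?invr_ge0 ?(ltW s0)// invf_le1.
Qed.

(** The witnesses for different [e] coincide, being the conditional moments, so both errors are 0.
    For the variance, [e' <= 1] makes the bound linear in [e']. *)
Lemma close_eq {d} {T : measurableType d} (P : probability T R) (A : set T)
    (X : T -> R) (c1 c2 : R) : 0 <= c2 ->
  (forall e, 0 < e -> close P A X c1 c2 e) ->
  cond_mean P A X = c1%:E /\ cond_var P A X = (c2 - c1 ^+ 2)%:E.
Proof.
move=> c20 h.
have [m [v [mE vE _ _]]] := h 1 ltr01.
have c0 : 0 < c2 + 1 + 2 * `|c1| + 2.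
  by rewrite ltr_wpDl// addr_ge0// ?mulr_ge0// addr_ge0.
split.
  rewrite mE; congr EFin; apply/eqP; rewrite -subr_eq0 -normr_le0.
  apply/ler_addgt0Pl => e e0; rewrite addr0.
  have [m' [v' [mE' _ hm _]]] := h e e0.
  by move: mE'; rewrite mE => -[->].
rewrite vE; congr EFin; apply/eqP; rewrite -subr_eq0 -normr_le0.
apply/ler_addgt0Pl => e e0; rewrite addr0.
pose e' := Num.min 1 (e / (c2 + 1 + 2 * `|c1| + 2)).
have e'0 : 0 < e' by rewrite lt_min ltr01 divr_gt0.
have [m' [v' [_ vE' _ hv]]] := h e' e'0.
have e'1 : e' <= 1 by rewrite ge_min lexx.
have e'e : e' * (c2 + 1 + 2 * `|c1| + 2) <= e by rewrite -ler_pdivlMr// ge_min lexx orbT.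
move: vE'; rewrite vE => -[->]; apply: le_trans hv _; apply: le_trans e'e.
rewrite [leRHS]mulrDr lerD2l mulrC ler_wpM2r//.
by rewrite expr2 ler_piMl// ltW.
Qed.

End closeness.

Section frozen_facts.
Context {d : measure_display} {T : measurableType d} {R : realType}.

Lemma frozen_msq_ge0 (Q : {finite_measure set T -> \bar R}) (u0 : T -> R)
    (W : R -> T -> R) m0 v0 gam sig b : 0 <= v0 -> 0 < b ->
  noise_input Q u0 W m0 v0 b -> 0 <= frozen_msq m0 v0 gam sig b.
Proof.
move=> v00 b0 N; rewrite -(E_frozen_sqr gam sig v00 b0 N).
by apply: Rintegral_ge0 => w _; exact: sqr_ge0.
Qed.

End frozen_facts.

(** * The conditional moments of dMSM *)

Section constant_mode.
Context {d : measure_display} {T : measurableType d} {R : realType}.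
Variables (P : probability T R) (gam rho : bool -> R) (sigu m0 v0 b : R).
Variables (u : R -> {RV P >-> R}) (g : {RV P >-> R}) (W : R -> {RV P >-> R}).
Hypotheses (v00 : 0 <= v0) (b0 : 0 < b).
Hypothesis mod : is_dMSM gam rho sigu u g W.
Hypothesis lu : has_law P (u 0) (gaussian_law m0 v0).

Lemma dMSM_moments s : (0 < P (starts_at gam g s))%E ->
  0 <= frozen_msq m0 v0 (gam s) sigu b /\
  (cond_mean P (starts_at gam g s) (u b) = (frozen_mean m0 v0 (gam s) sigu b)%:E /\
   cond_var P (starts_at gam g s) (u b) =
     (frozen_msq m0 v0 (gam s) sigu b - frozen_mean m0 v0 (gam s) sigu b ^+ 2)%:E).
Proof.
case: mod => BW _ ind sde A0.
pose A := starts_at gam g s.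
have AE : A = g @^-1` [set gam s] by [].
have mA : measurable A.
  by rewrite AE -[X in measurable X]setTI; exact: measurable_funP.
have [W' [mW' cW' WW']] := brownian_clean BW (ltW b0).
have hI E0 E2 : g_sigma_algebra_preimage (u 0) E0 -> process_sigma W E2 ->
    P (E0 `&` A `&` E2) = (P E0 * P A * P E2)%E.
  move=> h0 h2; apply: (indep_systems3 ind) => //.
  by rewrite AE; exact: g_sigma_preimageS.
have N := noise_inputI BW (ltW b0) mW' cW' WW' mA A0 v00 lu hI.
have c20 := frozen_msq_ge0 (gam s) sigu v00 b0 N.
split => //; apply: close_eq => // e e0.
rewrite -(E_frozen (gam s) sigu v00 b0 N) -(E_frozen_sqr (gam s) sigu v00 b0 N).
apply: (cond_close (Bd := fun=> 0)) => //.
- exact: frozen_sqint N.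
- apply: filterS2 sde WW' => w [cu hu] h Aw.
  have dp := damped_clip (g := fun=> g w) (G := fun=> gam s) (W' := W' ^~ w)
    (ltW b0) hu h (fun _ _ => esym Aw).
  have := damped_const b0 (continuous_clip_comp (f := u ^~ w) (ltW b0) cu) (cW' w) dp.
  rewrite !clip_id ?lexx ?(ltW b0)// => ->.
  by rewrite -[frozen _ _ _ _ _ _]/(frozen_path (gam s) sigu b (u 0 w) (W' ^~ w)) subrr expr0n.
- split; first exact: rint_cst.
  by rewrite Rintegral_cst// mul0r sqr_ge0.
Qed.

End constant_mode.

(** * The error estimate for dDSM *)

Section diffusive_mode.
Context {d : measure_display} {T : measurableType d} {R : realType}.
Variables (P : probability T R) (nu mu sig rho gam : bool -> R) (sigu eps m0 v0 b : R).
Variables (u g : R -> {RV P >-> R}) (M : {RV P >-> bool}) (W B : R -> {RV P >-> R}).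
Hypotheses (v00 : 0 <= v0) (b0 : 0 < b) (e1 : 1 <= eps) (nu0 : forall s, 0 < nu s).
Hypothesis mod : is_dDSM nu mu sig rho sigu eps u g M W B.
Hypothesis lu : has_law P (u 0) (gaussian_law m0 v0).

(** The constant [C1] of [damped_perturbed]: the bound of [damped_OU] with [a <= kap * nu s] and
    [|c| = kap * |sig s|], where [kap = 1 / sqrt eps]. *)
Definition dDSM_slope (s : bool) : R :=
  nu s * b * `|gam s - mu s| + `|sig s| * (1 + nu s).

(** The factor of [kap ^ 2] in [damped_perturbed], with expectations bounded term by term: [256]
    comes from [x^4 <= 256 exp |x|], the factors 1 are the total mass of the conditional
    probability. *)
Definition dDSM_rate (s : bool) : R :=
  let C1 := dDSM_slope s in let c0 := `|gam s| + C1 in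
  let G q := 1 * gaussian_exp_bound 0 b q * b in
  4 * expR (`|gam s| * b) ^+ 2 *
    (8 * (256 * (1 * gaussian_exp_bound m0 v0 1) + sigu ^+ 4 *
      (b ^+ 3 * (G 16 + (b * expR (16 * c0) + G (16 * C1) + G (16 * C1 * b))))) +
     (expR (16 * c0 * b) + b^-1 * G (16 * (C1 * (1 + b)) * b))).

(** On the conditioning event the mode is fixed, so the damping is an Ornstein-Uhlenbeck path
    started at [gam s], and its noise keeps its Gaussian marginals by independence. The [+ 1] under
    the root keeps the error radius positive. *)
Lemma dDSM_close s : (0 < P (starts_at_mode gam (g 0%R) M s))%E ->
  close P (starts_at_mode gam (g 0%R) M s) (u b)
    (frozen_mean m0 v0 (gam s) sigu b) (frozen_msq m0 v0 (gam s) sigu b)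
    (Num.sqrt (dDSM_rate s + 1) / Num.sqrt eps).
Proof.
case: mod => [[BW BB] _ ind sdeg sde] A0.
set A := starts_at_mode gam (g 0) M s in A0 *.
pose G := preimage_set_system [set: T] (g 0) measurable `|`
  preimage_set_system [set: T] M measurable.
have GA : g_sigma_preimageU (g 0) M A.
  rewrite (_ : A = (g 0 @^-1` [set gam s]) `&` (M @^-1` [set s])); last first.
    by apply/seteqP; split.
  have m1 : measurable ((g 0 @^-1` [set gam s]) : set (g_sigma_algebraType G)).
    by apply: sub_sigma_algebra; left; exists [set gam s] => //; rewrite setTI.
  have m2 : measurable ((M @^-1` [set s]) : set (g_sigma_algebraType G)).
    by apply: sub_sigma_algebra; right; exists [set s] => //; rewrite setTI.
  exact: (measurableI _ _ m1 m2).
have mA : measurable A.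
  rewrite (_ : A = (g 0 @^-1` [set gam s]) `&` (M @^-1` [set s])); last first.
    by apply/seteqP; split.
  by apply: measurableI; rewrite -[X in measurable X]setTI; exact: measurable_funP.
have [W' [mW' cW' WW']] := brownian_clean BW (ltW b0).
have [B' [mB' cB' BB']] := brownian_clean BB (ltW b0).
have hI E0 E2 : g_sigma_algebra_preimage (u 0) E0 -> process_sigma W E2 ->
    P (E0 `&` A `&` E2) = (P E0 * P A * P E2)%E.
  move=> h0 h2; have := indep_systems4 ind h0 GA h2 (@process_sigmaT _ _ _ P B).
  by rewrite setIT probability_setT mule1.
have N := noise_inputI BW (ltW b0) mW' cW' WW' mA A0 v00 lu hI.
have LB t : 0 <= t <= b -> has_mlaw (condp P mA) (B' t) 1 (gaussian_law 0 t).
  move=> tb; apply: mlaw_condp => // S mS.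
  apply: (mlaw_W BB (ltW b0) mB' BB') => // E2 h2.
  have := indep_systems4 ind (g_sigma_preimageT (u 0)) GA (@process_sigmaT _ _ _ P W) h2.
  by rewrite setTI setIT probability_setT mul1e mule1.
have s0 : 0 < Num.sqrt eps by rewrite sqrtr_gt0 (lt_le_trans _ e1).
have s1 : 1 <= Num.sqrt eps by rewrite -[leLHS]sqrtr1 ler_sqrt// (le_trans _ e1).
pose kap := (Num.sqrt eps)^-1.
have kap01 : 0 <= kap <= 1 by rewrite invr_ge0 (ltW s0) invf_le1.
have /andP[kap0 kap1] := kap01.
have epsV : eps^-1 = kap ^+ 2 by rewrite /kap exprVn sqr_sqrtr// (le_trans _ e1).
pose C1 := dDSM_slope s; pose c0 := `|gam s| + C1.
have C10 : 0 <= C1.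
  by rewrite addr_ge0// mulr_ge0// ?mulr_ge0 ?addr_ge0 ?(ltW b0) ?(ltW (nu0 s)).
pose Z w := 4 * expR (`|gam s| * b) ^+ 2 *
    (8 * (256 * expR `|u 0 w| + sigu ^+ 4 *
      (b ^+ 3 * (expint b 16 (W' ^~ w) + (b * expR (16 * c0) +
        expint b (16 * C1) (B' ^~ w) + expint b (16 * C1 * b) (B' ^~ w))))) +
     (expR (16 * c0 * b) + b^-1 * expint b (16 * (C1 * (1 + b)) * b) (B' ^~ w))).
have mu0 : measurable_fun setT (u 0) by exact: measurable_funP.
have bZ : bint (condp P mA) Z (dDSM_rate s).
  have bW q := bint_expint q b0 ler01 mW' cW' (noise_law_W N).
  have bB q := bint_expint q b0 ler01 mB' cB' LB.
  have bc (r : R) : bint (condp P mA) (fun=> r) r.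
    by split; [exact: rint_cst|rewrite E_cst].
  have bu := bint_exp v00 ler01 mu0 (noise_law_u0 N).
  have b00 := ltW b0.
  apply: bintZ; first by rewrite mulr_ge0// sqr_ge0.
  apply: bintD; last by apply: bintD => //; apply: bintZ => //; rewrite invr_ge0.
  apply: bintZ => //; apply: bintD; first exact: bintZ.
  apply: bintZ; first by rewrite exprn_even_ge0.
  apply: bintZ; first by rewrite exprn_ge0.
  apply: bintD; first exact: bW.
  by apply: bintD; first apply: bintD.
have Z0 w : 0 <= Z w.
  have b00 := ltW b0.
  rewrite /Z; apply: mulr_ge0; first by rewrite mulr_ge0// sqr_ge0.
  apply: addr_ge0; last first.
    by rewrite addr_ge0 ?expR_ge0// mulr_ge0 ?invr_ge0 ?expint_ge0.
  apply: mulr_ge0 => //; apply: addr_ge0; first by rewrite mulr_ge0 ?expR_ge0.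
  apply: mulr_ge0; first by rewrite exprn_even_ge0.
  apply: mulr_ge0; first by rewrite exprn_ge0.
  apply: addr_ge0; first exact: expint_ge0.
  apply: addr_ge0; last exact: expint_ge0.
  apply: addr_ge0; last exact: expint_ge0.
  by rewrite mulr_ge0 ?expR_ge0.
have r0 : 0 <= dDSM_rate s.
  have [_] := bZ; apply: le_trans; apply: Rintegral_ge0 => w _; exact: Z0.
rewrite -(E_frozen (gam s) sigu v00 b0 N) -(E_frozen_sqr (gam s) sigu v00 b0 N).
apply: (cond_close (Bd := fun w => kap ^+ 2 * Z w)) => //.
- exact: frozen_sqint N.
- by move=> w; rewrite mulr_ge0 ?sqr_ge0.
- apply: filterS2 (filterI sde sdeg) (filterI WW' BB') => w [[cu hu] [cg hg]] [hW hB] [gw Mw].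
  rewrite Mw in hg.
  have cuc := continuous_clip_comp (f := u ^~ w) (ltW b0) cu.
  have cgc := continuous_clip_comp (f := g ^~ w) (ltW b0) cg.
  pose a := nu s / eps; pose c := sig s / Num.sqrt eps.
  (* Centering at [mu s] makes the equation of the damping linear. *)
  have dx : damped (fun=> a) c b (B' ^~ w) (fun t => g (clip b t) w - mu s).
    apply: (damped_clip (g := fun=> a) (W := B ^~ w) (u := fun t => g t w - mu s)
      (ltW b0) _ hB) => // t t0.
    have [it gt] := hg t t0; split => //.
    by rewrite [X in X - _ = _]gt -/a -/c addrAC [X in X + _ = _]addrAC.
  have a0 : 0 <= a by rewrite divr_ge0 ?(ltW (nu0 s))// (le_trans _ e1).
  have cx : continuous (fun t => g (clip b t) w - mu s).
    by apply: continuousB_fun => //; exact: cst_continuous.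
  have x0E : g (clip b 0) w - mu s = gam s - mu s.
    by rewrite clip_id ?lexx ?(ltW b0)// gw.
  have OU := damped_OU b0 a0 cx (cB' w) dx x0E.
  have du := damped_clip (g := fun t => g t w) (G := fun t => g (clip b t) w)
    (W' := W' ^~ w) (ltW b0) hu hW (fun t tb => congr1 (fun r => g r w) (clip_id tb)).
  have dev t : 0 <= t <= b -> `|g (clip b t) w - gam s| <=
      kap * (C1 * (1 + `|B' t w| + \int[lebesgue_measure]_(r in `[0, b]) `|B' r w|)).
    move=> tb; have := OU t tb.
    rewrite (_ : _ - mu s - _ = g (clip b t) w - gam s); last by ring.
    set I := \int[_]_(_ in _) _; set x := `|B' t w|.
    have I0 : 0 <= I by apply: Rintegral_ge0.
    have x0 : 0 <= x by exact: normr_ge0.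
    have nus := ltW (nu0 s); have b00 := ltW b0.
    move=> h; apply: le_trans h _.
    have cE : `|c| = kap * `|sig s| by rewrite /c normrM mulrC (ger0_norm (_ : 0 <= kap)).
    have aE : a = kap ^+ 2 * nu s by rewrite /a epsV mulrC.
    have ak : a <= kap * nu s by rewrite aE expr2 ler_wpM2r// ler_piMl.
    have an : a <= nu s by apply: le_trans ak _; rewrite ler_piMl.
    apply: (@le_trans _ _ (kap * (nu s * b * `|gam s - mu s|) +
        kap * (`|sig s| * (1 + nu s)) * (x + I))).
      apply: lerD; first by rewrite !mulrA ler_wpM2r// ler_wpM2r.
      rewrite cE -[leLHS]mulrA -[leRHS]mulrA ler_wpM2l// -[leRHS]mulrA ler_wpM2l//.
      have := ler_wpM2r I0 an; have := mulr_ge0 nus x0; have := mulr_ge0 nus I0.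
      by lra.
    rewrite -[X in _ + X <= _]mulrA -mulrDr ler_wpM2l// /C1 /dDSM_slope.
    have : 0 <= nu s * b * `|gam s - mu s| by rewrite !mulr_ge0.
    have : 0 <= `|sig s| * (1 + nu s) by rewrite mulr_ge0// addr_ge0.
    move: (nu s * b * _) (`|sig s| * _) => p q q0 p0.
    have := mulr_ge0 p0 x0; have := mulr_ge0 p0 I0.
    by lra.
  have := damped_perturbed b0 cuc (cW' w) cgc (cB' w) kap01 C10 dev du (erefl c0).
  rewrite !clip_id ?lexx ?(ltW b0)//.
  rewrite -[frozen _ _ _ _ _ _]/(frozen_path (gam s) sigu b (u 0 w) (W' ^~ w)).
  rewrite (real_normK (num_real _)) => h; apply: le_trans h _.
  rewrite ler_wpM2l ?sqr_ge0// ler_wpM2l ?mulr_ge0 ?sqr_ge0// lerD2r.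
  by rewrite ler_wpM2l// lerD2r exp4_le_exp.
- by rewrite divr_gt0// sqrtr_gt0 ltr_wpDl.
- have [iZ leZ] := bintZ (sqr_ge0 kap) bZ; split => //.
  apply: le_trans leZ _.
  rewrite exprMn sqr_sqrtr; last by rewrite addr_ge0.
  by rewrite mulrC -/kap ler_wpM2r ?sqr_ge0// lerDl.
Qed.

End diffusive_mode.

(** * The probability that the chain jumps before time [b] *)

Section no_jump.
Context {d : measure_display} {T : measurableType d} {R : realType}.
Variables (P : probability T R) (gam q : bool -> R) (g : R -> {RV P >-> R}).
Variables (b : R) (b0 : 0 < b) (s : bool).
Hypothesis chain : markov_chain gam q g.

Let mesh k : R := b * 2^-1 ^+ k.
Let mesh0 k : 0 < mesh k. Proof. by rewrite mulr_gt0// exprn_gt0. Qed.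
Let mesh_b k : (2 ^ k)%:R * mesh k = b.
Proof. by rewrite /mesh natrX mulrCA -exprMn mulfV// expr1n mulr1. Qed.
Let mesh_cvg : mesh k @[k --> \oo] --> 0.
Proof.
rewrite -(mulr0 b); apply: cvgM; first exact: cvg_cst.
by apply: cvg_expr; rewrite ger0_norm ?invf_lt1 ?ltr1n.
Qed.

Let stay k m : set T := [set w | forall i, (i <= m)%N -> g (i%:R * mesh k) w = gam s].

(* Restricting to dyadic times keeps the event in the sigma-algebra of [g]; almost
   surely it is the event of no jump on [[0, b]], by right continuity. *)
Definition no_jump : set T :=
  [set w | forall k i, (i <= 2 ^ k)%N -> g (i%:R * mesh k) w = gam s].

Let stayE k m : stay k m = \bigcap_i
  (if (i <= m)%N then g (i%:R * mesh k) @^-1` [set gam s] else setT).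
Proof.
apply/seteqP; split => w /= h i; first by move=> _; case: ifPn => // im; exact: h.
by move=> im; have := h i I; rewrite im.
Qed.

Let no_jumpE : no_jump = \bigcap_k stay k (2 ^ k).
Proof.
by apply/seteqP; split => w /= h; [move=> k _; exact: h|move=> k; exact: (h k I)].
Qed.

Lemma process_sigma_no_jump : process_sigma g no_jump.
Proof.
pose G := \bigcup_(t in [set t : R | 0 <= t]) g_sigma_algebra_preimage (g t).
have : measurable (no_jump : set (g_sigma_algebraType G)).
  rewrite no_jumpE; apply: bigcapT_measurable => k.
  rewrite stayE; apply: bigcapT_measurable => i; case: ifPn => // _.
  by apply: process_sigma_preimage => //; rewrite mulr_ge0// ltW.
by [].
Qed.

Let mstay k m : measurable (stay k m).
Proof.
by rewrite stayE; apply: bigcapT_measurable => i; case: ifPn.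
Qed.

Let A := starts_at gam (g 0) s.

Let stay0 k : stay k 0 = A.
Proof.
apply/seteqP; split => w; first by move=> /(_ 0 (leqnn 0)); rewrite mul0r.
by move=> Aw i; rewrite leqn0 => /eqP ->; rewrite mul0r.
Qed.

(** On the grid of mesh [b / 2^k], the Markov property gives [P A * p^(2^k)] for staying put, with
    [p] the one-step probability of staying. Bernoulli's inequality bounds the complement by
    [2^k (1 - p)], that is [b (1 - p) / mesh], which tends to [b * q s]; continuity from below then
    passes to all dyadic times. *)
Lemma P_jump_le : (P (A `\` no_jump) <= P A * (b * q s)%:E)%E.
Proof.
have [_ [p [[p0 p1 _ _] jr mk]]] := chain.
have mA : measurable A by rewrite -(stay0 0); exact: mstay.
have PstayE k m : P (stay k m) = (P A * (p (mesh k) s s ^+ m)%:E)%E.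
  elim: m => [|m IH]; first by rewrite stay0 expr0 mule1.
  have := mk m (fun i => i%:R * mesh k) (fun=> s).
  rewrite mul0r lexx => /(_ isT) h.
  rewrite [LHS]h; last by move=> i; rewrite ltr_pM2r ?ltr_nat.
  rewrite -[X in (X * _)%E]/(P (stay k m)) IH -muleA -EFinM exprSr.
  congr (_ * (_ * p _ _ _)%:E)%E; rewrite -natr1; ring.
have PA_fin : P A \is a fin_num by exact: fin_num_measure.
have a0 : 0 <= fine (P A) by exact: fine_ge0.
have bound k : (P (A `\` stay k (2 ^ k)) <=
    (fine (P A) * (b * (p (mesh k) s (~~ s) / mesh k)))%:E)%E.
  have sub : stay k (2 ^ k) `<=` A.
    by rewrite -(stay0 k) => w h i; rewrite leqn0 => /eqP ->; exact: h.
  have DE : P (A `\` stay k (2 ^ k)) = (P A - P (stay k (2 ^ k)))%E.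
    have PAy : (P A < +oo)%E by rewrite ltey_eq PA_fin.
    by rewrite (measureD mA (mstay k (2 ^ k)) PAy) (setIidr sub).
  rewrite DE PstayE.
  rewrite -{1 2}(fineK PA_fin) -EFinM -EFinB lee_fin.
  have pk : p (mesh k) s s + p (mesh k) s (~~ s) = 1.
    rewrite -(p1 (mesh k) s (ltW (mesh0 k))) big_bool.
    by case: (s) => //=; rewrite addrC.
  have [pss pns] := (p0 (mesh k) s s (ltW (mesh0 k)), p0 (mesh k) s (~~ s) (ltW (mesh0 k))).
  rewrite -[X in X - _]mulr1 -mulrBr ler_wpM2l//.
  have bern n : 1 - p (mesh k) s s ^+ n <= n%:R * p (mesh k) s (~~ s).
    have px : p (mesh k) s s = 1 - p (mesh k) s (~~ s) by rewrite -pk addrK.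
    have p1' : p (mesh k) s s <= 1 by rewrite px lerBlDr lerDl.
    elim: n => [|n IH]; first by rewrite expr0 subrr mul0r.
    have xn : p (mesh k) s s ^+ n <= 1 by rewrite exprn_ile1.
    rewrite exprS -natr1 mulrDl mul1r.
    apply: le_trans (lerD IH (lexx _)).
    have : p (mesh k) s (~~ s) * p (mesh k) s s ^+ n <= p (mesh k) s (~~ s).
      by rewrite ler_piMr.
    by rewrite px; move: (_ ^+ n) => x; lra.
  apply: le_trans (bern _) _.
  rewrite -[X in _ <= X * _](mesh_b k) le_eqVlt; apply/orP; left; apply/eqP.
  by field; rewrite gt_eqF.
(* The grids are nested: point [i] of level [k] is point [2 * i] of level [k + 1]. *)
have mono : {homo (fun k => A `\` stay k (2 ^ k)) : n m / (n <= m)%N >-> (n <= m)%O}.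
  apply/nondecreasing_seqP => k; rewrite subsetEset => w [Aw h]; split => // h'.
  apply: h => i ik; have := h' (2 * i)%N.
  rewrite expnS leq_mul2l ik => /(_ isT).
  rewrite natrM /mesh exprS (_ : 2 * i%:R * (b * (2^-1 * 2^-1 ^+ k)) = i%:R * (b * 2^-1 ^+ k))//.
  by field.
have cupE : \bigcup_k (A `\` stay k (2 ^ k)) = A `\` no_jump.
  by rewrite no_jumpE setDE setC_bigcap setI_bigcupr.
have mD k : measurable (A `\` stay k (2 ^ k)) by exact: measurableD.
have cv1 := nondecreasing_cvg_mu (mu := P) mD (bigcupT_measurable _ mD) mono.
rewrite cupE in cv1.
have cv2 : (fine (P A) * (b * (p (mesh k) s (~~ s) / mesh k)))%:E @[k --> \oo] -->
    (fine (P A) * (b * q s))%:E.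
  apply: cvg_EFin; first by apply: nearW.
  apply: cvgM; first exact: cvg_cst.
  apply: cvgM; first exact: cvg_cst.
  by have /cvg_at_rightP := jr s; apply.
rewrite -[X in (_ <= X * _)%E](fineK PA_fin) -EFinM.
rewrite -(cvg_lim _ cv1)// -(cvg_lim _ cv2)//.
apply: lee_lim; [by apply: cvgP cv1|by apply: cvgP cv2|].
by apply: nearW => k; exact: bound.
Qed.

(** A time [t < b] is a limit of grid points strictly to its right, so right continuity determines
    [g t]. The endpoint [b] is a grid point itself. *)
Lemma no_jump_const : {ae P, forall w, no_jump w -> forall t, 0 <= t <= b -> g t w = gam s}.
Proof.
have [rc _] := chain.
apply: filterS rc => w h Nw t /andP[t0 tb].
move: tb; rewrite le_eqVlt => /orP[/eqP ->|tb].
  by have := Nw 0 1 isT; rewrite /mesh expr0 mulr1 mul1r.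
have [_ cv] := h t t0.
pose n k := Num.truncn (t / mesh k).
(* The successor makes [r k > t] strict, as the right limit requires; [t < b] keeps the index at
   most [2 ^ k]. *)
pose r k := (n k).+1%:R * mesh k.
have tn k : (n k)%:R <= t / mesh k < (n k).+1%:R.
  by apply: truncn_itv; rewrite divr_ge0// ltW.
have rt k : t < r k by have /andP[_] := tn k; rewrite ltr_pdivrMr.
have rt' k : r k <= t + mesh k.
  have /andP[h1 _] := tn k; rewrite ler_pdivlMr// in h1.
  by rewrite /r -natr1 mulrDl mul1r lerD2r.
have rcv : r k @[k --> \oo] --> t.
  apply: (@squeeze_cvgr _ _ _ _ (fun=> t) (fun k => t + mesh k)).
  - by apply: nearW => k; rewrite (ltW (rt k)) rt'.
  - exact: cvg_cst.
  - by rewrite -[X in _ --> X]addr0; apply: cvgD; [exact: cvg_cst|exact: mesh_cvg].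
have gr k : g (r k) w = gam s.
  apply: Nw; rewrite -(ltr_nat R); apply: (@le_lt_trans _ _ (t / mesh k)).
    by have /andP[] := tn k.
  by rewrite ltr_pdivrMr// mesh_b.
have /cvg_at_rightP/(_ r) := cv => /(_ (conj rt rcv)).
have -> : (fun k => g (r k) w) = fun=> gam s by apply/funext.
by move=> /(cvg_lim (@Rhausdorff R)) <-; exact: lim_cst.
Qed.

End no_jump.

(** * The error estimate for SSM *)

Section switching.
Context {d : measure_display} {T : measurableType d} {R : realType}.
Variables (P : probability T R) (gam lam : bool -> R) (sigu eps m0 v0 b : R).
Variables (u g : R -> {RV P >-> R}) (W : R -> {RV P >-> R}).
Hypotheses (v00 : 0 <= v0) (b0 : 0 < b) (e1 : 1 <= eps) (lam0 : forall s, 0 < lam s).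
Hypothesis mod : is_SSM gam lam sigu eps u g W.
Hypothesis lu : has_law P (u 0) (gaussian_law m0 v0).

Let C := `|gam true| + `|gam false|.

(** The expectation bound for the square of [damped_crude]: [32 = 2^2 * 2 * 4], from its factor 2,
    from [(x + y)^2 <= 2 (x^2 + y^2)], and from [x^2 <= 4 exp |x|]. *)
Definition SSM_jump_bound : R :=
  32 * expR (C * b) ^+ 2 * (gaussian_exp_bound m0 v0 1 +
    (`|sigu| * C) ^+ 2 * (b * (gaussian_exp_bound 0 b 1 * b))).

(** The factor [b * lam s] is [eps] times the bound on the conditional jump probability. *)
Definition SSM_rate (s : bool) : R := b * lam s * SSM_jump_bound.

Lemma SSM_close s : (0 < P (starts_at gam (g 0%R) s))%E ->
  close P (starts_at gam (g 0%R) s) (u b)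
    (frozen_mean m0 v0 (gam s) sigu b) (frozen_msq m0 v0 (gam s) sigu b)
    (Num.sqrt (SSM_rate s + 1) / Num.sqrt eps).
Proof.
case: mod => BW chain ind sde A0.
set A := starts_at gam (g 0) s in A0 *.
have AE : A = g 0 @^-1` [set gam s] by [].
have gA : process_sigma g A by rewrite AE; exact: process_sigma_preimage.
have mA : measurable A by exact: process_sigma_measurable gA.
pose G := \bigcup_(t in [set t : R | 0 <= t]) g_sigma_algebra_preimage (g t).
pose Nc := ~` no_jump gam g b s.
pose E := Nc `&` A.
have gNc : process_sigma g Nc.
  have h : process_sigma g (no_jump gam g b s) by exact: process_sigma_no_jump.
  have hm : measurable (no_jump gam g b s : set (g_sigma_algebraType G)) by exact: h.
  exact: measurableC hm.
have gE : process_sigma g E.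
  exact: (@measurableI _ (g_sigma_algebraType G) _ _ gNc gA).
have mNc : measurable Nc by exact: process_sigma_measurable gNc.
have mE : measurable E by exact: process_sigma_measurable gE.
have [W' [mW' cW' WW']] := brownian_clean BW (ltW b0).
have hI E0 E2 : g_sigma_algebra_preimage (u 0) E0 -> process_sigma W E2 ->
    P (E0 `&` A `&` E2) = (P E0 * P A * P E2)%E.
  by move=> h0 h2; apply: (indep_systems3 ind).
have N := noise_inputI BW (ltW b0) mW' cW' WW' mA A0 v00 lu hI.
pose Q := condp P mA.
have QE (S : set T) : Q S = (P (S `&` A) * ((fine (P A))^-1)%:E)%E by exact: condpE.
have QNc_fin : Q Nc \is a fin_num by exact: fin_num_measure.
pose p := fine (Q Nc).
have p0 : 0 <= p by apply: fine_ge0; exact: measure_ge0.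
have QNcE : Q Nc = p%:E by rewrite fineK.
(* Restricting to the jump event, of conditional probability [p], multiplies the laws of [u 0] and
   [W' t] by [p], by independence. Integrating the crude bound against [Q'] thus produces the factor
   [p] directly. *)
pose Q' := mrestr (condp P mA) mNc.
have LW t : 0 <= t <= b -> has_mlaw Q' (W' t) p (gaussian_law 0 t).
  move=> tb S mS; rewrite /Q' /mrestr -/Q QE -setIA -/E.
  rewrite (mlaw_W BW (ltW b0) mW' WW' mE _ tb mS); last first.
    move=> E2 h2; have := indep_systems3 ind (g_sigma_preimageT (u 0)) gE h2.
    by rewrite setTI probability_setT mul1e.
  by rewrite -muleA -[X in (_ * X)%E](QE Nc) QNcE muleC.
have Lu : has_mlaw Q' (u 0) p (gaussian_law m0 v0).
  move=> S mS; rewrite /Q' /mrestr -/Q QE -setIA -/E.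
  have := indep_systems3 ind (g_sigma_preimageS (u 0) mS) gE (@process_sigmaT _ _ _ P W).
  rewrite setIT probability_setT mule1 => ->.
  by rewrite lu// -muleA -[X in (_ * X)%E](QE Nc) QNcE muleC.
have mu0 : measurable_fun setT (u 0) by exact: measurable_funP.
have b00 := ltW b0.
have C0 : 0 <= C by rewrite addr_ge0.
pose Z w := 32 * expR (C * b) ^+ 2 * (expR `|u 0 w| +
  (`|sigu| * C) ^+ 2 * (b * expint b 1 (W' ^~ w))).
have K0 : 0 <= 32 * expR (C * b) ^+ 2 by rewrite mulr_ge0// sqr_ge0.
have Z0 w : 0 <= Z w.
  apply: mulr_ge0 => //; apply: addr_ge0; first exact: expR_ge0.
  by rewrite mulr_ge0 ?sqr_ge0// mulr_ge0 ?expint_ge0.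
have bZ' : bint Q' Z (p * SSM_jump_bound).
  have bW := bint_expint (Q := Q') 1 b0 p0 mW' cW' LW.
  have bu := bint_exp (Q := Q') v00 p0 mu0 Lu.
  have [iZ leZ] := bintZ K0 (bintD bu (bintZ (sqr_ge0 (`|sigu| * C)) (bintZ b00 bW))).
  split; first exact: iZ.
  apply: le_trans leZ _; rewrite /SSM_jump_bound le_eqVlt; apply/orP; left; apply/eqP.
  by move: (gaussian_exp_bound _ _ _) (gaussian_exp_bound _ _ _) (expR _) => x y z; ring.
have mZ : measurable_fun setT Z by exact: rint_measurable bZ'.1.
have s0 : 0 < Num.sqrt eps by rewrite sqrtr_gt0 (lt_le_trans _ e1).
have eps0 : 0 < eps by exact: lt_le_trans e1.
have J0 : 0 <= SSM_jump_bound.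
  apply: mulr_ge0 => //; apply: addr_ge0; first exact: gaussian_exp_bound_ge0.
  rewrite mulr_ge0 ?sqr_ge0// mulr_ge0// mulr_ge0//; exact: gaussian_exp_bound_ge0.
have ple : p <= b * (lam s / eps).
  have PA_fin : P A \is a fin_num by exact: fin_num_measure.
  have a0 : 0 < fine (P A) by rewrite fine_gt0// A0 ltey_eq PA_fin.
  rewrite -lee_fin -QNcE QE (_ : Nc `&` A = A `\` no_jump gam g b s); last first.
    by rewrite setDE setIC.
  apply: (@le_trans _ _ (P A * (b * (lam s / eps))%:E * ((fine (P A))^-1)%:E)%E).
    by rewrite lee_wpmul2r ?lee_fin ?invr_ge0 ?(ltW a0)//; exact: (P_jump_le b0 s chain).
  rewrite -{1}(fineK PA_fin) -!EFinM lee_fin le_eqVlt; apply/orP; left; apply/eqP.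
  by field; rewrite !gt_eqF.
have r0 : 0 <= SSM_rate s by rewrite mulr_ge0// mulr_ge0 ?(ltW (lam0 s)).
rewrite -(E_frozen (gam s) sigu v00 b0 N) -(E_frozen_sqr (gam s) sigu v00 b0 N).
apply: (cond_close (Bd := fun w => \1_Nc w * Z w)) => //.
- exact: frozen_sqint N.
- by move=> w; rewrite mulr_ge0.
- have nj := no_jump_const b0 s chain; have [st _] := chain.
  apply: filterS2 (filterI sde WW') (filterI nj st) => w [[cu hu] hW] [njw stw] Aw.
  have cuc := continuous_clip_comp (f := u ^~ w) (ltW b0) cu.
  rewrite -[frozen _ _ _ _ _ _]/(frozen_path (gam s) sigu b (u 0 w) (W' ^~ w)).
  (* Without a jump the damping is constant and the error is exactly 0; with one, the crude bound
     applies. *)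
  have [/njw gw|njw'] := pselect (no_jump gam g b s w).
    have du := damped_clip (g := fun t => g t w) (G := fun=> gam s)
      (W' := W' ^~ w) (ltW b0) hu hW (fun t tb => esym (gw t tb)).
    have := damped_const b0 cuc (cW' w) du.
    by rewrite !clip_id ?lexx ?(ltW b0)// => ->; rewrite subrr expr0n mulr_ge0.
  have du := damped_clip (g := fun t => g t w) (G := fun t => g t w)
    (W' := W' ^~ w) (ltW b0) hu hW (fun _ _ => erefl).
  have gsC r : `|gam r| <= C by case: r; rewrite /C ?lerDl ?lerDr.
  have gC t : 0 <= t <= b -> `|g t w| <= C.
    by move=> /andP[t0 _]; have [[r ->] _] := stw t t0.
  have := damped_crude b0 cuc (cW' w) (gsC s) gC du.
  rewrite !clip_id ?lexx ?(ltW b0)// => h.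
  rewrite indicE mem_set ?mul1r// -(real_normK (num_real _)).
  have I2 := sqr_int_le_expint b00 (cW' w).
  set I := \int[_]_(_ in _) _ in h I2.
  have I0 : 0 <= I by apply: Rintegral_ge0.
  have sC0 : 0 <= `|sigu| * C by rewrite mulr_ge0.
  apply: (@le_trans _ _ ((2 * expR (C * b) * (`|u 0 w| + `|sigu| * C * I)) ^+ 2)).
    by rewrite lerXn2r ?nnegrE// !mulr_ge0 ?expR_ge0// addr_ge0// mulr_ge0.
  have u2 := sqr_le_exp (u 0 w); rewrite -(real_normK (num_real (u 0 w))) in u2.
  have sI2 := ler_wpM2l (sqr_ge0 (`|sigu| * C)) I2.
  rewrite exprMn exprMn /Z (_ : 32 * _ * _ = 2 ^+ 2 * expR (C * b) ^+ 2 *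
    (8 * (expR `|u 0 w| + (`|sigu| * C) ^+ 2 * (b * expint b 1 (W' ^~ w))))); last by ring.
  apply: ler_wpM2l; first by rewrite mulr_ge0 ?sqr_ge0.
  move: sI2 u2; move: (`|u 0 w|) (expR _) (expint _ _ _) => x y z.
  move: (`|sigu| * C) => k h1 h2.
  have := sqr_ge0 (x - k * I); nra.
- by rewrite divr_gt0// sqrtr_gt0 ltr_wpDl.
- have mB : measurable_fun setT (fun w => \1_Nc w * Z w).
    by apply: measurable_funM => //; exact: measurable_indic.
  have : (\int[condp P mA]_w (\1_Nc w * Z w)%:E <= (p * SSM_jump_bound)%:E)%E.
    rewrite (_ : (\int[condp P mA]_w (\1_Nc w * Z w)%:E = \int[Q']_w (Z w)%:E)%E).
      by rewrite rint_EFin ?lee_fin; case: bZ'.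
    rewrite integral_mrestr; last exact/measurable_EFinP.
    rewrite [RHS]integral_mkcond; apply: eq_integral => w _.
    by rewrite patchE indicE; case: ifPn => _; rewrite ?mul1r ?mul0r.
  have B0 w : 0 <= \1_Nc w * Z w by rewrite mulr_ge0.
  move=> /(rint_of_le mB B0)[iB leB]; split => //.
  apply: le_trans leB _; rewrite exprMn exprVn !sqr_sqrtr ?addr_ge0 ?(ltW eps0)//.
  apply: (@le_trans _ _ (b * (lam s / eps) * SSM_jump_bound)).
    by rewrite ler_wpM2r.
  rewrite (_ : b * (lam s / eps) * SSM_jump_bound = SSM_rate s / eps); last first.
    by rewrite /SSM_rate; ring.
  by rewrite ler_wpM2r ?invr_ge0 ?(ltW eps0)// lerDl.
Qed.

End switching.

(** * Conclusion: the limits of the conditional moments and of the mixtures *)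

Theorem theorem3p2 (R : realType)
  (gam lam nu sig mu : bool -> R) (sigu : R)
  (hgam : gam false < 0 < gam true)
  (hlam : forall s, 0 < lam s) (hnu : forall s, 0 < nu s)
  (* common Gaussian law N(m0, v0) of the initial values of u *)
  (m0 v0 : R) (hv0 : 0 <= v0)
  (* SSM, for each eps > 0 *)
  (d : measure_display) (Om : R -> measurableType d)
  (P : forall eps : R, probability (Om eps) R)
  (u g Bu : forall eps : R, R -> {RV (P eps) >-> R})
  (law_g0 : set R -> \bar R)
  (hSSM : forall eps : R, 0 < eps ->
    is_SSM gam lam sigu eps (u eps) (g eps) (Bu eps))
  (hu0 : forall eps : R, 0 < eps -> has_law (P eps) (u eps 0) (gaussian_law m0 v0))
  (hg0 : forall eps : R, 0 < eps -> has_law (P eps) (g eps 0) law_g0)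
  (* dMSM *)
  (db : measure_display) (Omb : measurableType db) (Pb : probability Omb R)
  (rhob : bool -> R) (ub : R -> {RV Pb >-> R}) (gb : {RV Pb >-> R})
  (Bub : R -> {RV Pb >-> R})
  (hrhob : rhob false = 1 - rhob true)
  (hdMSM : is_dMSM gam rhob sigu ub gb Bub)
  (hub0 : has_law Pb (ub 0) (gaussian_law m0 v0))
  (* dDSM, for each eps > 0 *)
  (dh : measure_display) (Omh : R -> measurableType dh)
  (Ph : forall eps : R, probability (Omh eps) R)
  (rhoh : bool -> R)
  (uh gh : forall eps : R, R -> {RV (Ph eps) >-> R})
  (M : forall eps : R, {RV (Ph eps) >-> bool})
  (Buh Bgh : forall eps : R, R -> {RV (Ph eps) >-> R})
  (law_gh0 : set R -> \bar R)
  (hrhoh : rhoh false = 1 - rhoh true)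
  (hdDSM : forall eps : R, 0 < eps ->
    is_dDSM nu mu sig rhoh sigu eps
      (uh eps) (gh eps) (M eps) (Buh eps) (Bgh eps))
  (huh0 : forall eps : R, 0 < eps ->
    has_law (Ph eps) (uh eps 0) (gaussian_law m0 v0))
  (hgh0 : forall eps : R, 0 < eps -> has_law (Ph eps) (gh eps 0) law_gh0)
  (T : R) (hT : 0 < T) :
  (forall s : bool, 0 < rhob s ->
    ((0 < law_g0 [set gam s])%E ->
      cond_mean (P eps) (starts_at gam (g eps 0) s) (u eps T) @[eps --> +oo]
        --> cond_mean Pb (starts_at gam gb s) (ub T) /\
      cond_var (P eps) (starts_at gam (g eps 0) s) (u eps T) @[eps --> +oo]
        --> cond_var Pb (starts_at gam gb s) (ub T))
    /\
    ((forall eps : R, 0 < eps ->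
        (0 < Ph eps (starts_at_mode gam (gh eps 0%R) (M eps) s))%E) ->
      cond_mean (Ph eps) (starts_at_mode gam (gh eps 0) (M eps) s) (uh eps T)
        @[eps --> +oo] --> cond_mean Pb (starts_at gam gb s) (ub T) /\
      cond_var (Ph eps) (starts_at_mode gam (gh eps 0) (M eps) s) (uh eps T)
        @[eps --> +oo] --> cond_var Pb (starts_at gam gb s) (ub T)))
  /\
  ((forall eps : R, 0 < eps ->
      has_law (P eps) (g eps 0) (gamma_infty_law gam lam)) ->
   has_law Pb gb (gamma_infty_law gam lam) ->
   (forall eps : R, 0 < eps ->
      has_law (Ph eps) (gh eps 0) (gamma_infty_law gam lam)) ->
   (forall (eps : R) (s : bool), 0 < eps ->
      (0 < Ph eps (starts_at_mode gam (gh eps 0%R) (M eps) s))%E) ->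
   let mixb := gm_approx Pb (starts_at gam gb) (starts_at gam gb) (ub T) in
   let mix (eps : R) := gm_approx (P eps) (starts_at gam (g eps 0))
     (starts_at gam (g eps 0)) (u eps T) in
   let mixh (eps : R) := gm_approx (Ph eps) (starts_at gam (gh eps 0))
     (starts_at_mode gam (gh eps 0) (M eps)) (uh eps T) in
   forall s : bool,
     [/\ gm_weight (mix eps) s @[eps --> +oo] --> gm_weight mixb s,
         gm_mean (mix eps) s @[eps --> +oo] --> gm_mean mixb s
       & gm_var (mix eps) s @[eps --> +oo] --> gm_var mixb s] /\
     [/\ gm_weight (mixh eps) s @[eps --> +oo] --> gm_weight mixb s,
         gm_mean (mixh eps) s @[eps --> +oo] --> gm_mean mixb s
       & gm_var (mixh eps) s @[eps --> +oo] --> gm_var mixb s]).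
Proof.
(* Both halves of the theorem reduce to this form, where the conditioning event has positive
   probability for every [eps]. *)
have main s : 0 < rhob s ->
    ((forall eps : R, 0 < eps -> (0 < P eps (starts_at gam (g eps 0%R) s))%E) ->
      cond_mean (P eps) (starts_at gam (g eps 0) s) (u eps T) @[eps --> +oo]
        --> cond_mean Pb (starts_at gam gb s) (ub T) /\
      cond_var (P eps) (starts_at gam (g eps 0) s) (u eps T) @[eps --> +oo]
        --> cond_var Pb (starts_at gam gb s) (ub T)) /\
    ((forall eps : R, 0 < eps ->
        (0 < Ph eps (starts_at_mode gam (gh eps 0%R) (M eps) s))%E) ->
      cond_mean (Ph eps) (starts_at_mode gam (gh eps 0) (M eps) s) (uh eps T)
        @[eps --> +oo] --> cond_mean Pb (starts_at gam gb s) (ub T) /\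
      cond_var (Ph eps) (starts_at_mode gam (gh eps 0) (M eps) s) (uh eps T)
        @[eps --> +oo] --> cond_var Pb (starts_at gam gb s) (ub T)).
  move=> rs.
  have Pb0 : (0 < Pb (starts_at gam gb s))%E.
    by have [_ -> _ _] := hdMSM; rewrite lte_fin.
  have [c20 [-> ->]] := dMSM_moments hv0 hT hdMSM hub0 Pb0.
  have e0 (eps : R) : 1 <= eps -> 0 < eps by exact: lt_le_trans.
  split=> h.
    apply: (@close_cvg _ _ _ P (fun eps => starts_at gam (g eps 0) s)
      (fun eps => u eps T) _ _ (Num.sqrt (SSM_rate gam lam sigu m0 v0 T s + 1))) => // eps e1.
    exact: (SSM_close hv0 hT e1 hlam (hSSM eps (e0 _ e1)) (hu0 eps (e0 _ e1)) (h _ (e0 _ e1))).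
  apply: (@close_cvg _ _ _ Ph (fun eps => starts_at_mode gam (gh eps 0) (M eps) s)
    (fun eps => uh eps T) _ _ (Num.sqrt (dDSM_rate nu mu sig gam sigu m0 v0 T s + 1))) => // eps e1.
  exact: (dDSM_close hv0 hT e1 hnu (hdDSM eps (e0 _ e1)) (huh0 eps (e0 _ e1)) (h _ (e0 _ e1))).
split.
  move=> s rs; have [h1 h2] := main s rs; split => // l0.
  by apply: h1 => eps e0; rewrite -[X in (_ < X)%E]/(P eps (g eps 0 @^-1` [set gam s])) hg0.
move=> hg hgb hgh hM mixb mix mixh s.
(* The two atoms are distinct by the signs in [hgam], so each singleton carries the weight of a
   single one. *)
have lawE (c : bool) : gamma_infty_law gam lam [set gam c] =
    (lam (~~ c) / (lam false + lam true))%:E.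
  have [h1 h2] := andP hgam.
  have h12 : gam false != gam true by rewrite lt_eqF// (lt_trans h1).
  rewrite /gamma_infty_law !diracE.
  case: c; rewrite (mem_set (erefl : [set gam _] (gam _))) memNset ?mule1 ?mule0 ?adde0 ?add0e//=.
  - by move=> /eqP; rewrite (negbTE h12).
  - by move=> /esym/eqP; rewrite (negbTE h12).
have lawp (c : bool) : (0 < gamma_infty_law gam lam [set gam c])%E.
  by rewrite lawE lte_fin divr_gt0// addr_gt0.
have rs : 0 < rhob s.
  have [_ hr _ _] := hdMSM; rewrite -lte_fin -hr.
  by rewrite -[X in (_ < X)%E]/(Pb (gb @^-1` [set gam s])) hgb.
have [h1 h2] := main s rs.
have [] := h1 _.
  by move=> eps e0; rewrite -[X in (_ < X)%E]/(P eps (g eps 0 @^-1` [set gam s])) hg.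
move=> m1 v1; have [m2 v2] := h2 (fun eps e0 => hM eps s e0).
(* The weights do not merely converge: for every [eps > 0] they equal those of dMSM, all being
   masses of [gamma_infty_law]. *)
have wcvg (f : R -> \bar R) (c : \bar R) : (forall eps, 0 < eps -> f eps = c) ->
    f eps @[eps --> +oo] --> c.
  move=> fc; apply: cvg_near_cst; near=> eps; apply: fc.
  by near: eps; exact: nbhs_pinfty_gt.
split; split => //; apply: wcvg => eps e0.
- rewrite -[LHS]/(P eps (g eps 0 @^-1` [set gam s])).
  by rewrite -[RHS]/(Pb (gb @^-1` [set gam s])) hg// hgb.
- rewrite -[LHS]/(Ph eps (gh eps 0 @^-1` [set gam s])).
  by rewrite -[RHS]/(Pb (gb @^-1` [set gam s])) hgh// hgb.
Unshelve. all: by end_near.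
Qed.
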